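(* $\mathcal{K}^\infty$ is closed under the holomorphic functional calculus: for any $c\in\mathcal{K}^\infty$ and any function $f$ that is holomorphic on an open domain containing the spectrum of $c$ and such that $f(0)=0$, we have $f(c)\in\mathcal{K}^\infty$.
   Context: $H$ is a separable infinite-dimensional complex Hilbert space with a fixed orthonormal basis $\{E_k\}_{k\ge0}$; $P_{k,l}$ is the operator with $P_{k,l}E_l=E_k$ and $P_{k,l}E_m=0$ for $m\ne l$. $\mathcal{K}^\infty$ (smooth compact operators) is the set of operators $c=\sum_{k,l\ge0}c_{k,l}P_{k,l}$ with rapidly decaying coefficients: $\sup_{k,l}(1+k)^M(1+l)^N|c_{k,l}|<\infty$ for all $M,N\ge0$. The spectrum is that of $c$ as a bounded operator on $H$, and $f(c)=\frac1{2\pi i}\int_Cf(\zeta)(\zeta-c)^{-1}d\zeta$ for a contour $C$ around the spectrum. *)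

(* Defs.v *)
From Stdlib Require Import Reals Lra List PeanoNat.
From Stdlib Require Import ClassicalEpsilon FunctionalExtensionality
  PropExtensionality ProofIrrelevance.
From Coquelicot Require Import Coquelicot.
Import ListNotations.

Open Scope R_scope.

(** The inner product is linear in its first argument.  Definiteness and
    positivity follow from [inner_norm], completeness from the base structure. *)
Record HilbertSpace := {
  hs_space :> CompleteNormedModule C_AbsRing;
  inner : hs_space -> hs_space -> C;
  inner_plus_l : forall x y z,
    inner (plus x y) z = Cplus (inner x z) (inner y z);
  inner_scal_l : forall (a : C) x y, inner (scal a x) y = Cmult a (inner x y);
  inner_conj : forall x y, inner y x = Cconj (inner x y);
  inner_norm : forall x, inner x x = RtoC (norm x ^ 2)
}.

Arguments inner {h} _ _.

Lemma inner_plus_r (H : HilbertSpace) (x y z : H) :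
  inner x (plus y z) = Cplus (inner x y) (inner x z).
Proof.
  rewrite (inner_conj H (plus y z) x), inner_plus_l, Cplus_conj.
  now rewrite <- !inner_conj.
Qed.

Lemma inner_scal_r (H : HilbertSpace) (a : C) (x y : H) :
  inner x (scal a y) = Cmult (Cconj a) (inner x y).
Proof.
  rewrite (inner_conj H (scal a y) x), inner_scal_l, Cmult_conj.
  now rewrite <- inner_conj.
Qed.

Lemma hs_triangle (H : HilbertSpace) (x y : H) :
  norm (plus x y) <= norm x + norm y.
Proof. exact (norm_triangle (x : CompleteNormedModule.NormedModule _ H) y). Qed.

Lemma hs_norm_scal (H : HilbertSpace) (a : C) (x : H) :
  norm (scal a x) <= Cmod a * norm x.
Proof. exact (norm_scal a (x : CompleteNormedModule.NormedModule _ H)). Qed.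

Lemma hs_norm_ge_0 (H : HilbertSpace) (x : H) : 0 <= norm x.
Proof. exact (norm_ge_0 (x : CompleteNormedModule.NormedModule _ H)). Qed.

Lemma hs_norm_eq_zero (H : HilbertSpace) (x : H) : norm x = 0 -> x = zero.
Proof. exact (norm_eq_zero (x : CompleteNormedModule.NormedModule _ H)). Qed.

Lemma hs_norm_opp (H : HilbertSpace) (x : H) : norm (opp x) = norm x.
Proof. exact (norm_opp (x : CompleteNormedModule.NormedModule _ H)). Qed.

Lemma hs_norm_compat1 (H : HilbertSpace) (x y : H) (eps : R) :
  norm (minus y x) < eps -> ball x eps y.
Proof.
  exact (norm_compat1 (x : CompleteNormedModule.NormedModule _ H) y eps).
Qed.

Lemma hs_norm_compat2 (H : HilbertSpace) : exists K : R, 0 < K /\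
  forall (x y : H) (eps : posreal), ball x eps y -> norm (minus y x) < K * eps.
Proof.
  exists (norm_factor (V := CompleteNormedModule.NormedModule _ H)); split.
  - apply norm_factor_gt_0.
  - exact (norm_compat2 (V := CompleteNormedModule.NormedModule _ H)).
Qed.

Lemma hs_minus_plus (H : HilbertSpace) (a b : H) : plus (minus a b) b = a.
Proof.
  unfold minus; rewrite <- plus_assoc.
  rewrite (plus_opp_l (G := CompleteNormedModule.AbelianGroup _ H)).
  exact (plus_zero_r (G := CompleteNormedModule.AbelianGroup _ H) a).
Qed.

Lemma hs_minus_eq0 (H : HilbertSpace) (a b : H) : minus a b = zero -> a = b.
Proof.
  intros Hab; rewrite <- (hs_minus_plus H a b), Hab.
  exact (plus_zero_l (G := CompleteNormedModule.AbelianGroup _ H) b).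
Qed.

Lemma hs_minus_trans (H : HilbertSpace) (r x y : H) :
  minus x y = plus (minus x r) (minus r y).
Proof. exact (minus_trans (G := CompleteNormedModule.AbelianGroup _ H) r x y). Qed.

Lemma hs_minus_sym (H : HilbertSpace) (x y : H) :
  norm (minus x y) = norm (minus y x).
Proof.
  rewrite <- hs_norm_opp; f_equal.
  exact (opp_minus (G := CompleteNormedModule.AbelianGroup _ H) x y).
Qed.

Lemma hs_minus_plus2 (H : HilbertSpace) (a b x y : H) :
  minus (plus a b) (plus x y) = plus (minus a x) (minus b y).
Proof.
  unfold minus; rewrite (opp_plus (G := CompleteNormedModule.AbelianGroup _ H)).
  rewrite <- !plus_assoc; f_equal.
  rewrite !plus_assoc; f_equal; apply plus_comm.
Qed.

Lemma hs_scal_minus (H : HilbertSpace) (k : C) (x y : H) :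
  scal k (minus x y) = minus (scal k x) (scal k y).
Proof.
  exact (scal_minus_distr_l (V := CompleteNormedModule.ModuleSpace _ H) k x y).
Qed.

Lemma Re_inner_le (H : HilbertSpace) (x y : H) :
  Re (inner x y) <= norm x * norm y.
Proof.
  assert (Hn : norm (plus x y) ^ 2 <= (norm x + norm y) ^ 2).
  { apply pow_incr; split; [apply hs_norm_ge_0 | apply hs_triangle]. }
  assert (He : RtoC (norm (plus x y) ^ 2) =
     Cplus (Cplus (RtoC (norm x ^ 2)) (inner x y))
           (Cplus (Cconj (inner x y)) (RtoC (norm y ^ 2)))).
  { rewrite <- !inner_norm, inner_plus_l, !inner_plus_r, <- inner_conj.
    reflexivity. }
  apply (f_equal Re) in He.
  destruct (inner x y) as [u v]; simpl in *; lra.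
Qed.

Lemma Cauchy_Schwarz (H : HilbertSpace) (x y : H) :
  Cmod (inner x y) <= norm x * norm y.
Proof.
  pose (a := Cconj (inner x y)).
  assert (Ha : Cmod a = Cmod (inner x y)).
  { unfold a; unfold Cmod, Cconj; simpl; f_equal; ring. }
  pose proof (Re_inner_le H (scal a x) y) as H1.
  rewrite inner_scal_l in H1.
  assert (H2 : Re (Cmult a (inner x y)) = Cmod (inner x y) ^ 2).
  { unfold a, Cmod; rewrite pow2_sqrt.
    - destruct (inner x y); simpl; ring.
    - apply Rplus_le_le_0_compat; apply pow2_ge_0. }
  pose proof (hs_norm_scal H a x) as H3.
  rewrite Ha in H3; rewrite H2 in H1.
  destruct (Req_dec (Cmod (inner x y)) 0) as [E0 | N0].
  - rewrite E0; apply Rmult_le_pos; apply hs_norm_ge_0.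
  - pose proof (Cmod_ge_0 (inner x y)).
    apply Rmult_le_reg_l with (Cmod (inner x y)); [lra|].
    eapply Rle_trans; [|eapply Rle_trans].
    2: exact H1.
    + apply Req_le; ring.
    + rewrite <- Rmult_assoc; apply Rmult_le_compat_r; [apply hs_norm_ge_0 | exact H3].
Qed.

(** Indexing by [nat] makes [H] separable and infinite-dimensional. *)
Definition orthonormal_basis {H : HilbertSpace} (E : nat -> H) : Prop :=
  (forall k l, inner (E k) (E l) = if Nat.eqb k l then RtoC 1 else RtoC 0) /\
  (forall (x : H) (eps : posreal), exists (n : nat) (a : nat -> C),
     norm (minus x (sum_n (fun k => scal (a k) (E k)) n)) < eps).

(** [is_linear] from Coquelicot includes boundedness. *)
Record BOp (H : HilbertSpace) := mkBOp {
  bop :> H -> H;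
  bop_linear : is_linear bop
}.

Arguments mkBOp {H} _ _.
Arguments bop {H} _ _.
Arguments bop_linear {H} _.

Section BoundedOperators.
Context {H : HilbertSpace}.
Implicit Types A B D : BOp H.

Lemma BOp_eq A B : (forall x, A x = B x) -> A = B.
Proof.
  destruct A as [a la], B as [b lb]; simpl; intros Hab.
  assert (a = b) as -> by (apply functional_extensionality; exact Hab).
  f_equal; apply proof_irrelevance.
Qed.

Definition opnorm A : R :=
  real (Glb_Rbar (fun M => 0 <= M /\ forall x, norm (A x) <= M * norm x)).

Lemma opnorm_glb A :
  is_glb_Rbar (fun M => 0 <= M /\ forall x, norm (A x) <= M * norm x)
              (Finite (opnorm A)).
Proof.
  unfold opnorm.
  pose proof (Glb_Rbar_correct
    (fun M => 0 <= M /\ forall x, norm (A x) <= M * norm x)) as Hg.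
  destruct (linear_norm _ (bop_linear A)) as [M0 [HM0 HA]].
  revert Hg; destruct (Glb_Rbar _) as [g | |]; intros Hg; [exact Hg | |].
  - destruct Hg as [Hl _]; specialize (Hl M0 (conj (Rlt_le _ _ HM0) HA)).
    contradiction Hl.
  - destruct Hg as [_ Hb]; specialize (Hb (Finite 0)).
    contradiction Hb; intros M [HM _]; exact HM.
Qed.

Lemma opnorm_ge_0 A : 0 <= opnorm A.
Proof.
  destruct (opnorm_glb A) as [_ Hb]; apply (Hb (Finite 0)).
  intros M [HM _]; exact HM.
Qed.

Lemma opnorm_le A M :
  0 <= M -> (forall x, norm (A x) <= M * norm x) -> opnorm A <= M.
Proof.
  intros HM HA; destruct (opnorm_glb A) as [Hl _].
  exact (Hl M (conj HM HA)).
Qed.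

Lemma opnorm_bound A x : norm (A x) <= opnorm A * norm x.
Proof.
  destruct (Req_dec (norm x) 0) as [E0 | N0].
  - destruct (linear_norm _ (bop_linear A)) as [M0 [_ HA]].
    specialize (HA x); rewrite E0, Rmult_0_r in *; exact HA.
  - pose proof (hs_norm_ge_0 H x) as Hx.
    assert (Hlb : norm (A x) / norm x <= opnorm A).
    { destruct (opnorm_glb A) as [_ Hb].
      apply (Hb (Finite (norm (A x) / norm x))); intros M [_ HM]; simpl.
      apply Rmult_le_reg_r with (norm x); [lra|].
      unfold Rdiv; rewrite Rmult_assoc, Rinv_l, Rmult_1_r by exact N0.
      apply HM. }
    apply Rmult_le_compat_r with (r := norm x) in Hlb; [|exact Hx].
    unfold Rdiv in Hlb; rewrite Rmult_assoc, Rinv_l, Rmult_1_r in Hlb by exact N0.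
    exact Hlb.
Qed.

Lemma op_id_linear : is_linear (fun x : H => x).
Proof. exact is_linear_id. Qed.

Definition op_id : BOp H := mkBOp (fun x => x) op_id_linear.

Definition op_zero : BOp H :=
  mkBOp (fun _ => zero) is_linear_zero.

Lemma op_comp_linear A B : is_linear (fun x => A (B x)).
Proof. apply (is_linear_comp B A); apply bop_linear. Qed.

Definition op_comp A B : BOp H := mkBOp (fun x => A (B x)) (op_comp_linear A B).

Lemma op_plus_linear A B : is_linear (fun x => plus (A x) (B x)).
Proof.
  destruct (bop_linear A) as [Ap As [M [HM Ab]]].
  destruct (bop_linear B) as [Bp Bs [N [HN Bb]]]; split.
  - intros x y; rewrite Ap, Bp, <- !plus_assoc; f_equal.
    rewrite !plus_assoc; f_equal; apply plus_comm.
  - intros k x; rewrite As, Bs; symmetry; apply (scal_distr_l k (A x)).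
  - exists (M + N); split; [lra|]; intros x.
    eapply Rle_trans; [apply hs_triangle|].
    rewrite Rmult_plus_distr_r; apply Rplus_le_compat; auto.
Qed.

Definition op_plus A B : BOp H :=
  mkBOp (fun x => plus (A x) (B x)) (op_plus_linear A B).

Lemma op_scal_linear (a : C) A : is_linear (fun x => scal a (A x) : H).
Proof.
  destruct (bop_linear A) as [Ap As [M [HM Ab]]]; split.
  - intros x y; rewrite Ap; apply (scal_distr_l a (A x)).
  - intros k x; rewrite As, !scal_assoc; f_equal; apply Cmult_comm.
  - exists (Cmod a * M + 1); pose proof (Cmod_ge_0 a) as Ha; split.
    { assert (0 <= Cmod a * M) by (apply Rmult_le_pos; lra); lra. }
    intros x; eapply Rle_trans; [apply hs_norm_scal|].
    pose proof (hs_norm_ge_0 H x).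
    apply Rle_trans with (Cmod a * (M * norm x)).
    + apply Rmult_le_compat_l; auto.
    + rewrite Rmult_plus_distr_r, Rmult_assoc; lra.
Qed.

Definition op_scal (a : C) A : BOp H :=
  mkBOp (fun x => scal a (A x)) (op_scal_linear a A).

Definition op_opp A : BOp H := op_scal (RtoC (-1)) A.

Lemma scal_m1 (x : H) : scal (RtoC (-1)) x = opp x.
Proof.
  replace (RtoC (-1)) with (opp (one : C_Ring)).
  - exact (scal_opp_one (x : CompleteNormedModule.ModuleSpace _ H)).
  - change (Copp (RtoC 1) = RtoC (-1)); now rewrite <- RtoC_opp.
Qed.

(** [BOp H] is a Banach space over [R] for the operator
    norm, which is what [RInt] requires; complex scalars act by [op_scal]. *)

Definition BOp_AbelianMonoid_mixin : AbelianMonoid.mixin_of (BOp H).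
Proof.
  refine (AbelianMonoid.Mixin (BOp H) op_plus op_zero _ _ _).
  - intros A B; apply BOp_eq; intros x; apply plus_comm.
  - intros A B D; apply BOp_eq; intros x; apply plus_assoc.
  - intros A; apply BOp_eq; intros x; apply plus_zero_r.
Defined.

Canonical BOp_AbelianMonoid :=
  AbelianMonoid.Pack (BOp H) BOp_AbelianMonoid_mixin (BOp H).

Definition BOp_AbelianGroup_mixin : AbelianGroup.mixin_of BOp_AbelianMonoid.
Proof.
  refine (AbelianGroup.Mixin BOp_AbelianMonoid op_opp _).
  intros A; apply BOp_eq; intros x; simpl.
  rewrite scal_m1; exact (plus_opp_r (G := CompleteNormedModule.AbelianGroup _ H) (A x)).
Defined.

Canonical BOp_AbelianGroup :=
  AbelianGroup.Pack (BOp H)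
    (AbelianGroup.Class _ BOp_AbelianMonoid_mixin BOp_AbelianGroup_mixin) (BOp H).

Lemma minus_apply A B x : (minus A B : BOp H) x = minus (A x) (B x).
Proof. unfold minus; simpl; now rewrite scal_m1. Qed.

Definition BOp_ModuleSpace_mixin :
  ModuleSpace.mixin_of R_Ring BOp_AbelianGroup.
Proof.
  refine (ModuleSpace.Mixin R_Ring BOp_AbelianGroup
            (fun (r : R) A => op_scal (RtoC r) A) _ _ _ _).
  - intros a b A; apply BOp_eq; intros x; simpl.
    rewrite scal_assoc; f_equal; symmetry; apply RtoC_mult.
  - intros A; apply BOp_eq; intros x; apply (scal_one (A x)).
  - intros a A B; apply BOp_eq; intros x; apply (scal_distr_l (RtoC a) (A x)).
  - intros a b A; apply BOp_eq; intros x; simpl.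
    change (plus a b) with (a + b); rewrite RtoC_plus.
    apply (scal_distr_r (RtoC a) (RtoC b) (A x)).
Defined.

Canonical BOp_ModuleSpace :=
  ModuleSpace.Pack R_Ring (BOp H)
    (ModuleSpace.Class _ _ (AbelianGroup.class BOp_AbelianGroup)
       BOp_ModuleSpace_mixin) (BOp H).

Lemma opnorm_triangle A B : opnorm (plus A B) <= opnorm A + opnorm B.
Proof.
  apply opnorm_le.
  - pose proof (opnorm_ge_0 A); pose proof (opnorm_ge_0 B); lra.
  - intros x; simpl; eapply Rle_trans; [apply hs_triangle|].
    rewrite Rmult_plus_distr_r; apply Rplus_le_compat; apply opnorm_bound.
Qed.

Lemma opnorm_op_scal a A : opnorm (op_scal a A) <= Cmod a * opnorm A.
Proof.
  apply opnorm_le.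
  - apply Rmult_le_pos; [apply Cmod_ge_0 | apply opnorm_ge_0].
  - intros x; simpl; eapply Rle_trans; [apply hs_norm_scal|].
    rewrite Rmult_assoc; apply Rmult_le_compat_l;
      [apply Cmod_ge_0 | apply opnorm_bound].
Qed.

Lemma opnorm_opp A : opnorm (opp A) <= opnorm A.
Proof.
  change (opp A) with (op_scal (RtoC (-1)) A).
  eapply Rle_trans; [apply opnorm_op_scal|].
  rewrite Cmod_R, Rabs_left by lra; lra.
Qed.

Lemma opnorm_minus_sym A B : opnorm (minus A B) = opnorm (minus B A).
Proof.
  apply Rle_antisym.
  - rewrite <- (opp_minus B A); apply opnorm_opp.
  - rewrite <- (opp_minus A B); apply opnorm_opp.
Qed.

Definition op_ball A (eps : R) B : Prop := opnorm (minus B A) < eps.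

Definition BOp_UniformSpace_mixin : UniformSpace.mixin_of (BOp H).
Proof.
  refine (UniformSpace.Mixin (BOp H) zero op_ball _ _ _); unfold op_ball.
  - intros A [e He]; simpl.
    apply Rle_lt_trans with 0; [|exact He].
    apply opnorm_le; [lra|]; intros x.
    rewrite minus_apply, Rmult_0_l.
    rewrite (minus_eq_zero (G := CompleteNormedModule.AbelianGroup _ H)).
    right; exact (norm_zero (V := CompleteNormedModule.NormedModule _ H)).
  - intros A B e; now rewrite opnorm_minus_sym.
  - intros A B D e1 e2 H1 H2.
    rewrite (minus_trans B D A).
    eapply Rle_lt_trans; [apply opnorm_triangle|]; lra.
Defined.

Canonical BOp_UniformSpace :=
  UniformSpace.Pack (BOp H) BOp_UniformSpace_mixin (BOp H).

Canonical BOp_NormedModuleAux :=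
  NormedModuleAux.Pack R_AbsRing (BOp H)
    (NormedModuleAux.Class R_AbsRing (BOp H)
       (ModuleSpace.class _ BOp_ModuleSpace) BOp_UniformSpace_mixin) (BOp H).

Definition BOp_NormedModule_mixin :
  NormedModule.mixin_of R_AbsRing BOp_NormedModuleAux.
Proof.
  refine (NormedModule.Mixin R_AbsRing BOp_NormedModuleAux opnorm 1 _ _ _ _ _).
  - exact opnorm_triangle.
  - intros a A; eapply Rle_trans; [apply (opnorm_op_scal (RtoC a))|].
    rewrite Cmod_R; apply Rle_refl.
  - intros A B eps HAB; exact HAB.
  - intros A B eps HAB; rewrite Rmult_1_l; exact HAB.
  - intros A HA; apply BOp_eq; intros x; simpl.
    apply hs_norm_eq_zero, Rle_antisym; [|apply hs_norm_ge_0].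
    pose proof (opnorm_bound A x) as Hx; rewrite HA in Hx; lra.
Defined.

Canonical BOp_NormedModule :=
  NormedModule.Pack R_AbsRing (BOp H)
    (NormedModule.Class R_AbsRing (BOp H)
       (NormedModuleAux.class _ BOp_NormedModuleAux)
       BOp_NormedModule_mixin) (BOp H).

Definition op_lim (F : (BOp H -> Prop) -> Prop) : BOp H :=
  epsilon (inhabits op_zero) (fun A => forall eps : posreal, F (op_ball A eps)).

Lemma op_cauchy_ex (F : (BOp H -> Prop) -> Prop) :
  ProperFilter F -> cauchy F ->
  exists A : BOp H, forall eps : posreal, F (op_ball A eps).
Proof.
  intros FF HF.
  pose (Fx := fun (x : H) (P : H -> Prop) => F (fun A => P (A x))).
  assert (FFx : forall x, ProperFilter (Fx x)).
  { intros x; exact (filtermap_proper_filter (BOp H) H (fun A => A x) F FF). }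
  assert (small : forall (x : H) (e : posreal), exists d : posreal,
             d * norm x < e).
  { intros x e; pose proof (hs_norm_ge_0 H x) as Hx.
    assert (Hd : 0 < e / (norm x + 1)).
    { apply Rdiv_lt_0_compat; [apply cond_pos | lra]. }
    exists (mkposreal _ Hd); simpl.
    apply Rmult_lt_reg_r with (norm x + 1); [lra|].
    replace (e / (norm x + 1) * norm x * (norm x + 1)) with (e * norm x)
      by (field; lra).
    pose proof (cond_pos e); apply Rmult_lt_compat_l; lra. }
  assert (HFx : forall x, cauchy (Fx x)).
  { intros x e; destruct (small x e) as [d Hd].
    destruct (HF d) as [B HB]; exists (B x); unfold Fx.
    revert HB; apply filter_imp; intros A HA.
    apply hs_norm_compat1; change (op_ball B d A) in HA; unfold op_ball in HA.
    rewrite <- minus_apply.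
    eapply Rle_lt_trans; [apply opnorm_bound|].
    eapply Rle_lt_trans; [|exact Hd].
    apply Rmult_le_compat_r; [apply hs_norm_ge_0 | lra]. }
  pose (L := fun x : H => (lim (T := CompleteNormedModule.CompleteSpace _ H) (Fx x) : H)).
  assert (HL : forall x (e : posreal), F (fun A => norm (minus (A x) (L x)) < e)).
  { intros x e.
    destruct (hs_norm_compat2 H) as [K [HK Hc2]].
    assert (Hd : 0 < e / K).
    { apply Rdiv_lt_0_compat; [apply cond_pos | exact HK]. }
    pose proof (complete_cauchy (T := CompleteNormedModule.CompleteSpace _ H)
                  (Fx x) (FFx x) (HFx x) (mkposreal _ Hd)) as Hc.
    unfold Fx in Hc; revert Hc; apply filter_imp; intros A HA.
    apply Hc2 in HA; simpl in HA.
    replace (K * (e / K)) with (e : R) in HA by (field; lra).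
    exact HA. }
  assert (zeroP : forall z : H, (forall e : posreal, norm z < e) -> z = zero).
  { intros z Hz; apply hs_norm_eq_zero.
    destruct (Rle_lt_or_eq_dec 0 (norm z) (hs_norm_ge_0 H z)) as [Hp | He]; [|auto].
    specialize (Hz (mkposreal _ Hp)); simpl in Hz; lra. }
  assert (close_bound : forall (d : posreal) (B : BOp H) (x : H),
    F (op_ball B d) -> norm (minus (L x) (B x)) <= d * norm x).
  { intros d B x HB; apply Rle_plus_epsilon; intros e He.
    pose proof (filter_and _ _ HB (HL x (mkposreal _ He))) as Hand.
    apply filter_ex in Hand; destruct Hand as [A [HA1 HA2]]; simpl in HA2.
    rewrite (hs_minus_trans H (A x) (L x) (B x)).
    eapply Rle_trans; [apply hs_triangle|].
    rewrite Rplus_comm; apply Rplus_le_compat.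
    - rewrite <- minus_apply; eapply Rle_trans; [apply opnorm_bound|].
      apply Rmult_le_compat_r; [apply hs_norm_ge_0|].
      left; exact HA1.
    - rewrite hs_minus_sym; lra. }
  assert (LL : is_linear L).
  { split.
    - intros x y; apply hs_minus_eq0, zeroP; intros e.
      assert (He : 0 < e / 3) by (pose proof (cond_pos e); lra).
      pose (e3 := mkposreal _ He).
      pose proof (filter_and _ _ (HL (plus x y) e3)
                   (filter_and _ _ (HL x e3) (HL y e3))) as Hand.
      apply filter_ex in Hand; destruct Hand as [A [H1 [H2 H3]]].
      rewrite (linear_plus _ (bop_linear A)) in H1.
      rewrite (hs_minus_trans H (plus (A x) (A y))).
      eapply Rle_lt_trans; [apply hs_triangle|].
      rewrite hs_minus_sym, hs_minus_plus2.
      replace (e : R) with (e3 + (e3 + e3)) by (simpl; lra).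
      apply Rplus_lt_compat; [exact H1|].
      eapply Rle_lt_trans; [apply hs_triangle|].
      apply Rplus_lt_compat; [exact H2 | exact H3].
    - intros k x; apply hs_minus_eq0, zeroP; intros e.
      pose proof (Cmod_ge_0 k) as Hk.
      assert (He : 0 < e / (Cmod k + 2)).
      { apply Rdiv_lt_0_compat; [apply cond_pos | lra]. }
      pose (e3 := mkposreal _ He).
      pose proof (filter_and _ _ (HL (scal k x) e3) (HL x e3)) as Hand.
      apply filter_ex in Hand; destruct Hand as [A [H1 H2]].
      rewrite (linear_scal _ (bop_linear A)) in H1.
      match goal with |- ?u < _ =>
        change u with (norm (minus (L (scal k x)) (scal k (L x) : H) : H)) end.
      rewrite (hs_minus_trans H (scal k (A x))).
      eapply Rle_lt_trans; [apply hs_triangle|].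
      rewrite (hs_minus_sym H (L (scal k x))).
      replace (e : R) with (e3 + (Cmod k + 1) * e3) by (simpl; field; lra).
      apply Rplus_lt_le_compat; [exact H1|].
      apply Rle_trans with (norm (scal k (minus (A x) (L x)) : H)).
      { right; rewrite hs_scal_minus; reflexivity. }
      eapply Rle_trans; [apply hs_norm_scal|].
      pose proof (cond_pos e3) as H3.
      apply Rle_trans with (Cmod k * e3); [|lra].
      apply Rmult_le_compat_l; [exact Hk | left; exact H2].
    - destruct (HF (mkposreal _ Rlt_0_1)) as [B HB].
      change (F (op_ball B 1)) in HB.
      exists (opnorm B + 1); pose proof (opnorm_ge_0 B); split; [lra|].
      intros x.
      pose proof (close_bound (mkposreal _ Rlt_0_1) B x HB) as Hc; simpl in Hc.
      pose proof (opnorm_bound B x).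
      rewrite <- (hs_minus_plus H (L x) (B x)) at 1.
      eapply Rle_trans; [apply hs_triangle|].
      rewrite Rmult_plus_distr_r, Rplus_comm.
      apply Rplus_le_compat; assumption. }
  exists (mkBOp L LL); intros e.
  assert (He : 0 < e / 3) by (pose proof (cond_pos e); lra).
  destruct (HF (mkposreal _ He)) as [B HB].
  pose proof HB as HB'; revert HB'; apply filter_imp; intros A HA.
  unfold op_ball; rewrite (minus_trans B A (mkBOp L LL)).
  eapply Rle_lt_trans; [apply opnorm_triangle|].
  assert (H1 : opnorm (minus B (mkBOp L LL)) <= e / 3).
  { rewrite opnorm_minus_sym; apply opnorm_le; [lra|]; intros x.
    rewrite minus_apply; exact (close_bound (mkposreal _ He) B x HB). }
  change (opnorm (minus A B) < e / 3) in HA.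
  pose proof (cond_pos e); lra.
Qed.

Definition BOp_CompleteSpace_mixin : CompleteSpace.mixin_of BOp_UniformSpace.
Proof.
  refine (CompleteSpace.Mixin BOp_UniformSpace op_lim _ _).
  - intros F FF HF; unfold op_lim.
    apply epsilon_spec; exact (op_cauchy_ex F FF HF).
  - intros F G HFG HGF.
    assert (F = G) as ->.
    { apply functional_extensionality; intros P; apply propositional_extensionality.
      split; [apply HGF | apply HFG]. }
    intros eps; apply ball_center.
Defined.

Canonical BOp_CompleteSpace :=
  CompleteSpace.Pack (BOp H)
    (CompleteSpace.Class (BOp H) BOp_UniformSpace_mixin BOp_CompleteSpace_mixin)
    (BOp H).

Canonical BOp_CompleteNormedModule :=
  CompleteNormedModule.Pack R_AbsRing (BOp H)
    (CompleteNormedModule.Class R_AbsRing (BOp H)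
       (NormedModule.class _ BOp_NormedModule) BOp_CompleteSpace_mixin) (BOp H).

Definition is_inverse A B : Prop :=
  op_comp A B = op_id /\ op_comp B A = op_id.

Definition spectrum (c : BOp H) (z : C) : Prop :=
  ~ exists B, is_inverse (minus (op_scal z op_id) c) B.

(** The resolvent [(z - c)^{-1}]; unspecified when [z] is in the spectrum. *)
Definition resolvent (c : BOp H) (z : C) : BOp H :=
  iota (is_inverse (minus (op_scal z op_id) c)).

Lemma matrix_unit_linear (E : nat -> H) k l :
  is_linear (fun x => scal (inner x (E l)) (E k) : H).
Proof.
  split.
  - intros x y; rewrite inner_plus_l.
    apply (scal_distr_r (inner x (E l)) (inner y (E l)) (E k)).
  - intros a x; rewrite inner_scal_l; symmetry.
    apply (scal_assoc a (inner x (E l)) (E k)).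
  - exists (norm (E l) * norm (E k) + 1).
    pose proof (hs_norm_ge_0 H (E l)) as H1; pose proof (hs_norm_ge_0 H (E k)) as H2.
    pose proof (Rmult_le_pos _ _ H1 H2); split; [lra|]; intros x.
    pose proof (hs_norm_ge_0 H x).
    eapply Rle_trans; [apply hs_norm_scal|].
    apply Rle_trans with (norm x * norm (E l) * norm (E k)).
    + apply Rmult_le_compat_r; [exact H2 | apply Cauchy_Schwarz].
    + rewrite Rmult_plus_distr_r.
      replace (norm x * norm (E l) * norm (E k))
        with (norm (E l) * norm (E k) * norm x) by ring; lra.
Qed.

(** [P_{k,l}], the bounded operator sending [E l] to [E k] and the other basis
    vectors to [0]; see [matrix_unit_spec]. *)
Definition matrix_unit (E : nat -> H) (k l : nat) : BOp H :=
  mkBOp (fun x => scal (inner x (E l)) (E k)) (matrix_unit_linear E k l).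

Lemma matrix_unit_spec (E : nat -> H) k l m : orthonormal_basis E ->
  matrix_unit E k l (E m) = if Nat.eqb m l then E k else zero.
Proof.
  intros [HE _]; simpl; rewrite HE; destruct (Nat.eqb m l).
  - apply (scal_one (E k)).
  - apply (scal_zero_l (E k)).
Qed.

Definition rapid_decay (a : nat -> nat -> C) : Prop :=
  forall M N : nat, exists B : R, forall k l : nat,
    (1 + INR k) ^ M * (1 + INR l) ^ N * Cmod (a k l) <= B.

(** The double series is taken in operator norm along square partial sums; for
    rapidly decaying [a] it converges absolutely. *)
Definition smooth_compact (E : nat -> H) (c : BOp H) : Prop :=
  exists a : nat -> nat -> C,
    rapid_decay a /\
    filterlim
      (fun n => sum_n (fun k =>
                  sum_n (fun l => op_scal (a k l) (matrix_unit E k l)) n) n)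
      eventually (locally c).

End BoundedOperators.

(** A C^1 arc parametrized by [[0,1]]; only its restriction to [[0,1]] is used.
    Requiring derivatives on all of [R] loses no arc, since a C^1 function on
    [[0,1]] (one-sided at the ends) extends affinely. *)
Record arc := {
  arc_fun :> R -> C;
  arc_der : R -> C;
  arc_is_derive : forall t : R,
    is_derive (K := R_AbsRing) (V := C_R_NormedModule) arc_fun t (arc_der t);
  arc_der_continuous : forall t : R,
    continuous (U := C_UniformSpace) arc_der t
}.

(** [chain p s q]: the arcs of [s] join end to end from [p] to [q]. *)
Fixpoint chain (p : C) (s : list arc) (q : C) : Prop :=
  match s with
  | [] => p = q
  | g :: s' => g 0 = p /\ chain (g 1) s' q
  end.

(** Piecewise C^1: no smoothness is required where consecutive arcs join. *)
Definition closed_curve (s : list arc) : Prop :=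
  match s with
  | [] => False
  | g :: _ => chain (g 0) s (g 0)
  end.

(** A contour [G] is a finite family of closed curves, so that it can surround a
    disconnected spectrum. *)
Definition on_contour (G : list (list arc)) (z : C) : Prop :=
  exists (s : list arc) (g : arc) (t : R),
    In s G /\ In g s /\ 0 <= t <= 1 /\ g t = z.

(** The integral of [F] over [G], where [sc] is the complex scalar action on the
    (a priori only real) normed space [V]. *)
Definition contour_integral {V : CompleteNormedModule R_AbsRing}
    (sc : C -> V -> V) (F : C -> V) (G : list (list arc)) : V :=
  fold_right plus zero
    (map (fun g : arc => RInt (fun t => sc (arc_der g t) (F (g t))) 0 1)
       (concat G)).

Definition inv_2pi_i : C := Cinv (Cmult (RtoC (2 * PI)) Ci).

Definition winding_number (G : list (list arc)) (z : C) : C :=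
  Cmult inv_2pi_i
    (contour_integral (V := C_R_CompleteNormedModule) Cmult
       (fun w => Cinv (Cminus w z)) G).

(** [G] is a contour in [Om] around [S]: it lies in [Om] off [S], winds once
    around each point of [S] and zero times around each point outside [Om]. *)
Definition contour_around (G : list (list arc)) (S Om : C -> Prop) : Prop :=
  (forall s, In s G -> closed_curve s) /\
  (forall z, on_contour G z -> Om z /\ ~ S z) /\
  (forall z, S z -> winding_number G z = RtoC 1) /\
  (forall z, ~ Om z -> winding_number G z = RtoC 0).

Definition holomorphic_on (Om : C -> Prop) (f : C -> C) : Prop :=
  forall z : C, Om z ->
    ex_derive (K := C_AbsRing) (V := C_NormedModule) f z.

(** [f(c)] computed along [G], as a Riemann integral in operator norm. *)
Definition hol_calc {H : HilbertSpace} (f : C -> C) (c : BOp H)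
    (G : list (list arc)) : BOp H :=
  op_scal inv_2pi_i
    (contour_integral op_scal (fun z => op_scal (f z) (resolvent c z)) G).

(* Main.v *)
(** The resolvent satisfies [R(z) = 1/z + c/z^2 + c R(z) c / z^2] off the
    spectrum, so [f(c) = lam + mu c + c X c] with [X] bounded, [lam] the
    integral of [f(z)/z] over the contour and [mu] that of [f(z)/z^2], both
    divided by [2 pi i]. The operator [c X c] is smooth compact for every
    bounded [X]: its matrix entries are at most [|row k of c| |X| |column l of
    c|], and its compressions to the span of the first basis vectors converge
    in norm since those of [c] do. It remains that [lam = f(0) = 0], where [0]
    lies in the spectrum because [c E_l] tends to [0]. This is Cauchy's
    theorem for a cycle in an open set, obtained by Dixon's argument: the
    integral over the cycle of the divided difference of [f] extends to an
    entire function that vanishes at infinity. Goursat's lemma gives local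
    primitives, and Cauchy's formula for a primitive shows that [f'] is again
    holomorphic. *)

Require Import Defs.
From Stdlib Require Import Reals List.
From Coquelicot Require Import Coquelicot.
From Stdlib Require Import Lra PeanoNat Compare_dec Classical ClassicalEpsilon.
Import ListNotations.
Local Open Scope R_scope.

(** * Limits and complex derivatives *)

(** Two factors [c] are split off the resolvent so that the remainder has a smoothing factor on each
    side: the left one gives decay in the row index, the right one in the column index, and any
    bounded operator may stand between them. The scalar term is the obstruction. The identity is not
    compact, so [lam] has to vanish exactly, while [mu] may take any value. Since f(0) = 0, the
    integrand f(z)/z is the difference quotient of f at 0, and [lam = 0] is the case z0 = 0 of
    Dixon's statement. A homological form of Cauchy's theorem is called for because the contour is
    described by winding numbers only and [Om] may be disconnected or have holes. Dixon's function
    is differentiated under the integral also where z lies on the cycle; there the z-derivative of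
    the divided difference takes the value f''/2, and its joint continuity rests on that of f''.
    Hence differentiability alone must first be upgraded to a continuous second derivative. All
    uniformity along the cycle comes from a tube lemma stated with filters. *)

Definition clim {T : Type} (F : (T -> Prop) -> Prop) (f : T -> C) (l : C) : Prop :=
  forall eps : R, 0 < eps -> F (fun x => Cmod (f x - l) < eps).

Notation locC := (locally (T := C_UniformSpace)).

(** Balls of [C_UniformSpace] are squares: the square of half-side d contains the disc of radius d,
    and the disc of radius d contains the square of half-side d / sqrt 2. *)
Lemma locally_Cmod (z : C) (P : C -> Prop) :
  locally (T := C_UniformSpace) z P <->
  exists d : R, 0 < d /\ forall w : C, Cmod (w - z) < d -> P w.
Proof.
  split.
  - intros [d Hd]; exists d; split; [apply cond_pos|].
    intros w Hw; apply Hd.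
    exact (C_NormedModule_mixin_compat1 z w d Hw).
  - intros [d [Hd HP]].
    assert (H2 : 0 < d / sqrt 2).
    { apply Rdiv_lt_0_compat; [exact Hd | apply sqrt_lt_R0; lra]. }
    exists (mkposreal _ H2); intros w Hw; apply HP.
    pose proof (C_NormedModule_mixin_compat2 z w _ Hw) as H3; simpl in H3.
    replace (sqrt 2 * (d / sqrt 2)) with d in H3.
    + exact H3.
    + field; apply Rgt_not_eq, sqrt_lt_R0; lra.
Qed.

Lemma clim_filterlim {T : Type} (F : (T -> Prop) -> Prop) (FF : Filter F)
  (f : T -> C) (l : C) :
  clim F f l <-> filterlim f F (locally (T := C_UniformSpace) l).
Proof.
  split.
  - intros Hf P HP; apply locally_Cmod in HP; destruct HP as [d [Hd HP]].
    unfold filtermap; generalize (Hf d Hd); apply filter_imp; intros x; apply HP.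
  - intros Hf eps He; apply (Hf (fun w => Cmod (w - l) < eps)).
    apply locally_Cmod; exists eps; auto.
Qed.

Section Limits.
Context {T : Type} {F : (T -> Prop) -> Prop} {FF : Filter F}.

Lemma clim_const (a : C) : clim F (fun _ => a) a.
Proof.
  intros eps He; apply filter_forall; intros _.
  replace (a - a)%C with (RtoC 0) by ring; now rewrite Cmod_0.
Qed.

Lemma clim_plus (f g : T -> C) (a b : C) :
  clim F f a -> clim F g b -> clim F (fun x => f x + g x)%C (a + b)%C.
Proof.
  intros Hf Hg eps He.
  generalize (filter_and (F := F) _ _ (Hf (eps / 2) ltac:(lra)) (Hg (eps / 2) ltac:(lra))).
  apply filter_imp; intros x [H1 H2].
  replace (f x + g x - (a + b))%C with ((f x - a) + (g x - b))%C by ring.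
  eapply Rle_lt_trans; [apply Cmod_triangle|]; lra.
Qed.

Lemma clim_mult (f g : T -> C) (a b : C) :
  clim F f a -> clim F g b -> clim F (fun x => f x * g x)%C (a * b)%C.
Proof.
  intros Hf Hg eps He.
  pose (K := 1 + Cmod a + Cmod b).
  pose proof (Cmod_ge_0 a); pose proof (Cmod_ge_0 b).
  assert (HK : 0 < K) by (unfold K; lra).
  (* With u = f x - a and v = g x - b the error is u v + u b + a v. If both moduli are below d <= 1,
     it is at most d (1 + |a| + |b|) = d K. *)
  pose (d := Rmin 1 (eps / (2 * K))).
  assert (Hd : 0 < d).
  { apply Rmin_pos; [lra|]; apply Rdiv_lt_0_compat; lra. }
  assert (Hd1 : d <= 1) by apply Rmin_l.
  assert (Hd2 : d * K <= eps / 2).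
  { apply Rle_trans with (eps / (2 * K) * K).
    - apply Rmult_le_compat_r; [lra | apply Rmin_r].
    - right; field; lra. }
  generalize (filter_and (F := F) _ _ (Hf d Hd) (Hg d Hd)).
  apply filter_imp; intros x [H1 H2].
  replace (f x * g x - a * b)%C
    with ((f x - a) * (g x - b) + ((f x - a) * b + a * (g x - b)))%C by ring.
  pose proof (Cmod_ge_0 (f x - a)); pose proof (Cmod_ge_0 (g x - b)).
  eapply Rle_lt_trans; [apply Cmod_triangle|].
  eapply Rle_lt_trans; [apply Rplus_le_compat_l, Cmod_triangle|].
  rewrite !Cmod_mult.
  apply Rle_lt_trans with (d * K); [|lra].
  unfold K; rewrite !Rmult_plus_distr_l, Rmult_1_r.
  assert (Cmod (f x - a) * Cmod (g x - b) <= d * 1) by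
    (apply Rmult_le_compat; lra).
  assert (Cmod (f x - a) * Cmod b <= d * Cmod b) by
    (apply Rmult_le_compat_r; lra).
  assert (Cmod a * Cmod (g x - b) <= Cmod a * d) by
    (apply Rmult_le_compat_l; lra).
  lra.
Qed.

Lemma clim_opp (f : T -> C) (a : C) :
  clim F f a -> clim F (fun x => - f x)%C (- a)%C.
Proof.
  intros Hf eps He; generalize (Hf eps He); apply filter_imp; intros x Hx.
  replace (- f x - - a)%C with (- (f x - a))%C by ring; now rewrite Cmod_opp.
Qed.

Lemma clim_minus (f g : T -> C) (a b : C) :
  clim F f a -> clim F g b -> clim F (fun x => f x - g x)%C (a - b)%C.
Proof. intros Hf Hg; apply clim_plus; [exact Hf | now apply clim_opp]. Qed.

Lemma clim_neq_0 (f : T -> C) (a : C) :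
  clim F f a -> a <> RtoC 0 -> F (fun x => f x <> RtoC 0).
Proof.
  intros Hf Ha; apply Cmod_gt_0 in Ha.
  generalize (Hf _ Ha); apply filter_imp; intros x Hx E0.
  rewrite E0 in Hx; replace (0 - a)%C with (- a)%C in Hx by ring.
  rewrite Cmod_opp in Hx; lra.
Qed.

Lemma clim_inv (f : T -> C) (a : C) :
  clim F f a -> a <> RtoC 0 -> clim F (fun x => / f x)%C (/ a)%C.
Proof.
  intros Hf Ha eps He; pose proof (proj1 (Cmod_gt_0 a) Ha) as Ha'.
  (* The first bound keeps |f x| above |a| / 2; the second leaves eps after division by |f x|
     |a|. *)
  pose (d := Rmin (Cmod a / 2) (eps * (Cmod a * Cmod a) / 2)).
  assert (Hp : 0 < eps * (Cmod a * Cmod a) / 2).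
  { apply Rdiv_lt_0_compat; [|lra]; apply Rmult_lt_0_compat; [lra|].
    now apply Rmult_lt_0_compat. }
  assert (Hd : 0 < d) by (apply Rmin_pos; lra).
  generalize (filter_and (F := F) _ _ (clim_neq_0 f a Hf Ha) (Hf d Hd)).
  apply filter_imp; intros x [Hx0 Hx].
  assert (H1 : Cmod (f x - a) < Cmod a / 2).
  { eapply Rlt_le_trans; [exact Hx | apply Rmin_l]. }
  assert (H2 : Cmod (f x - a) < eps * (Cmod a * Cmod a) / 2).
  { eapply Rlt_le_trans; [exact Hx | apply Rmin_r]. }
  assert (H3 : Cmod a / 2 < Cmod (f x)).
  { pose proof (Cmod_triangle (f x) (- (f x - a))) as H4.
    replace (f x + - (f x - a))%C with a in H4 by ring.
    rewrite Cmod_opp in H4; lra. }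
  replace (/ f x - / a)%C with (- (f x - a) * / (f x * a))%C by (field; auto).
  rewrite Cmod_mult, Cmod_opp, Cmod_inv, Cmod_mult
    by (now apply Cmult_neq_0).
  apply Rmult_lt_reg_r with (Cmod (f x) * Cmod a).
  { apply Rmult_lt_0_compat; lra. }
  rewrite Rmult_assoc, Rinv_l, Rmult_1_r
    by (apply Rgt_not_eq, Rmult_lt_0_compat; lra).
  eapply Rlt_le_trans; [exact H2|].
  replace (eps * (Cmod a * Cmod a) / 2) with (eps * (Cmod a / 2 * Cmod a)) by field.
  apply Rmult_le_compat_l; [lra|]; apply Rmult_le_compat_r; lra.
Qed.

Lemma clim_div (f g : T -> C) (a b : C) :
  clim F f a -> clim F g b -> b <> RtoC 0 ->
  clim F (fun x => f x / g x)%C (a / b)%C.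
Proof. intros Hf Hg Hb; apply clim_mult; [exact Hf | now apply clim_inv]. Qed.

Lemma clim_ext_loc (f g : T -> C) (a : C) :
  F (fun x => f x = g x) -> clim F f a -> clim F g a.
Proof.
  intros He Hf eps Hp; generalize (filter_and (F := F) _ _ He (Hf eps Hp)).
  apply filter_imp; now intros x [-> Hx].
Qed.

Lemma clim_comp {U : Type} (G : (U -> Prop) -> Prop) (h : T -> U) (f : U -> C) (a : C) :
  filterlim h F G -> clim G f a -> clim F (fun x => f (h x)) a.
Proof. intros Hh Hf eps He; exact (Hh _ (Hf eps He)). Qed.

Lemma clim_lim_eq (f : T -> C) (a b : C) : a = b -> clim F f a -> clim F f b.
Proof. now intros ->. Qed.

End Limits.

Lemma clim_id (z : C) : clim (locally (T := C_UniformSpace) z) (fun w => w) z.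
Proof. intros eps He; apply locally_Cmod; exists eps; auto. Qed.

(** Neighbourhoods are not punctured, so the limit is forced to be the value at z. *)
Lemma clim_at_point (f : C -> C) (z a : C) :
  clim (locally (T := C_UniformSpace) z) f a -> f z = a.
Proof.
  intros Hf; apply NNPP; intros Hne.
  assert (Hp : 0 < Cmod (f z - a)).
  { apply Cmod_gt_0; intros E0; apply Hne.
    replace (f z) with ((f z - a) + a)%C by ring; rewrite E0; ring. }
  specialize (Hf _ Hp); apply locally_Cmod in Hf; destruct Hf as [d [Hd Hf]].
  specialize (Hf z); replace (z - z)%C with (RtoC 0) in Hf by ring.
  rewrite Cmod_0 in Hf; specialize (Hf Hd); lra.
Qed.

(** Caratheodory's form of differentiability: the calculus rules become algebra on
    the difference quotient [q]. *)
Definition cderiv (f : C -> C) (z l : C) : Prop :=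
  exists q : C -> C, clim (locally (T := C_UniformSpace) z) q l /\
    locally (T := C_UniformSpace) z (fun w => f w = f z + q w * (w - z))%C.

Lemma cderiv_continuous (f : C -> C) (z l : C) :
  cderiv f z l -> clim (locC z) f (f z).
Proof.
  intros [q [Hq He]].
  apply clim_ext_loc with (fun w => f z + q w * (w - z))%C.
  { revert He; apply filter_imp; intros w; apply eq_sym. }
  apply clim_lim_eq with (f z + l * (z - z))%C; [ring|].
  apply clim_plus; [apply clim_const|]; apply clim_mult; [exact Hq|].
  apply clim_minus; [apply clim_id | apply clim_const].
Qed.

(** The little-o form, used wherever a derivative is established by an estimate rather than by the
    calculus rules. *)
Lemma cderiv_bound (f : C -> C) (z l : C) :
  cderiv f z l <->
  forall eps : R, 0 < eps ->
    locC z (fun w => Cmod (f w - f z - l * (w - z)) <= eps * Cmod (w - z)).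
Proof.
  split.
  - intros [q [Hq He]] eps Hp.
    generalize (filter_and (F := locC z) _ _ He (Hq eps Hp)); apply filter_imp.
    intros w [-> H].
    replace (f z + q w * (w - z) - f z - l * (w - z))%C
      with ((q w - l) * (w - z))%C by ring.
    rewrite Cmod_mult; apply Rmult_le_compat_r; [apply Cmod_ge_0 | lra].
  - intros Hf.
    (* The value l at w = z makes the difference quotient continuous there. *)
    exists (fun w => if excluded_middle_informative (w = z) then l
                     else ((f w - f z) / (w - z))%C); split.
    + intros eps Hp; generalize (Hf (eps / 2) ltac:(lra)); apply filter_imp.
      intros w Hw; cbv beta.
      destruct excluded_middle_informative as [-> | Hne].
      * replace (l - l)%C with (RtoC 0) by ring; now rewrite Cmod_0.
      * assert (Hwz : (w - z)%C <> RtoC 0).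
        { intros E0; apply Hne.
          replace w with ((w - z) + z)%C by ring; rewrite E0; ring. }
        pose proof (proj1 (Cmod_gt_0 _) Hwz) as Hpos.
        replace ((f w - f z) / (w - z) - l)%C
          with ((f w - f z - l * (w - z)) / (w - z))%C by (field; exact Hwz).
        rewrite Cmod_div by exact Hwz.
        apply Rmult_lt_reg_r with (Cmod (w - z)); [exact Hpos|].
        unfold Rdiv; rewrite Rmult_assoc, Rinv_l, Rmult_1_r by lra.
        eapply Rle_lt_trans; [exact Hw|]; apply Rmult_lt_compat_r; lra.
    + apply filter_forall; intros w; cbv beta.
      destruct excluded_middle_informative as [-> | Hne]; [ring|].
      field; intros E0; apply Hne.
      replace w with ((w - z) + z)%C by ring; rewrite E0; ring.
Qed.

Lemma is_derive_cderiv (f : C -> C) (z l : C) :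
  is_derive (K := C_AbsRing) (V := C_NormedModule) f z l -> cderiv f z l.
Proof.
  intros [_ Hd]; apply cderiv_bound; intros eps He.
  specialize (Hd z (fun P HP => HP) (mkposreal eps He)).
  destruct Hd as [d Hd]; apply locally_Cmod; exists d; split; [apply cond_pos|].
  intros w Hw; specialize (Hd w Hw); simpl in Hd.
  replace (f w - f z - l * (w - z))%C with (f w - f z - (w - z) * l)%C by ring.
  exact Hd.
Qed.

Lemma cderiv_ext_loc (f g : C -> C) (z l : C) :
  locC z (fun w => f w = g w) -> cderiv f z l -> cderiv g z l.
Proof.
  intros He [q [Hq Hf]]; exists q; split; [exact Hq|].
  pose proof (locally_singleton z _ He) as E0; simpl in E0.
  generalize (filter_and (F := locC z) _ _ He Hf); apply filter_imp.
  intros w [<- ->]; now rewrite E0.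
Qed.

Lemma cderiv_eq (f : C -> C) (z l l' : C) : l = l' -> cderiv f z l -> cderiv f z l'.
Proof. now intros ->. Qed.

Lemma cderiv_const (a z : C) : cderiv (fun _ => a) z (RtoC 0).
Proof.
  exists (fun _ => RtoC 0); split; [apply clim_const|].
  apply filter_forall; intros w; change C in w; simpl; ring.
Qed.

Lemma cderiv_id (z : C) : cderiv (fun w => w) z (RtoC 1).
Proof.
  exists (fun _ => RtoC 1); split; [apply clim_const|].
  apply filter_forall; intros w; change C in w; simpl; ring.
Qed.

Lemma cderiv_plus (f g : C -> C) (z a b : C) :
  cderiv f z a -> cderiv g z b -> cderiv (fun w => f w + g w)%C z (a + b)%C.
Proof.
  intros [p [Hp Hf]] [q [Hq Hg]]; exists (fun w => p w + q w)%C; split.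
  - now apply clim_plus.
  - generalize (filter_and (F := locC z) _ _ Hf Hg); apply filter_imp; intros w [-> ->]; ring.
Qed.

Lemma cderiv_mult (f g : C -> C) (z a b : C) :
  cderiv f z a -> cderiv g z b ->
  cderiv (fun w => f w * g w)%C z (a * g z + f z * b)%C.
Proof.
  intros Df Dg; pose proof (cderiv_continuous _ _ _ Dg) as Cg.
  destruct Df as [p [Hp Hf]]; destruct Dg as [q [Hq Hg]].
  exists (fun w => p w * g w + f z * q w)%C; split.
  - apply clim_plus; apply clim_mult; try assumption; apply clim_const.
  - generalize (filter_and (F := locC z) _ _ Hf Hg); apply filter_imp; intros w [-> ->]; ring.
Qed.

Lemma cderiv_opp (f : C -> C) (z a : C) :
  cderiv f z a -> cderiv (fun w => - f w)%C z (- a)%C.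
Proof.
  intros [p [Hp Hf]]; exists (fun w => - p w)%C; split; [now apply clim_opp|].
  revert Hf; apply filter_imp; intros w ->; ring.
Qed.

Lemma cderiv_minus (f g : C -> C) (z a b : C) :
  cderiv f z a -> cderiv g z b -> cderiv (fun w => f w - g w)%C z (a - b)%C.
Proof. intros Hf Hg; apply cderiv_plus; [exact Hf | now apply cderiv_opp]. Qed.

Lemma cderiv_inv (f : C -> C) (z a : C) :
  cderiv f z a -> f z <> RtoC 0 ->
  cderiv (fun w => / f w)%C z (- a / (f z * f z))%C.
Proof.
  intros Df Hz; pose proof (cderiv_continuous _ _ _ Df) as Cf.
  destruct Df as [p [Hp Hf]].
  exists (fun w => - p w / (f w * f z))%C; split.
  - apply clim_div; [now apply clim_opp | | now apply Cmult_neq_0].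
    apply clim_mult; [exact Cf | apply clim_const].
  - generalize (filter_and (F := locC z) _ _ Hf (clim_neq_0 _ _ Cf Hz)); apply filter_imp.
    intros w [He Hw].
    transitivity (/ f z + - (p w * (w - z)) / (f w * f z))%C; [|field; auto].
    replace (p w * (w - z))%C with (f w - f z)%C by (rewrite He; ring).
    field; auto.
Qed.

Lemma cderiv_comp (f g : C -> C) (z a b : C) :
  cderiv g z b -> cderiv f (g z) a -> cderiv (fun w => f (g w)) z (a * b)%C.
Proof.
  intros Dg; pose proof (cderiv_continuous _ _ _ Dg) as Cg.
  apply clim_filterlim in Cg; [|apply locally_filter].
  destruct Dg as [q [Hq Hg]]; intros [p [Hp Hf]].
  exists (fun w => p (g w) * q w)%C; split.
  - apply clim_mult; [|exact Hq]; exact (clim_comp _ _ _ _ Cg Hp).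
  - generalize (filter_and (F := locC z) _ _ Hg (Cg _ Hf)); unfold filtermap.
    apply filter_imp; intros w [H1 ->]; rewrite H1 at 2; ring.
Qed.

Lemma cderiv_unique (f : C -> C) (z a b : C) : cderiv f z a -> cderiv f z b -> a = b.
Proof.
  intros Ha Hb; apply NNPP; intros Hne.
  assert (Hp : 0 < Cmod (a - b)).
  { apply Cmod_gt_0; intros E0; apply Hne.
    replace a with ((a - b) + b)%C by ring; rewrite E0; ring. }
  rewrite cderiv_bound in Ha, Hb.
  specialize (Ha (Cmod (a - b) / 4) ltac:(lra)).
  specialize (Hb (Cmod (a - b) / 4) ltac:(lra)).
  pose proof (filter_and (F := locC z) _ _ Ha Hb) as H; apply locally_Cmod in H.
  destruct H as [d [Hd H]].
  (* At distance d / 2 the two errors add up to at most half of |a - b| d / 2, which is the modulus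
     of their difference. *)
  pose (w := (z + RtoC (d / 2))%C).
  assert (Hw : Cmod (w - z) = d / 2).
  { unfold w; replace (z + RtoC (d / 2) - z)%C with (RtoC (d / 2)) by ring.
    rewrite Cmod_R, Rabs_pos_eq; lra. }
  destruct (H w) as [H1 H2]; [lra|].
  pose proof (Cmod_triangle (f w - f z - b * (w - z)) (- (f w - f z - a * (w - z)))) as H3.
  rewrite Cmod_opp in H3.
  replace (f w - f z - b * (w - z) + - (f w - f z - a * (w - z)))%C
    with ((a - b) * (w - z))%C in H3 by ring.
  rewrite Cmod_mult, Hw in H3; rewrite Hw in H1, H2.
  assert (0 < Cmod (a - b) * d) by now apply Rmult_lt_0_compat.
  lra.
Qed.

(** * Integration along arcs *)

Notation is_derive_R := (is_derive (K := R_AbsRing) (V := C_R_NormedModule)).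

Lemma scal_C_R (r : R) (z : C) : scal (V := C_R_NormedModule) r z = (z * RtoC r)%C.
Proof.
  destruct z as [x y]; unfold scal; simpl; unfold prod_scal, scal; simpl.
  unfold mult, Cmult; simpl; f_equal; ring.
Qed.

(** The same form for curves, so that the chain rule for a complex function along a curve is a
    product of two quotients. *)
Lemma is_derive_caratheodory (f : R -> C) (t : R) (d : C) :
  is_derive_R f t d <->
  exists q : R -> C, clim (locally t) q d /\
    locally t (fun s => f s = f t + q s * RtoC (s - t))%C.
Proof.
  split.
  - intros [_ Hd]; specialize (Hd t (fun P HP => HP)).
    exists (fun s => if excluded_middle_informative (s = t) then d
                     else ((f s - f t) / RtoC (s - t))%C); split.
    + intros eps He.
      assert (He2 : 0 < eps / 2) by lra.
      generalize (Hd (mkposreal _ He2)); apply filter_imp; intros s Hs; simpl in Hs.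
      destruct excluded_middle_informative as [-> | Hne].
      * replace (d - d)%C with (RtoC 0) by ring; now rewrite Cmod_0.
      * rewrite scal_C_R, <- Cmod_norm in Hs.
        assert (Hst : RtoC (s - t) <> RtoC 0) by (intros E0; apply RtoC_inj in E0; lra).
        pose proof (proj1 (Cmod_gt_0 _) Hst) as Hpos.
        replace ((f s - f t) / RtoC (s - t) - d)%C
          with ((f s - f t - d * RtoC (s - t)) / RtoC (s - t))%C by (field; exact Hst).
        rewrite Cmod_div by exact Hst.
        apply Rmult_lt_reg_r with (Cmod (RtoC (s - t))); [exact Hpos|].
        unfold Rdiv; rewrite Rmult_assoc, Rinv_l, Rmult_1_r by lra.
        eapply Rle_lt_trans; [exact Hs|].
        rewrite Cmod_R in *; change (norm (minus s t)) with (Rabs (s - t)).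
        apply Rmult_lt_compat_r; lra.
    + apply filter_forall; intros s.
      destruct excluded_middle_informative as [-> | Hne].
      * replace (t - t) with 0 by ring; ring.
      * field; intros E0; apply RtoC_inj in E0; lra.
  - intros [q [Hq Hf]]; split; [apply is_linear_scal_l|].
    intros x Hx eps.
    pose proof (is_filter_lim_locally_unique (V := R_NormedModule) t x Hx); subst x.
    generalize (filter_and (F := locally t) _ _ Hf (Hq eps (cond_pos eps))).
    apply filter_imp; intros s [H1 H2].
    rewrite scal_C_R, <- Cmod_norm.
    match goal with |- Cmod ?u <= _ =>
      replace u with ((q s - d) * RtoC (s - t))%C end.
    + rewrite Cmod_mult, Cmod_R; change (norm (minus s t)) with (Rabs (s - t)).
      apply Rmult_le_compat_r; [apply Rabs_pos | lra].
    + change ((q s - d) * RtoC (s - t) = f s - f t - d * RtoC (s - t))%C.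
      rewrite H1; ring.
Qed.

Lemma is_derive_R_continuous (f : R -> C) (t : R) (d : C) :
  is_derive_R f t d -> clim (locally t) f (f t).
Proof.
  intros Hd; apply is_derive_caratheodory in Hd; destruct Hd as [q [Hq Hf]].
  apply clim_ext_loc with (fun s => f t + q s * RtoC (s - t))%C.
  { revert Hf; apply filter_imp; intros s; apply eq_sym. }
  apply clim_lim_eq with (f t + d * RtoC (t - t))%C.
  { replace (t - t) with 0 by ring; ring. }
  apply clim_plus; [apply clim_const|]; apply clim_mult; [exact Hq|].
  intros eps He; exists (mkposreal eps He); intros s Hs.
  rewrite <- RtoC_minus, Cmod_R.
  replace (s - t - (t - t)) with (s - t) by ring; exact Hs.
Qed.

Lemma is_derive_R_comp (F : C -> C) (f : R -> C) (t : R) (l d : C) :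
  is_derive_R f t d -> cderiv F (f t) l ->
  is_derive_R (fun s => F (f s)) t (l * d)%C.
Proof.
  intros Hd; pose proof (is_derive_R_continuous _ _ _ Hd) as Cf.
  apply clim_filterlim in Cf; [|apply locally_filter].
  apply is_derive_caratheodory in Hd; destruct Hd as [q [Hq Hf]].
  intros [p [Hp HF]]; apply is_derive_caratheodory.
  exists (fun s => p (f s) * q s)%C; split.
  - apply clim_mult; [|exact Hq]; exact (clim_comp _ _ _ _ Cf Hp).
  - generalize (filter_and (F := locally t) _ _ Hf (Cf _ HF)); unfold filtermap.
    apply filter_imp; intros s [H1 ->]; rewrite H1 at 2; ring.
Qed.

(** * Compactness of the parameter interval *)

Definition I01 (t : R) : Prop := 0 <= t <= 1.

Lemma clim_locally_within {T : Type} (F : (T -> Prop) -> Prop) (FF : Filter F)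
  (D : T -> Prop) (f : T -> C) (l : C) :
  clim F f l -> clim (within D F) f l.
Proof.
  intros Hf eps He; unfold within; generalize (Hf eps He).
  apply filter_imp; auto.
Qed.

Definition clamp (t : R) : R := Rmax 0 (Rmin 1 t).

Lemma clamp_I01 (t : R) : I01 (clamp t).
Proof.
  unfold I01, clamp; split; [apply Rmax_l|].
  apply Rmax_lub; [lra | apply Rmin_l].
Qed.

Lemma clamp_id (t : R) : I01 t -> clamp t = t.
Proof.
  intros [H0 H1]; unfold clamp; rewrite Rmin_right by exact H1.
  now rewrite Rmax_right.
Qed.

Lemma clamp_lipschitz (s t : R) : Rabs (clamp s - clamp t) <= Rabs (s - t).
Proof.
  unfold clamp, Rmax, Rmin.
  destruct (Rle_dec 1 s), (Rle_dec 1 t); repeat destruct Rle_dec;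
    unfold Rabs; repeat destruct Rcase_abs; lra.
Qed.

(** The integrands are controlled on the interval only. Composition with the retraction [clamp] is
    continuous at every real and changes nothing on the interval. *)
Lemma within_continuous_ex_RInt {V : CompleteNormedModule R_AbsRing} (f : R -> V) :
  (forall t, I01 t -> filterlim f (within I01 (locally t)) (locally (f t))) ->
  ex_RInt f 0 1.
Proof.
  intros Hf; apply ex_RInt_ext with (fun t => f (clamp t)).
  - rewrite Rmin_left, Rmax_right by lra; intros t Ht.
    now rewrite clamp_id by (unfold I01; lra).
  - apply ex_RInt_continuous; intros t _.
    apply filterlim_comp with (within I01 (locally (clamp t))).
    + intros P [d Hd]; exists d; intros s Hs; apply Hd; [|apply clamp_I01].
      eapply Rle_lt_trans; [apply clamp_lipschitz | exact Hs].
    + apply Hf, clamp_I01.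
Qed.

Lemma Riemann_sum_linear {U V : NormedModule R_AbsRing} (A : U -> V) (f : R -> U) :
  is_linear A -> forall ptd,
  Riemann_sum (fun t => A (f t)) ptd = A (Riemann_sum f ptd).
Proof.
  intros HA ptd; pattern ptd; apply SF_cons_ind; clear ptd.
  - intros x; simpl; symmetry; apply (linear_zero A HA).
  - intros h s IH; rewrite !Riemann_sum_cons, IH.
    now rewrite (linear_plus A HA), (linear_scal A HA).
Qed.

(** A bounded linear map commutes with Riemann sums, hence with their limit. This later carries the
    integral through z -> z T and T -> c T c. *)
Lemma is_RInt_linear {U V : NormedModule R_AbsRing} (A : U -> V) (f : R -> U)
  (a b : R) (If : U) :
  is_linear A -> is_RInt f a b If -> is_RInt (fun t => A (f t)) a b (A If).
Proof.
  intros HA Hf.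
  apply filterlim_ext with (fun ptd => A (scal (sign (b - a)) (Riemann_sum f ptd))).
  - intros ptd; rewrite (linear_scal A HA), (Riemann_sum_linear A f HA); reflexivity.
  - eapply filterlim_comp; [exact Hf|]; exact (linear_cont A If HA).
Qed.

(** The tube lemma.  The filter in the other variable also serves to bound functions
    on an arc and to separate an arc from a point. *)
Lemma tube_I01 {T : Type} (F : (T -> Prop) -> Prop) (FF : Filter F)
  (P : T -> R -> Prop) :
  (forall t, I01 t ->
     filter_prod F (within I01 (locally t)) (fun p => P (fst p) (snd p))) ->
  F (fun z => forall t, I01 t -> P z t).
Proof.
  intros HP.
  (* Supremum argument in place of finite covers: a neighbourhood of m = sup S absorbs an interval
     beyond m, so S contains min 1 (m + d / 2), which forces that number to be 1. *)
  pose (S := fun x => I01 x /\ F (fun z => forall t, 0 <= t <= x -> P z t)).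
  assert (Hloc : forall t, I01 t -> exists d, 0 < d /\ exists Q, F Q /\
            forall z s, Q z -> I01 s -> Rabs (s - t) < d -> P z s).
  { intros t Ht; destruct (HP t Ht) as [Q D HQ [d Hd] HPQ].
    exists d; split; [apply cond_pos|]; exists Q; split; [exact HQ|].
    intros z s Hz Hs Hst; exact (HPQ z s Hz (Hd s Hst Hs)). }
  assert (S0 : S 0).
  { split; [unfold I01; lra|].
    destruct (Hloc 0 ltac:(unfold I01; lra)) as [d [Hd [Q [HQ H]]]].
    revert HQ; apply filter_imp; intros z Hz t Ht; apply H; auto.
    - unfold I01; lra.
    - replace (t - 0) with 0 by lra; now rewrite Rabs_R0. }
  destruct (completeness S) as [m [Hub Hlub]].
  { exists 1; intros x [[_ Hx] _]; exact Hx. }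
  { now exists 0. }
  assert (Hm : I01 m).
  { split; [now apply Hub | apply Hlub; intros x [[_ Hx] _]; exact Hx]. }
  destruct (Hloc m Hm) as [d [Hd [Q [HQ H]]]].
  assert (Hx : exists x, S x /\ m - d < x).
  { apply NNPP; intros Hn.
    assert (is_upper_bound S (m - d)).
    { intros x Sx; apply Rnot_lt_le; intros Hx; apply Hn; eauto. }
    specialize (Hlub _ H0); lra. }
  destruct Hx as [x [[Hx Fx] Hmx]].
  pose (y := Rmin 1 (m + d / 2)).
  assert (Sy : S y).
  { split.
    - unfold I01, y; split; [apply Rmin_glb; unfold I01 in Hm; lra | apply Rmin_l].
    - generalize (filter_and (F := F) _ _ Fx HQ); apply filter_imp.
      intros z [H1 H2] t Ht; destruct (Rle_dec t x) as [Htx | Htx]; [apply H1; lra|].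
      pose proof (Rmin_l 1 (m + d / 2)); pose proof (Rmin_r 1 (m + d / 2)).
      fold y in H0, H3; apply H; [exact H2 | unfold I01; lra |].
      apply Rabs_def1; lra. }
  assert (Hy1 : y = 1).
  { pose proof (Hub y Sy) as Hym; unfold y, Rmin in *.
    destruct Rle_dec; [reflexivity | lra]. }
  rewrite Hy1 in Sy; destruct Sy as [_ Sy].
  exact Sy.
Qed.

Definition trace (l : list arc) (w : C) : Prop :=
  exists (g : arc) (t : R), In g l /\ I01 t /\ g t = w.

Lemma trace_in (l : list arc) (g : arc) (t : R) : In g l -> I01 t -> trace l (g t).
Proof. intros Hg Ht; now exists g, t. Qed.

Lemma arc_continuous (l : list arc) (g : arc) (t : R) : In g l ->
  filterlim g (within I01 (locally t)) (within (trace l) (locC (g t))).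
Proof.
  intros Hg P HP.
  pose proof (is_derive_R_continuous _ _ _ (arc_is_derive g t)) as Cg.
  apply clim_filterlim in Cg; [|apply locally_filter].
  unfold filtermap, within; generalize (Cg _ HP); unfold filtermap.
  apply filter_imp; intros s Hs Hs'; apply Hs; now apply trace_in.
Qed.

Lemma tube_trace {T : Type} (F : (T -> Prop) -> Prop) (FF : Filter F)
  (l : list arc) (P : T -> C -> Prop) :
  (forall w, trace l w ->
     filter_prod F (within (trace l) (locC w)) (fun p => P (fst p) (snd p))) ->
  F (fun z => forall w, trace l w -> P z w).
Proof.
  intros HP.
  (* The induction runs over sublists of [l], so that the neighbourhoods stay relative to the trace
     of the whole list. *)
  assert (Hg : forall l', (forall g, In g l' -> In g l) ->
            F (fun z => forall g t, In g l' -> I01 t -> P z (g t))).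
  { induction l' as [|g l' IH]; intros Hl.
    - apply filter_forall; intros z g t [].
    - assert (H1 : F (fun z => forall t, I01 t -> P z (g t))).
      { apply (tube_I01 F FF (fun z t => P z (g t))); intros t Ht.
        destruct (HP (g t)) as [Q D HQ HD HQD].
        { apply trace_in; [apply Hl; now left | exact Ht]. }
        apply (Filter_prod _ _ _ Q (fun s => D (g s)) HQ).
        - exact (arc_continuous l g t (Hl g (or_introl eq_refl)) D HD).
        - intros z s Hz Hs; exact (HQD z (g s) Hz Hs). }
      assert (H2 := IH (fun g' Hg' => Hl g' (or_intror Hg'))).
      generalize (filter_and (F := F) _ _ H1 H2); apply filter_imp.
      intros z [K1 K2] g' t [<- | Hg'] Ht; auto. }
  generalize (Hg l (fun g Hg => Hg)); apply filter_imp.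
  intros z Hz w [g [t [H1 [H2 <-]]]]; auto.
Qed.

(** The integral over a list of arcs; [contour_integral sc F G] is
    [path_integral sc F (concat G)]. *)
Definition path_integral {V : CompleteNormedModule R_AbsRing}
    (sc : C -> V -> V) (F : C -> V) (l : list arc) : V :=
  fold_right plus zero
    (map (fun g : arc => RInt (fun t => sc (arc_der g t) (F (g t))) 0 1) l).

Definition path_integrable {V : CompleteNormedModule R_AbsRing}
    (sc : C -> V -> V) (F : C -> V) (l : list arc) : Prop :=
  forall g, In g l -> ex_RInt (fun t => sc (arc_der g t) (F (g t))) 0 1.

(** The modules are real, so complex linearity of [A] appears as compatibility with the two complex
    actions [scU] and [scV]. *)
Lemma path_integral_linear {U V : CompleteNormedModule R_AbsRing}
  (scU : C -> U -> U) (scV : C -> V -> V) (A : U -> V) (F : C -> U) (l : list arc) :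
  is_linear A -> (forall a x, A (scU a x) = scV a (A x)) ->
  path_integrable scU F l ->
  path_integrable scV (fun w => A (F w)) l /\
  path_integral scV (fun w => A (F w)) l = A (path_integral scU F l).
Proof.
  intros HA Hsc HF.
  assert (Hg : forall g, In g l ->
    is_RInt (fun t => scV (arc_der g t) (A (F (g t)))) 0 1
      (A (RInt (fun t => scU (arc_der g t) (F (g t))) 0 1))).
  { intros g Hg.
    apply is_RInt_ext with (fun t => A (scU (arc_der g t) (F (g t)))).
    - intros t _; apply Hsc.
    - apply (is_RInt_linear A); [exact HA|]; apply (RInt_correct (V := U)), HF, Hg. }
  split.
  - intros g Hgl; eexists; apply (Hg g Hgl).
  - clear HF; unfold path_integral; induction l as [|g l IH]; simpl.
    + symmetry; apply (linear_zero A HA).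
    + etransitivity; [|symmetry; apply (linear_plus A HA)].
      apply f_equal2; [apply is_RInt_unique, Hg; now left|].
      apply IH; intros; apply Hg; now right.
Qed.

Lemma path_integral_plus {V : CompleteNormedModule R_AbsRing}
  (sc : C -> V -> V) (F K : C -> V) (l : list arc) :
  (forall a x y, sc a (plus x y) = plus (sc a x) (sc a y)) ->
  path_integrable sc F l -> path_integrable sc K l ->
  path_integrable sc (fun w => plus (F w) (K w)) l /\
  path_integral sc (fun w => plus (F w) (K w)) l =
    plus (path_integral sc F l) (path_integral sc K l).
Proof.
  intros Hsc HF HK.
  assert (Hg : forall g, In g l ->
    is_RInt (fun t => sc (arc_der g t) (plus (F (g t)) (K (g t)))) 0 1
      (plus (RInt (fun t => sc (arc_der g t) (F (g t))) 0 1)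
            (RInt (fun t => sc (arc_der g t) (K (g t))) 0 1))).
  { intros g Hg.
    apply is_RInt_ext with
      (fun t => plus (sc (arc_der g t) (F (g t))) (sc (arc_der g t) (K (g t)))).
    - intros t _; now rewrite Hsc.
    - apply (is_RInt_plus (V := CompleteNormedModule.NormedModule _ V));
        apply (RInt_correct (V := V)); [apply HF | apply HK]; exact Hg. }
  split.
  - intros g Hgl; eexists; apply (Hg g Hgl).
  - clear HF HK; unfold path_integral; induction l as [|g l IH]; simpl.
    + symmetry; apply plus_zero_r.
    + etransitivity.
      { apply f_equal2; [apply is_RInt_unique, Hg; now left|].
        apply IH; intros; apply Hg; now right. }
      rewrite <- !plus_assoc; f_equal.
      rewrite !plus_assoc; f_equal; apply plus_comm.
Qed.

Lemma path_integral_ext {V : CompleteNormedModule R_AbsRing}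
  (sc : C -> V -> V) (F K : C -> V) (l : list arc) :
  (forall w, trace l w -> F w = K w) ->
  path_integral sc F l = path_integral sc K l.
Proof.
  intros HFK; unfold path_integral; f_equal; apply map_ext_in; intros g Hg.
  apply RInt_ext; rewrite Rmin_left, Rmax_right by lra; intros t Ht.
  rewrite HFK; [reflexivity|]; apply trace_in; [exact Hg | unfold I01; lra].
Qed.

Definition cint (F : C -> C) (l : list arc) : C :=
  path_integral (V := C_R_CompleteNormedModule) Cmult F l.

(** Continuity relative to the trace is what integrability along the arcs uses, and it makes sense
    for integrands that are controlled only there. *)
Definition path_continuous (l : list arc) (F : C -> C) : Prop :=
  forall w, trace l w -> clim (within (trace l) (locC w)) F (F w).

Lemma path_continuous_sub (l l' : list arc) (F : C -> C) :
  (forall g, In g l' -> In g l) -> path_continuous l F -> path_continuous l' F.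
Proof.
  intros Hl HF w [g [t [Hg [Ht <-]]]] eps He.
  specialize (HF (g t) (trace_in l g t (Hl g Hg) Ht) eps He).
  unfold within in *; revert HF; apply filter_imp.
  intros z Hz [g' [t' [Hg' [Ht' <-]]]]; apply Hz, trace_in; auto.
Qed.

Lemma continuous_path_continuous (l : list arc) (F : C -> C) :
  (forall w, trace l w -> clim (locC w) F (F w)) -> path_continuous l F.
Proof. intros HF w Hw; apply clim_locally_within; [apply locally_filter | auto]. Qed.

Lemma arc_clim (l : list arc) (F : C -> C) (g : arc) (t : R) :
  path_continuous l F -> In g l -> I01 t ->
  clim (within I01 (locally t)) (fun s => F (g s)) (F (g t)).
Proof.
  intros HF Hg Ht; apply (clim_comp _ _ _ _ (arc_continuous l g t Hg)).
  apply HF; now apply trace_in.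
Qed.

Lemma arc_der_clim (g : arc) (t : R) : clim (locally t) (arc_der g) (arc_der g t).
Proof. apply clim_filterlim; [apply locally_filter | apply arc_der_continuous]. Qed.

Lemma path_continuous_integrable (l : list arc) (F : C -> C) :
  path_continuous l F ->
  path_integrable (V := C_R_CompleteNormedModule) Cmult F l.
Proof.
  intros HF g Hg; apply within_continuous_ex_RInt; intros t Ht.
  apply (clim_filterlim (within I01 (locally t)) _ (fun s => arc_der g s * F (g s))%C).
  apply clim_mult.
  - apply clim_locally_within; [apply locally_filter | apply arc_der_clim].
  - now apply arc_clim with l.
Qed.

Lemma cint_ext (F K : C -> C) (l : list arc) :
  (forall w, trace l w -> F w = K w) -> cint F l = cint K l.
Proof. exact (path_integral_ext (V := C_R_CompleteNormedModule) Cmult F K l). Qed.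

Lemma cint_plus (F K : C -> C) (l : list arc) :
  path_continuous l F -> path_continuous l K ->
  cint (fun w => F w + K w)%C l = (cint F l + cint K l)%C.
Proof.
  intros HF HK; apply (path_integral_plus (V := C_R_CompleteNormedModule) Cmult).
  - intros; apply Cmult_plus_distr_l.
  - now apply path_continuous_integrable.
  - now apply path_continuous_integrable.
Qed.

Lemma Cmult_R_linear (a : C) :
  is_linear (U := C_R_NormedModule) (V := C_R_NormedModule) (fun z => a * z)%C.
Proof.
  split.
  - intros x y; apply Cmult_plus_distr_l.
  - intros k [x y]; destruct a as [u v]; unfold scal; simpl; unfold prod_scal, scal; simpl.
    unfold mult, Cmult; simpl; f_equal; ring.
  - exists (Cmod a + 1); pose proof (Cmod_ge_0 a); split; [lra|]; intros x.
    rewrite <- !Cmod_norm, Cmod_mult.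
    pose proof (Cmod_ge_0 x); apply Rmult_le_compat_r; lra.
Qed.

Lemma cint_scal (a : C) (F : C -> C) (l : list arc) :
  path_continuous l F -> cint (fun w => a * F w)%C l = (a * cint F l)%C.
Proof.
  intros HF.
  apply (path_integral_linear (U := C_R_CompleteNormedModule)
    (V := C_R_CompleteNormedModule) Cmult Cmult (fun z => a * z)%C).
  - apply Cmult_R_linear.
  - intros b x; simpl; rewrite !Cmult_assoc; f_equal; apply Cmult_comm.
  - now apply path_continuous_integrable.
Qed.

Lemma path_continuous_const (l : list arc) (a : C) : path_continuous l (fun _ => a).
Proof. intros w Hw; apply clim_const. Qed.

Lemma path_continuous_id (l : list arc) : path_continuous l (fun w => w).
Proof. apply continuous_path_continuous; intros w _; apply clim_id. Qed.

Lemma path_continuous_plus (l : list arc) (F K : C -> C) :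
  path_continuous l F -> path_continuous l K ->
  path_continuous l (fun w => F w + K w)%C.
Proof. intros HF HK w Hw; apply clim_plus; auto. Qed.

Lemma path_continuous_mult (l : list arc) (F K : C -> C) :
  path_continuous l F -> path_continuous l K ->
  path_continuous l (fun w => F w * K w)%C.
Proof. intros HF HK w Hw; apply clim_mult; auto. Qed.

Lemma path_continuous_opp (l : list arc) (F : C -> C) :
  path_continuous l F -> path_continuous l (fun w => - F w)%C.
Proof. intros HF w Hw; apply clim_opp; auto. Qed.

Lemma path_continuous_minus (l : list arc) (F K : C -> C) :
  path_continuous l F -> path_continuous l K ->
  path_continuous l (fun w => F w - K w)%C.
Proof. intros HF HK; apply path_continuous_plus; auto using path_continuous_opp. Qed.

Lemma path_continuous_inv (l : list arc) (F : C -> C) :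
  path_continuous l F -> (forall w, trace l w -> F w <> RtoC 0) ->
  path_continuous l (fun w => / F w)%C.
Proof. intros HF HF0 w Hw; apply clim_inv; auto. Qed.

Lemma path_continuous_div (l : list arc) (F K : C -> C) :
  path_continuous l F -> path_continuous l K ->
  (forall w, trace l w -> K w <> RtoC 0) ->
  path_continuous l (fun w => F w / K w)%C.
Proof.
  intros HF HK HK0; apply path_continuous_mult; auto using path_continuous_inv.
Qed.

Lemma cint_minus (F K : C -> C) (l : list arc) :
  path_continuous l F -> path_continuous l K ->
  cint (fun w => F w - K w)%C l = (cint F l - cint K l)%C.
Proof.
  intros HF HK.
  rewrite (cint_ext _ (fun w => F w + (- RtoC 1) * K w)%C).
  - rewrite cint_plus, cint_scal; auto.
    + ring.
    + apply path_continuous_mult; auto using path_continuous_const.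
  - intros w _; ring.
Qed.

Lemma eventually_gt (a : R) : Rbar_locally p_infty (fun M => a < M).
Proof. now exists a. Qed.

Lemma bounded_trace (l : list arc) (F : C -> C) :
  path_continuous l F -> exists M : R, 0 <= M /\ forall w, trace l w -> Cmod (F w) <= M.
Proof.
  intros HF.
  assert (H : Rbar_locally p_infty (fun M => forall w, trace l w -> Cmod (F w) <= M)).
  { apply (tube_trace (Rbar_locally p_infty) _ l (fun M w => Cmod (F w) <= M)).
    intros w Hw; specialize (HF w Hw 1 Rlt_0_1).
    apply (Filter_prod _ _ _ (fun M => Cmod (F w) + 1 < M) _ (eventually_gt (Cmod (F w) + 1)) HF).
    intros M z HM Hz; simpl in *.
    pose proof (Cmod_triangle (F z - F w) (F w)) as H1.
    replace (F z - F w + F w)%C with (F z) in H1 by ring; lra. }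
  destruct H as [M HM]; exists (Rmax 0 (M + 1)); split; [apply Rmax_l|].
  intros w Hw; eapply Rle_trans; [apply (HM (M + 1)); [lra | exact Hw] | apply Rmax_r].
Qed.

Lemma trace_closed (l : list arc) (z : C) : ~ trace l z ->
  exists r, 0 < r /\ forall w, trace l w -> r <= Cmod (w - z).
Proof.
  intros Hz.
  assert (H : at_right 0 (fun r => forall w, trace l w -> r <= Cmod (w - z))).
  { apply (tube_trace (at_right 0) _ l (fun r w => r <= Cmod (w - z))).
    intros w Hw.
    assert (Hp : 0 < Cmod (w - z)).
    { apply Cmod_gt_0; intros E0; apply Hz.
      replace z with w; [exact Hw|].
      replace w with ((w - z) + z)%C by ring; rewrite E0; ring. }
    assert (Hp2 : 0 < Cmod (w - z) / 2) by lra.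
    apply (Filter_prod _ _ _ (fun r => r < Cmod (w - z) / 2)
             (fun u => Cmod (u - w) < Cmod (w - z) / 2)).
    - exists (mkposreal _ Hp2); intros r Hr Hr0.
      change (Rabs (r - 0) < Cmod (w - z) / 2) in Hr.
      apply Rabs_def2 in Hr; lra.
    - apply clim_locally_within; [apply locally_filter | apply clim_id | exact Hp2].
    - intros r u Hr Hu; simpl.
      pose proof (Cmod_triangle (u - z) (- (u - w))) as H1.
      rewrite Cmod_opp in H1.
      replace (u - z + - (u - w))%C with (w - z)%C in H1 by ring; lra. }
  destruct H as [d Hd]; exists (d / 2); pose proof (cond_pos d); split; [lra|].
  apply Hd; [|lra]; change (Rabs (d / 2 - 0) < d); rewrite Rabs_pos_eq; lra.
Qed.

Lemma arc_der_bounded (g : arc) :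
  exists M, 0 <= M /\ forall t, I01 t -> Cmod (arc_der g t) <= M.
Proof.
  assert (H : Rbar_locally p_infty (fun M => forall t, I01 t -> Cmod (arc_der g t) <= M)).
  { apply (tube_I01 (Rbar_locally p_infty) _ (fun M t => Cmod (arc_der g t) <= M)).
    intros t Ht.
    pose proof (clim_locally_within (locally t) _ I01 _ _ (arc_der_clim g t) 1 Rlt_0_1) as H.
    apply (Filter_prod _ _ _ (fun M => Cmod (arc_der g t) + 1 < M) _
             (eventually_gt (Cmod (arc_der g t) + 1)) H).
    intros M s HM Hs; simpl in *.
    pose proof (Cmod_triangle (arc_der g s - arc_der g t) (arc_der g t)) as H1.
    replace (arc_der g s - arc_der g t + arc_der g t)%C with (arc_der g s) in H1 by ring.
    lra. }
  destruct H as [M HM]; exists (Rmax 0 (M + 1)); split; [apply Rmax_l|].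
  intros t Ht; eapply Rle_trans; [apply (HM (M + 1)); [lra | exact Ht] | apply Rmax_r].
Qed.

Lemma arc_bound (g : arc) (F : C -> C) (K M : R) :
  path_continuous [g] F ->
  (forall t, I01 t -> Cmod (arc_der g t) <= K) ->
  (forall t, I01 t -> Cmod (F (g t)) <= M) -> Cmod (cint F [g]) <= K * M.
Proof.
  intros HF HK HM.
  pose proof (path_continuous_integrable [g] F HF g (or_introl eq_refl)) as HI.
  replace (cint F [g]) with
    (RInt (V := C_R_CompleteNormedModule) (fun t => arc_der g t * F (g t))%C 0 1)
    by (symmetry; exact (Cplus_0_r _)).
  rewrite Cmod_norm.
  replace (K * M) with ((1 - 0) * (K * M)) by ring.
  eapply (norm_RInt_le_const (V := C_R_NormedModule)); [lra | |
    apply (RInt_correct (V := C_R_CompleteNormedModule)), HI].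
  intros t Ht; rewrite <- Cmod_norm, Cmod_mult.
  apply Rmult_le_compat; auto using Cmod_ge_0.
Qed.

Lemma cint_cons (F : C -> C) (g : arc) (l : list arc) :
  cint F (g :: l) = (cint F [g] + cint F l)%C.
Proof.
  symmetry; exact (f_equal2 Cplus (Cplus_0_r _) eq_refl).
Qed.

Lemma cint_nil (F : C -> C) : cint F [] = RtoC 0.
Proof. reflexivity. Qed.

Lemma cint_app (F : C -> C) (l l' : list arc) :
  cint F (l ++ l') = (cint F l + cint F l')%C.
Proof.
  induction l as [|g l IH]; simpl.
  - rewrite cint_nil; ring.
  - rewrite cint_cons, (cint_cons F g l), IH; ring.
Qed.

(** L adds up bounds for |g'| over the arcs and so majorizes the length of the path. Its
    independence of F is what limits under the integral rely on. *)
Lemma cint_bound (l : list arc) : exists L, 0 <= L /\ forall F M,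
  path_continuous l F -> (forall w, trace l w -> Cmod (F w) <= M) ->
  Cmod (cint F l) <= L * M.
Proof.
  induction l as [|g l [L [HL IH]]].
  - exists 0; split; [lra|]; intros F M _ _; rewrite cint_nil, Cmod_0; lra.
  - destruct (arc_der_bounded g) as [K [HK HgK]].
    exists (K + L); split; [lra|]; intros F M HF HM.
    rewrite cint_cons; eapply Rle_trans; [apply Cmod_triangle|].
    rewrite Rmult_plus_distr_r; apply Rplus_le_compat.
    + apply arc_bound; auto.
      * apply path_continuous_sub with (g :: l); [|exact HF].
        intros g' [<- | []]; now left.
      * intros t Ht; apply HM, trace_in; [now left | exact Ht].
    + apply IH.
      * apply path_continuous_sub with (g :: l); [|exact HF]; intros g' Hg'; now right.
      * intros w [g' [t [Hg' [Ht <-]]]]; apply HM, trace_in; [now right | exact Ht].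
Qed.

(** Continuity of F' is included because the fundamental theorem for the Riemann integral asks for a
    continuous derivative. *)
Definition primitive_at (F F' : C -> C) (w : C) : Prop :=
  cderiv F w (F' w) /\ clim (locC w) F' (F' w).

Lemma arc_ftc (g : arc) (F F' : C -> C) :
  (forall t, I01 t -> primitive_at F F' (g t)) ->
  cint F' [g] = (F (g 1) - F (g 0))%C.
Proof.
  intros HF; etransitivity; [exact (Cplus_0_r _)|].
  apply (is_RInt_unique (V := C_R_CompleteNormedModule)).
  apply (is_RInt_derive (V := C_R_CompleteNormedModule) (fun t => F (g t)));
    rewrite Rmin_left, Rmax_right by lra; intros t Ht; destruct (HF t Ht) as [HD HC].
  - replace (arc_der g t * F' (g t))%C with (F' (g t) * arc_der g t)%C by ring.
    apply is_derive_R_comp; [apply arc_is_derive | exact HD].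
  - apply (clim_filterlim (locally t) _ (fun s => arc_der g s * F' (g s))%C).
    apply clim_mult; [apply arc_der_clim|].
    eapply clim_comp; [|exact HC].
    apply clim_filterlim; [apply locally_filter|].
    eapply is_derive_R_continuous, arc_is_derive.
Qed.

Lemma chain_ftc (l : list arc) (F F' : C -> C) (p q : C) : chain p l q ->
  (forall w, trace l w -> primitive_at F F' w) -> cint F' l = (F q - F p)%C.
Proof.
  revert p; induction l as [|g l IH]; simpl; intros p.
  - intros ->; intros _; rewrite cint_nil; ring.
  - intros [<- Hch] HF; rewrite cint_cons, (IH _ Hch), (arc_ftc g F F').
    + ring.
    + intros t Ht; apply HF, trace_in; [now left | exact Ht].
    + intros w [g' [t [Hg' [Ht <-]]]]; apply HF, trace_in; [now right | exact Ht].
Qed.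

(** The only consequence of closedness that is used. *)
Definition cycle (l : list arc) : Prop := forall F F',
  (forall w, trace l w -> primitive_at F F' w) -> cint F' l = RtoC 0.

Lemma chain_cycle (l : list arc) (p : C) : chain p l p -> cycle l.
Proof. intros Hc F F' HF; rewrite (chain_ftc l F F' p p Hc HF); ring. Qed.

Lemma contour_cycle (G : list (list arc)) :
  (forall s, In s G -> closed_curve s) -> cycle (concat G).
Proof.
  induction G as [|s G IH]; intros HG F F' HF; simpl in *; [reflexivity|].
  rewrite cint_app.
  assert (Hs : cycle s).
  { pose proof (HG s (or_introl eq_refl)) as Hs; destruct s as [|g s]; [easy|].
    exact (chain_cycle _ _ Hs). }
  rewrite (Hs F F'), (IH (fun s' Hs' => HG s' (or_intror Hs')) F F'); [ring | |];
    intros w [g [t [Hg [Ht <-]]]]; apply HF, trace_in; auto; apply in_or_app; auto.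
Qed.

(** * Mean value estimates and differentiation under the integral *)

Lemma is_derive_Re (f : R -> C) (t : R) (d : C) :
  is_derive_R f t d -> is_derive (fun s => Re (f s)) t (Re d).
Proof.
  intros H; apply (filterdiff_comp (K := R_AbsRing) (U := R_NormedModule)
    (V := C_R_NormedModule) (W := R_NormedModule) f fst _ fst H).
  apply filterdiff_linear; exact (is_linear_fst (U := R_NormedModule) (V := R_NormedModule)).
Qed.

Lemma is_derive_Im (f : R -> C) (t : R) (d : C) :
  is_derive_R f t d -> is_derive (fun s => Im (f s)) t (Im d).
Proof.
  intros H; apply (filterdiff_comp (K := R_AbsRing) (U := R_NormedModule)
    (V := C_R_NormedModule) (W := R_NormedModule) f snd _ snd H).
  apply filterdiff_linear; exact (is_linear_snd (U := R_NormedModule) (V := R_NormedModule)).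
Qed.

Lemma Im_le_Cmod (z : C) : Rabs (Im z) <= Cmod z.
Proof. eapply Rle_trans; [apply Rmax_r | apply Rmax_Cmod]. Qed.

Lemma Cmod_le_Re_Im (z : C) : Cmod z <= Rabs (Re z) + Rabs (Im z).
Proof.
  replace z with (RtoC (Re z) + Ci * RtoC (Im z))%C at 1.
  - eapply Rle_trans; [apply Cmod_triangle|].
    rewrite Cmod_mult, Cmod_Ci, !Cmod_R; lra.
  - destruct z; unfold Cplus, Cmult, RtoC; simpl; f_equal; ring.
Qed.

Lemma is_derive_segment (a v : C) (t : R) :
  is_derive_R (fun s => a + RtoC s * v)%C t v.
Proof.
  apply is_derive_caratheodory; exists (fun _ => v); split; [apply clim_const|].
  apply filter_forall; intros s; rewrite RtoC_minus; ring.
Qed.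

(** The mean value theorem fails for complex values, so it is applied to the real and the imaginary
    part of f w - l (w - z0) along the segment; hence the factor 2. *)
Lemma mean_value_bound (f f' : C -> C) (z0 l : C) (r eps : R) :
  (forall w, Cmod (w - z0) <= r -> cderiv f w (f' w) /\ Cmod (f' w - l) <= eps) ->
  forall z, Cmod (z - z0) <= r ->
  Cmod (f z - f z0 - l * (z - z0)) <= 2 * eps * Cmod (z - z0).
Proof.
  intros Hf z Hz.
  pose (h := fun t : R => (f (z0 + RtoC t * (z - z0)) - l * (RtoC t * (z - z0)))%C).
  pose (h' := fun t : R => ((f' (z0 + RtoC t * (z - z0)) - l) * (z - z0))%C).
  (* [bounded_variation] looks at all |t| <= 1, so the segment is prolonged backwards through z0; it
     stays in the disc. *)
  assert (Hw : forall t, Rabs (t - 0) <= Rabs (1 - 0) ->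
             Cmod (z0 + RtoC t * (z - z0) - z0) <= r).
  { intros t Ht; replace (z0 + RtoC t * (z - z0) - z0)%C
      with (RtoC t * (z - z0))%C by ring.
    rewrite Cmod_mult, Cmod_R; rewrite !Rminus_0_r, Rabs_R1 in Ht.
    pose proof (Cmod_ge_0 (z - z0)).
    apply Rle_trans with (1 * Cmod (z - z0)); [|lra].
    apply Rmult_le_compat_r; lra. }
  assert (Hd : forall t, Rabs (t - 0) <= Rabs (1 - 0) -> is_derive_R h t (h' t)).
  { intros t Ht; unfold h, h'.
    pose (k := fun w => (f w - l * (w - z0))%C).
    assert (Hk : cderiv k (z0 + RtoC t * (z - z0))%C
               (f' (z0 + RtoC t * (z - z0)) - l)%C).
    { eapply cderiv_eq; [|apply cderiv_minus; [apply (Hf _ (Hw t Ht))|]].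
      2: apply cderiv_mult; [apply cderiv_const|].
      2: apply cderiv_minus; [apply cderiv_id | apply cderiv_const].
      cbv beta; ring. }
    apply is_derive_ext with (fun s => k (z0 + RtoC s * (z - z0))%C).
    - intros s; unfold k; apply f_equal; ring.
    - apply is_derive_R_comp; [apply is_derive_segment | exact Hk]. }
  assert (Hb : forall t, Rabs (t - 0) <= Rabs (1 - 0) ->
             Cmod (h' t) <= eps * Cmod (z - z0)).
  { intros t Ht; unfold h'; rewrite Cmod_mult; apply Rmult_le_compat_r;
      [apply Cmod_ge_0 | apply Hf, Hw, Ht]. }
  assert (E0 : (f z - f z0 - l * (z - z0))%C = (h 1 - h 0)%C).
  { unfold h; replace (z0 + RtoC 1 * (z - z0))%C with z by ring.
    replace (z0 + RtoC 0 * (z - z0))%C with z0 by ring; ring. }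
  assert (HR : Rabs (Re (h 1) - Re (h 0)) <= eps * Cmod (z - z0) * Rabs (1 - 0)).
  { apply (bounded_variation (fun t => Re (h t)) (fun t => Re (h' t))).
    intros t Ht; split; [apply is_derive_Re, Hd, Ht|].
    eapply Rle_trans; [apply re_le_Cmod | apply Hb, Ht]. }
  assert (HI : Rabs (Im (h 1) - Im (h 0)) <= eps * Cmod (z - z0) * Rabs (1 - 0)).
  { apply (bounded_variation (fun t => Im (h t)) (fun t => Im (h' t))).
    intros t Ht; split; [apply is_derive_Im, Hd, Ht|].
    eapply Rle_trans; [apply Im_le_Cmod | apply Hb, Ht]. }
  rewrite Rminus_0_r, Rabs_R1, Rmult_1_r in HR, HI.
  rewrite E0; eapply Rle_trans; [apply Cmod_le_Re_Im|].
  replace (2 * eps * Cmod (z - z0))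
    with (eps * Cmod (z - z0) + eps * Cmod (z - z0)) by ring.
  apply Rplus_le_compat; [exact HR | exact HI].
Qed.

Lemma cderiv_zero_constant (f : C -> C) (z0 : C) (r : R) :
  (forall w, Cmod (w - z0) < r -> cderiv f w (RtoC 0)) ->
  forall z, Cmod (z - z0) < r -> f z = f z0.
Proof.
  intros Hf z Hz.
  pose proof (mean_value_bound f (fun _ => RtoC 0) z0 (RtoC 0) (Cmod (z - z0)) 0) as H.
  specialize (H ltac:(intros w Hw; split; [apply Hf; lra |
    replace (0 - 0)%C with (RtoC 0) by ring; rewrite Cmod_0; lra]) z (Rle_refl _)).
  rewrite Rmult_0_r, Rmult_0_l in H.
  assert (E0 : (f z - f z0 - 0 * (z - z0))%C = RtoC 0).
  { apply Cmod_eq_0, Rle_antisym; [exact H | apply Cmod_ge_0]. }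
  replace (f z) with ((f z - f z0 - 0 * (z - z0)) + f z0)%C by ring.
  rewrite E0; ring.
Qed.

(** Joint continuity of P' and the tube lemma give closeness of P' z w to P' z0 w uniformly in w;
    the mean value bound in z then estimates the remainder uniformly on the trace. *)
Lemma cint_derivative (l : list arc) (P P' : C -> C -> C) (z0 : C) :
  locC z0 (fun z => path_continuous l (P z) /\
    forall w, trace l w -> cderiv (fun u => P u w) z (P' z w)) ->
  (forall w, trace l w -> clim (filter_prod (locC z0) (within (trace l) (locC w)))
     (fun p => P' (fst p) (snd p)) (P' z0 w)) ->
  cderiv (fun z => cint (P z) l) z0 (cint (P' z0) l).
Proof.
  intros HP HP'; destruct (cint_bound l) as [L [HL HB]].
  assert (Hc0 : path_continuous l (P' z0)).
  { intros w Hw eps He; destruct (HP' w Hw eps He) as [Q D HQ HD HQD].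
    unfold within in *; revert HD; apply filter_imp; intros u Hu Hu'.
    apply (HQD z0 u (locally_singleton _ _ HQ)); auto. }
  apply cderiv_bound; intros eps He.
  (* The 2 compensates [mean_value_bound], the L compensates the length, and the + 1 keeps the
     denominator positive. *)
  pose (e := eps / (2 * (L + 1))).
  assert (Hp : 0 < e) by (apply Rdiv_lt_0_compat; lra).
  assert (Hu : locC z0 (fun z => forall w, trace l w -> Cmod (P' z w - P' z0 w) <= e)).
  { apply (tube_trace (locC z0) _ l (fun z w => Cmod (P' z w - P' z0 w) <= e)).
    intros w Hw; destruct (HP' w Hw (e / 2) ltac:(lra)) as [Q D HQ HD HQD].
    apply (Filter_prod _ _ _ Q D HQ HD); intros z u Hz Hu; simpl.
    pose proof (HQD z u Hz Hu) as H1.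
    pose proof (HQD z0 u (locally_singleton _ _ HQ) Hu) as H2; simpl in *.
    pose proof (Cmod_triangle (P' z u - P' z0 w) (- (P' z0 u - P' z0 w))) as H3.
    rewrite Cmod_opp in H3.
    replace (P' z u - P' z0 w + - (P' z0 u - P' z0 w))%C
      with (P' z u - P' z0 u)%C in H3 by ring; lra. }
  pose proof (filter_and (F := locC z0) _ _ HP Hu) as Hd.
  apply locally_Cmod in Hd; destruct Hd as [d [Hd Hall]].
  apply locally_Cmod; exists d; split; [exact Hd|]; intros z Hz.
  assert (Hz0 : Cmod (z0 - z0) < d).
  { replace (z0 - z0)%C with (RtoC 0) by ring; now rewrite Cmod_0. }
  destruct (Hall z Hz) as [[Hcz _] _]; destruct (Hall z0 Hz0) as [[Hcz0 _] _].
  replace (cint (P z) l - cint (P z0) l - cint (P' z0) l * (z - z0))%C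
    with (cint (fun w => P z w - P z0 w - (z - z0) * P' z0 w)%C l).
  - eapply Rle_trans.
    + apply HB with (M := 2 * e * Cmod (z - z0)).
      * repeat apply path_continuous_minus; auto.
        apply path_continuous_mult; auto using path_continuous_const.
      * intros w Hw.
        replace (P z w - P z0 w - (z - z0) * P' z0 w)%C
          with (P z w - P z0 w - P' z0 w * (z - z0))%C by ring.
        apply (mean_value_bound (fun u => P u w) (fun u => P' u w) z0 (P' z0 w)
                 (Cmod (z - z0)) e); [|apply Rle_refl].
        intros u Huz; destruct (Hall u ltac:(lra)) as [[_ H1] H2]; auto.
    + replace (L * (2 * e * Cmod (z - z0))) with (L * (2 * e) * Cmod (z - z0)) by ring.
      apply Rmult_le_compat_r; [apply Cmod_ge_0|].
      apply Rle_trans with ((L + 1) * (2 * e)); [apply Rmult_le_compat_r; lra|].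
      right; unfold e; field; lra.
  - rewrite !cint_minus, cint_scal; auto using path_continuous_minus.
    + ring.
    + apply path_continuous_mult; auto using path_continuous_const.
Qed.

(** * Goursat's theorem *)

Ltac cring := cbv beta; ring.

Lemma Cminus_neq_0 (a b : C) : a <> b -> (a - b)%C <> RtoC 0.
Proof.
  intros Hab E0; apply Hab; replace a with ((a - b) + b)%C by ring.
  rewrite E0; ring.
Qed.

Definition segment (a b : C) : arc.
Proof.
  refine {| arc_fun := fun t => (a + RtoC t * (b - a))%C;
            arc_der := fun _ => (b - a)%C |}.
  - intros t; apply is_derive_segment.
  - intros t; apply continuous_const.
Defined.

Lemma segment_0 (a b : C) : segment a b 0 = a.
Proof. simpl; ring. Qed.

Lemma segment_1 (a b : C) : segment a b 1 = b.
Proof. simpl; ring. Qed.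

Lemma segment_dist (a b z : C) (r t : R) : I01 t ->
  Cmod (a - z) <= r -> Cmod (b - z) <= r -> Cmod (segment a b t - z) <= r.
Proof.
  intros [H0 H1] Ha Hb; simpl.
  replace (a + RtoC t * (b - a) - z)%C
    with (RtoC (1 - t) * (a - z) + RtoC t * (b - z))%C by (rewrite RtoC_minus; ring).
  eapply Rle_trans; [apply Cmod_triangle|].
  rewrite !Cmod_mult, !Cmod_R, !Rabs_pos_eq by lra.
  apply Rle_trans with ((1 - t) * r + t * r); [|lra].
  apply Rplus_le_compat; apply Rmult_le_compat_l; lra.
Qed.

Lemma trace_segment (a b w : C) : trace [segment a b] w <->
  exists t, I01 t /\ segment a b t = w.
Proof.
  split.
  - intros [g [t [[<- | []] [Ht Hw]]]]; eauto.
  - intros [t [Ht <-]]; apply trace_in; [now left | exact Ht].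
Qed.

(** The end parameters may come in either order, so reversal and bisection of a segment both reduce
    to rules for one real integral. *)
Lemma segment_integral (f : C -> C) (a b : C) (s0 s1 : R) :
  path_continuous [segment a b] f -> I01 s0 -> I01 s1 ->
  cint f [segment (segment a b s0) (segment a b s1)] =
  RInt (V := C_R_CompleteNormedModule) (fun t => (b - a) * f (segment a b t))%C s0 s1.
Proof.
  intros Hf H0 H1; etransitivity; [exact (Cplus_0_r _)|].
  pose (h := fun t => ((b - a) * f (segment a b t))%C).
  assert (HI : ex_RInt (V := C_R_CompleteNormedModule) h 0 1).
  { exact (path_continuous_integrable _ f Hf (segment a b) (or_introl eq_refl)). }
  assert (HI' : ex_RInt (V := C_R_CompleteNormedModule) h s0 s1).
  { unfold I01 in *.
    apply (ex_RInt_Chasles (V := C_R_CompleteNormedModule)) with 0.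
    - apply (ex_RInt_swap (V := C_R_CompleteNormedModule)).
      apply (ex_RInt_Chasles_1 (V := C_R_CompleteNormedModule)) with 1; [lra | exact HI].
    - apply (ex_RInt_Chasles_1 (V := C_R_CompleteNormedModule)) with 1; [lra | exact HI]. }
  pose proof (RInt_comp_lin (V := C_R_CompleteNormedModule) h (s1 - s0) s0 0 1) as HL.
  replace ((s1 - s0) * 0 + s0) with s0 in HL by ring.
  replace ((s1 - s0) * 1 + s0) with s1 in HL by ring.
  etransitivity; [|exact (HL HI')].
  apply (RInt_ext (V := C_R_CompleteNormedModule)); intros t _.
  replace (arc_fun (segment (segment a b s0) (segment a b s1)) t)
    with (segment a b ((s1 - s0) * t + s0)).
  - unfold h.
    etransitivity; [|symmetry; apply scal_C_R].
    simpl; rewrite RtoC_minus; ring.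
  - simpl; rewrite RtoC_plus, RtoC_mult, RtoC_minus; ring.
Qed.

Lemma segment_swap (f : C -> C) (a b : C) : path_continuous [segment a b] f ->
  cint f [segment b a] = (- cint f [segment a b])%C.
Proof.
  intros Hf.
  assert (H0 : I01 0) by (unfold I01; lra).
  assert (H1 : I01 1) by (unfold I01; lra).
  pose proof (segment_integral f a b 1 0 Hf H1 H0) as E1.
  pose proof (segment_integral f a b 0 1 Hf H0 H1) as E2.
  rewrite !segment_0, !segment_1 in *; rewrite E1, E2.
  symmetry; apply (opp_RInt_swap (V := C_R_CompleteNormedModule)).
  exact (path_continuous_integrable _ f Hf (segment a b) (or_introl eq_refl)).
Qed.

Definition midpoint (a b : C) : C := ((a + b) * RtoC (/ 2))%C.

Lemma segment_midpoint (a b : C) : segment a b (/ 2) = midpoint a b.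
Proof.
  unfold midpoint; simpl.
  replace a with (a * RtoC (/ 2 + / 2))%C at 1.
  - rewrite RtoC_plus; ring.
  - replace (/ 2 + / 2) with 1 by field; ring.
Qed.

Lemma segment_split (f : C -> C) (a b : C) : path_continuous [segment a b] f ->
  cint f [segment a b] =
  (cint f [segment a (midpoint a b)] + cint f [segment (midpoint a b) b])%C.
Proof.
  intros Hf.
  assert (H0 : I01 0) by (unfold I01; lra).
  assert (H1 : I01 1) by (unfold I01; lra).
  assert (H2 : I01 (/ 2)) by (unfold I01; lra).
  pose proof (segment_integral f a b 0 1 Hf H0 H1) as E0.
  pose proof (segment_integral f a b 0 (/ 2) Hf H0 H2) as E1.
  pose proof (segment_integral f a b (/ 2) 1 Hf H2 H1) as E2.
  rewrite !segment_0, !segment_1, ?segment_midpoint in *; rewrite E0, E1, E2.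
  pose proof (path_continuous_integrable _ f Hf (segment a b) (or_introl eq_refl)) as HI.
  symmetry; apply (RInt_Chasles (V := C_R_CompleteNormedModule)).
  - apply (ex_RInt_Chasles_1 (V := C_R_CompleteNormedModule)) with 1; [lra | exact HI].
  - apply (ex_RInt_Chasles_2 (V := C_R_CompleteNormedModule)) with 0; [lra | exact HI].
Qed.

Lemma segment_bound (f : C -> C) (a b : C) (M : R) :
  path_continuous [segment a b] f ->
  (forall w, trace [segment a b] w -> Cmod (f w) <= M) ->
  Cmod (cint f [segment a b]) <= Cmod (b - a) * M.
Proof.
  intros Hf HM; apply arc_bound; [exact Hf | |].
  - intros t _; apply Rle_refl.
  - intros t Ht; apply HM, trace_in; [now left | exact Ht].
Qed.

Definition triangle (a b c : C) : list arc := [segment a b; segment b c; segment c a].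

Lemma triangle_cycle (a b c : C) : cycle (triangle a b c).
Proof.
  apply chain_cycle with a; unfold triangle, chain.
  now rewrite !segment_0, !segment_1.
Qed.

Lemma cint_triangle (f : C -> C) (a b c : C) :
  cint f (triangle a b c) =
  (cint f [segment a b] + cint f [segment b c] + cint f [segment c a])%C.
Proof.
  unfold triangle; rewrite cint_cons, (cint_cons _ _ [segment c a]); ring.
Qed.

Lemma RtoC_2_neq_0 : RtoC 2 <> RtoC 0.
Proof. intros E0; apply RtoC_inj in E0; lra. Qed.

Lemma affine_primitive (m k : C) (w : C) :
  primitive_at (fun u => m * u + k * (u * u) * / RtoC 2)%C (fun u => m + k * u)%C w.
Proof.
  pose proof RtoC_2_neq_0 as H2.
  split.
  - eapply cderiv_eq; cycle 1.
    + apply cderiv_plus.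
      * apply cderiv_mult; [apply cderiv_const | apply cderiv_id].
      * apply cderiv_mult; [|apply cderiv_const].
        apply cderiv_mult; [apply cderiv_const|].
        apply cderiv_mult; apply cderiv_id.
    + cbv beta; replace (RtoC 2) with (RtoC 1 + RtoC 1)%C in *
        by (rewrite <- RtoC_plus; f_equal; ring).
      field; exact H2.
  - apply clim_plus; [apply clim_const|].
    apply clim_mult; [apply clim_const | apply clim_id].
Qed.

Section Goursat.
Variables (f : C -> C) (z0 : C) (rho : R).
Hypothesis Hf : forall w, Cmod (w - z0) <= rho -> exists d, cderiv f w d.

(** A closed disc: convexity keeps all midpoints inside, closedness keeps the limit of the nested
    triangles inside. *)
Let inside (a : C) : Prop := Cmod (a - z0) <= rho.

Lemma ball_segment_continuous (a b : C) : inside a -> inside b ->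
  path_continuous [segment a b] f.
Proof.
  unfold inside; intros Ha Hb; apply continuous_path_continuous; intros w Hw.
  apply trace_segment in Hw; destruct Hw as [t [Ht <-]].
  destruct (Hf (segment a b t)) as [d Hd].
  - now apply segment_dist.
  - eapply cderiv_continuous, Hd.
Qed.

Lemma midpoint_inside (a b : C) : inside a -> inside b -> inside (midpoint a b).
Proof.
  unfold inside; intros Ha Hb; rewrite <- segment_midpoint.
  apply segment_dist; auto; unfold I01; lra.
Qed.

(** All four pieces inherit the orientation, so each inner side is traversed once in each direction
    and cancels. *)
Lemma triangle_split (a b c : C) : inside a -> inside b -> inside c ->
  cint f (triangle a b c) =
  (cint f (triangle a (midpoint a b) (midpoint c a)) +
   cint f (triangle (midpoint a b) b (midpoint b c)) +
   cint f (triangle (midpoint c a) (midpoint b c) c) +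
   cint f (triangle (midpoint a b) (midpoint b c) (midpoint c a)))%C.
Proof.
  intros Ha Hb Hc.
  pose proof (midpoint_inside a b Ha Hb) as Hab.
  pose proof (midpoint_inside b c Hb Hc) as Hbc.
  pose proof (midpoint_inside c a Hc Ha) as Hca.
  rewrite !cint_triangle.
  rewrite (segment_split f a b), (segment_split f b c), (segment_split f c a)
    by (now apply ball_segment_continuous).
  rewrite (segment_swap f (midpoint a b) (midpoint c a)),
    (segment_swap f (midpoint a b) (midpoint b c)),
    (segment_swap f (midpoint b c) (midpoint c a))
    by (now apply ball_segment_continuous).
  ring.
Qed.

Let tri : Type := (C * C * C)%type.
Let tint (T : tri) : C := let '(a, b, c) := T in cint f (triangle a b c).
Let tsize (T : tri) : R :=
  let '(a, b, c) := T in Cmod (b - a) + Cmod (c - b) + Cmod (a - c).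
Let tvertex (T : tri) : C := let '(a, _, _) := T in a.
Let tinside (T : tri) : Prop :=
  let '(a, b, c) := T in inside a /\ inside b /\ inside c.

Lemma half_dist (x y : C) (h : C) : h = ((x - y) * RtoC (/ 2))%C ->
  Cmod h = Cmod (x - y) / 2.
Proof.
  intros ->; rewrite Cmod_mult, Cmod_R, Rabs_pos_eq by lra; reflexivity.
Qed.

Lemma half_half (x : C) : x = (x * RtoC (/ 2) + x * RtoC (/ 2))%C.
Proof.
  rewrite <- Cmult_plus_distr_l, <- RtoC_plus.
  replace (/ 2 + / 2) with 1 by field; ring.
Qed.

(** Some quarter carries at least a fourth of the integral. The perimeter is halved, and the bound
    on the first vertex makes these vertices a Cauchy sequence. *)
Lemma triangle_descend (T : tri) : tinside T -> exists T' : tri,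
  tinside T' /\ Cmod (tint T) <= 4 * Cmod (tint T') /\ tsize T' = tsize T / 2 /\
  Cmod (tvertex T' - tvertex T) <= tsize T.
Proof.
  destruct T as [[a b] c]; intros [Ha [Hb Hc]].
  pose proof (midpoint_inside a b Ha Hb) as Hab.
  pose proof (midpoint_inside b c Hb Hc) as Hbc.
  pose proof (midpoint_inside c a Hc Ha) as Hca.
  pose (T1 := (a, midpoint a b, midpoint c a) : tri).
  pose (T2 := (midpoint a b, b, midpoint b c) : tri).
  pose (T3 := (midpoint c a, midpoint b c, c) : tri).
  pose (T4 := (midpoint a b, midpoint b c, midpoint c a) : tri).
  pose proof (triangle_split a b c Ha Hb Hc) as E.
  change (cint f (triangle a b c) = tint T1 + tint T2 + tint T3 + tint T4)%C in E.
  pose proof (Cmod_ge_0 (b - a)); pose proof (Cmod_ge_0 (c - b));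
    pose proof (Cmod_ge_0 (a - c)).
  assert (Hsz : forall T', T' = T1 \/ T' = T2 \/ T' = T3 \/ T' = T4 ->
    tinside T' /\ tsize T' = tsize (a, b, c) / 2 /\
    Cmod (tvertex T' - a) <= tsize (a, b, c)).
  { assert (Hm : forall x y, (midpoint x y - x)%C = ((y - x) * RtoC (/ 2))%C).
    { intros x y; unfold midpoint; rewrite (half_half x) at 2; ring. }
    assert (Hm' : forall x y, (y - midpoint x y)%C = ((y - x) * RtoC (/ 2))%C).
    { intros x y; unfold midpoint; rewrite (half_half y) at 1; ring. }
    intros T' [-> | [-> | [-> | ->]]]; (split; [simpl; auto|]); split; simpl.
    - rewrite (half_dist b a (midpoint a b - a)), (half_dist c b (midpoint c a - midpoint a b)),
        (half_dist a c (a - midpoint c a)); auto; [lra | unfold midpoint; ring].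
    - replace (a - a)%C with (RtoC 0) by ring; rewrite Cmod_0; lra.
    - rewrite (half_dist b a (b - midpoint a b)), (half_dist c b (midpoint b c - b)),
        (half_dist a c (midpoint a b - midpoint b c)); auto; [lra | unfold midpoint; ring].
    - rewrite (half_dist b a (midpoint a b - a)); auto; lra.
    - rewrite (half_dist b a (midpoint b c - midpoint c a)), (half_dist c b (c - midpoint b c)),
        (half_dist a c (midpoint c a - c)); auto; [lra | unfold midpoint; ring].
    - replace (midpoint c a - a)%C with (- (a - midpoint c a))%C by ring.
      rewrite Cmod_opp, (half_dist a c (a - midpoint c a)); auto; lra.
    - replace (midpoint b c - midpoint a b)%C with (- (midpoint a b - midpoint b c))%C by ring;
      replace (midpoint c a - midpoint b c)%C with (- (midpoint b c - midpoint c a))%C by ring;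
      replace (midpoint a b - midpoint c a)%C with (- (midpoint c a - midpoint a b))%C by ring;
      rewrite !Cmod_opp.
      rewrite (half_dist b a (midpoint b c - midpoint c a)),
        (half_dist c b (midpoint c a - midpoint a b)),
        (half_dist a c (midpoint a b - midpoint b c)); [lra | | |]; unfold midpoint; ring.
    - rewrite (half_dist b a (midpoint a b - a)); auto; lra. }
  assert (Hbig : exists T', (T' = T1 \/ T' = T2 \/ T' = T3 \/ T' = T4) /\
            Cmod (tint (a, b, c)) <= 4 * Cmod (tint T')).
  { apply NNPP; intros Hn.
    assert (Hlt : forall T', T' = T1 \/ T' = T2 \/ T' = T3 \/ T' = T4 ->
              4 * Cmod (tint T') < Cmod (tint (a, b, c))).
    { intros T' HT'; apply Rnot_le_lt; intros Hle; apply Hn; eauto. }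
    pose proof (Hlt T1 ltac:(auto)); pose proof (Hlt T2 ltac:(auto)).
    pose proof (Hlt T3 ltac:(auto)); pose proof (Hlt T4 ltac:(auto)).
    change (cint f (triangle a b c)) with (tint (a, b, c)) in E.
    pose proof (Cmod_triangle (tint T1 + tint T2 + tint T3) (tint T4)) as K1.
    pose proof (Cmod_triangle (tint T1 + tint T2) (tint T3)) as K2.
    pose proof (Cmod_triangle (tint T1) (tint T2)) as K3.
    rewrite <- E in K1; lra. }
  destruct Hbig as [T' [HT' Hle]]; exists T'.
  destruct (Hsz T' HT') as [K1 [K2 K3]]; auto.
Qed.

Lemma tsize_ge_0 (T : tri) : 0 <= tsize T.
Proof.
  destruct T as [[a b] c]; simpl.
  pose proof (Cmod_ge_0 (b - a)); pose proof (Cmod_ge_0 (c - b));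
    pose proof (Cmod_ge_0 (a - c)); lra.
Qed.

Lemma triangle_trace_dist (a b c w : C) : trace (triangle a b c) w ->
  Cmod (w - a) <= tsize (a, b, c).
Proof.
  pose proof (Cmod_ge_0 (b - a)); pose proof (Cmod_ge_0 (c - b));
    pose proof (Cmod_ge_0 (a - c)).
  assert (Hca : Cmod (c - a) = Cmod (a - c)).
  { replace (c - a)%C with (- (a - c))%C by ring; apply Cmod_opp. }
  assert (Haa : Cmod (a - a) = 0).
  { replace (a - a)%C with (RtoC 0) by ring; apply Cmod_0. }
  intros [g [t [Hg [Ht <-]]]]; simpl tsize.
  destruct Hg as [<- | [<- | [<- | []]]]; apply segment_dist; auto; lra.
Qed.

(** The affine part f z + d (w - z) has a primitive and integrates to zero around the triangle, so
    only the deviation from it counts. *)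
Lemma triangle_small (a b c z d : C) (eps : R) :
  tinside (a, b, c) -> 
  (forall w, trace (triangle a b c) w ->
     Cmod (f w - f z - d * (w - z)) <= eps) ->
  Cmod (cint f (triangle a b c)) <= tsize (a, b, c) * eps.
Proof.
  intros [Ha [Hb Hc]] He.
  pose (m := (f z - d * z)%C).
  assert (Haff : cint (fun w => m + d * w)%C (triangle a b c) = RtoC 0).
  { eapply triangle_cycle; intros w _; apply affine_primitive. }
  assert (Hseg : forall x y, inside x -> inside y ->
    (forall w, trace [segment x y] w -> trace (triangle a b c) w) ->
    Cmod (cint f [segment x y] - cint (fun w => m + d * w)%C [segment x y])
      <= Cmod (y - x) * eps).
  { intros x y Hx Hy Hxy.
    assert (Hcf : path_continuous [segment x y] f) by now apply ball_segment_continuous.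
    assert (Hca : path_continuous [segment x y] (fun w => m + d * w)%C).
    { apply path_continuous_plus; [apply path_continuous_const|].
      apply path_continuous_mult; [apply path_continuous_const | apply path_continuous_id]. }
    rewrite <- cint_minus by assumption.
    apply segment_bound; [now apply path_continuous_minus|].
    intros w Hw; unfold m.
    replace (f w - (f z - d * z + d * w))%C with (f w - f z - d * (w - z))%C by ring.
    auto. }
  assert (Hsub : forall g, In g (triangle a b c) -> forall w, trace [g] w ->
            trace (triangle a b c) w).
  { intros g Hg w [g' [t [[<- | []] [Ht <-]]]]; now apply trace_in. }
  pose proof (Hseg a b Ha Hb (Hsub (segment a b) ltac:(simpl; auto))) as K1.
  pose proof (Hseg b c Hb Hc (Hsub (segment b c) ltac:(simpl; auto))) as K2.
  pose proof (Hseg c a Hc Ha (Hsub (segment c a) ltac:(simpl; auto))) as K3.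
  rewrite cint_triangle in Haff |- *; simpl tsize.
  set (x1 := cint (fun w => m + d * w)%C [segment a b]) in *.
  set (x2 := cint (fun w => m + d * w)%C [segment b c]) in *.
  set (x3 := cint (fun w => m + d * w)%C [segment c a]) in *.
  set (y1 := cint f [segment a b]) in *.
  set (y2 := cint f [segment b c]) in *.
  set (y3 := cint f [segment c a]) in *.
  replace (y1 + y2 + y3)%C
    with (((y1 - x1) + (y2 - x2)) + (y3 - x3) + (x1 + x2 + x3))%C by ring.
  rewrite Haff, Cplus_0_r.
  eapply Rle_trans; [apply Cmod_triangle|].
  pose proof (Cmod_triangle (y1 - x1) (y2 - x2)); lra.
Qed.

Theorem Goursat (a b c : C) : inside a -> inside b -> inside c ->
  cint f (triangle a b c) = RtoC 0.
Proof.
  intros Ha Hb Hc.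
  pose (T0 := (a, b, c) : tri).
  pose (next := fun T : tri => epsilon (inhabits T) (fun T' => 
    tinside T' /\ Cmod (tint T) <= 4 * Cmod (tint T') /\ tsize T' = tsize T / 2 /\
    Cmod (tvertex T' - tvertex T) <= tsize T)).
  assert (Hnext : forall T, tinside T -> tinside (next T) /\
    Cmod (tint T) <= 4 * Cmod (tint (next T)) /\ tsize (next T) = tsize T / 2 /\
    Cmod (tvertex (next T) - tvertex T) <= tsize T).
  { intros T HT; unfold next; apply epsilon_spec; now apply triangle_descend. }
  pose (Tn := fun n => Nat.iter n next T0).
  assert (Hin : forall n, tinside (Tn n)).
  { induction n as [|n IH]; [simpl; auto | apply Hnext, IH]. }
  pose (s0 := tsize T0).
  assert (Hs0 : 0 <= s0) by apply tsize_ge_0.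
  assert (Hsize : forall n, tsize (Tn n) = s0 * (/ 2) ^ n).
  { induction n as [|n IH]; [unfold s0; simpl; ring|].
    change (Tn (S n)) with (next (Tn n)).
    destruct (Hnext _ (Hin n)) as [_ [_ [-> _]]]; rewrite IH; simpl; field. }
  assert (Hint : forall n, Cmod (tint T0) <= 4 ^ n * Cmod (tint (Tn n))).
  { induction n as [|n IH]; [simpl; lra|].
    change (Tn (S n)) with (next (Tn n)).
    destruct (Hnext _ (Hin n)) as [_ [H4 _]].
    eapply Rle_trans; [exact IH|]; simpl.
    replace (4 * 4 ^ n * Cmod (tint (next (Tn n))))
      with (4 ^ n * (4 * Cmod (tint (next (Tn n))))) by ring.
    apply Rmult_le_compat_l; [apply pow_le; lra | exact H4]. }
  pose (v := fun n => tvertex (Tn n)).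
  (* The factor 1 - 2^-k is the geometric partial sum; the induction closes with it but not with the
     cruder bound 2 s0 2^-n. *)
  assert (Hv : forall n k, Cmod (v (n + k)%nat - v n) <= 2 * (s0 * (/ 2) ^ n) * (1 - (/ 2) ^ k)).
  { intros n; induction k as [|k IH].
    - rewrite Nat.add_0_r; replace (v n - v n)%C with (RtoC 0) by ring.
      rewrite Cmod_0; simpl; lra.
    - rewrite Nat.add_succ_r.
      replace (v (S (n + k)) - v n)%C
        with ((v (S (n + k)) - v (n + k)%nat) + (v (n + k)%nat - v n))%C by ring.
      eapply Rle_trans; [apply Cmod_triangle|].
      assert (H1 : Cmod (v (S (n + k)) - v (n + k)%nat) <= s0 * (/ 2) ^ (n + k)).
      { rewrite <- Hsize; apply (Hnext _ (Hin (n + k)%nat)). }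
      rewrite pow_add in H1; simpl; lra. }
  assert (Hv2 : forall n k, Cmod (v (n + k)%nat - v n) <= 2 * (s0 * (/ 2) ^ n)).
  { intros n k; eapply Rle_trans; [apply Hv|].
    assert (0 <= (/ 2) ^ k) by (apply pow_le; lra).
    assert (0 <= s0 * (/ 2) ^ n) by (apply Rmult_le_pos; [lra | apply pow_le; lra]).
    apply Rle_trans with (2 * (s0 * (/ 2) ^ n) * 1); [|lra].
    apply Rmult_le_compat_l; lra. }
  assert (Hpow : forall e, 0 < e -> exists n, forall m, (n <= m)%nat -> s0 * (/ 2) ^ m < e).
  { intros e He.
    destruct (pow_lt_1_zero (/ 2) ltac:(rewrite Rabs_pos_eq; lra) (e / (s0 + 1)))
      as [n Hn]; [apply Rdiv_lt_0_compat; lra|].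
    exists n; intros m Hm; specialize (Hn m Hm).
    rewrite Rabs_pos_eq in Hn by (apply pow_le; lra).
    assert (0 <= (/ 2) ^ m) by (apply pow_le; lra).
    apply Rle_lt_trans with ((s0 + 1) * (/ 2) ^ m); [apply Rmult_le_compat_r; lra|].
    apply Rmult_lt_reg_l with (/ (s0 + 1)); [apply Rinv_0_lt_compat; lra|].
    rewrite <- Rmult_assoc, Rinv_l, Rmult_1_l by lra; lra. }
  assert (Hlim : exists z : C, clim eventually v z).
  { destruct (proj1 (filterlim_locally_cauchy (U := C_R_CompleteNormedModule)
                (F := eventually) v)) as [z Hz].
    - intros eps; destruct (Hpow (eps / 4)) as [n Hn];
        [pose proof (cond_pos eps); lra|].
      exists (fun m => (n <= m)%nat); split; [now exists n|].
      intros p q Hp Hq; apply C_NormedModule_mixin_compat1.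
      change (Cmod (v q - v p) < eps).
      replace (v q - v p)%C with ((v q - v n) + - (v p - v n))%C by ring.
      eapply Rle_lt_trans; [apply Cmod_triangle|]; rewrite Cmod_opp.
      pose proof (Hv2 n (q - n)%nat) as K1; pose proof (Hv2 n (p - n)%nat) as K2.
      replace (n + (q - n))%nat with q in K1 by now rewrite Nat.add_comm, Nat.sub_add.
      replace (n + (p - n))%nat with p in K2 by now rewrite Nat.add_comm, Nat.sub_add.
      specialize (Hn n (le_n n)); lra.
    - exists z; apply clim_filterlim; [apply eventually_filter | exact Hz]. }
  destruct Hlim as [z Hz].
  assert (Hvz : forall n, Cmod (v n - z) <= 2 * (s0 * (/ 2) ^ n)).
  { intros n; apply Rle_plus_epsilon; intros e He.
    destruct (Hz e He) as [N HN]; specialize (HN (n + N)%nat ltac:(apply Nat.le_add_l)).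
    pose proof (Hv2 n N) as K1.
    pose proof (Cmod_triangle (v (n + N)%nat - z) (- (v (n + N)%nat - v n))) as K2.
    rewrite Cmod_opp in K2.
    replace (v (n + N)%nat - z + - (v (n + N)%nat - v n))%C with (v n - z)%C in K2 by ring.
    lra. }
  assert (Hzin : inside z).
  { apply Rle_plus_epsilon; intros e He.
    destruct (Hz e He) as [N HN]; specialize (HN N (le_n N)).
    assert (HvN : inside (v N)).
    { specialize (Hin N); unfold v; destruct (Tn N) as [[a' b'] c']; apply Hin. }
    pose proof (Cmod_triangle (v N - z0) (- (v N - z))) as K2.
    rewrite Cmod_opp in K2.
    replace (v N - z0 + - (v N - z))%C with (z - z0)%C in K2 by ring.
    unfold inside in HvN; lra. }
  destruct (Hf z Hzin) as [d Hd].
  assert (Hsmall : forall eps, 0 < eps -> Cmod (tint T0) <= 3 * (s0 * s0) * eps).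
  { intros eps He.
    pose proof (proj1 (cderiv_bound f z d) Hd eps He) as Hb1.
    apply locally_Cmod in Hb1; destruct Hb1 as [del [Hdel Hb1]].
    destruct (Hpow (del / 3) ltac:(lra)) as [n Hn]; specialize (Hn n (le_n n)).
    eapply Rle_trans; [apply (Hint n)|].
    destruct (Tn n) as [[a' b'] c'] eqn:ET.
    pose proof (Hin n) as Hin'; rewrite ET in Hin'.
    pose proof (Hsize n) as Hsz; rewrite ET in Hsz.
    pose proof (Hvz n) as Hvn; unfold v in Hvn; rewrite ET in Hvn; simpl tvertex in Hvn.
    assert (Hsn : 0 <= s0 * (/ 2) ^ n) by (rewrite <- Hsz; apply tsize_ge_0).
    (* Perimeter and distance to z are both of order 2^-n, so their product cancels the factor 4^n.
       The 3 is 1 + 2: from w to the first vertex at most one perimeter, from there to z at most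
       two. *)
    assert (K : Cmod (tint (a', b', c')) <= s0 * (/ 2) ^ n * (eps * (3 * (s0 * (/ 2) ^ n)))).
    { rewrite <- Hsz at 1; simpl tint; apply (triangle_small a' b' c' z d); [exact Hin'|].
      intros w Hw; apply triangle_trace_dist in Hw; rewrite Hsz in Hw.
      assert (Hwz : Cmod (w - z) <= 3 * (s0 * (/ 2) ^ n)).
      { replace (w - z)%C with ((w - a') + (a' - z))%C by ring.
        eapply Rle_trans; [apply Cmod_triangle|]; lra. }
      eapply Rle_trans; [apply Hb1; lra|].
      apply Rmult_le_compat_l; lra. }
    apply Rle_trans with (4 ^ n * (s0 * (/ 2) ^ n * (eps * (3 * (s0 * (/ 2) ^ n))))).
    - apply Rmult_le_compat_l; [apply pow_le; lra | exact K].
    - right.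
      replace (4 ^ n * (s0 * (/ 2) ^ n * (eps * (3 * (s0 * (/ 2) ^ n)))))
        with ((4 ^ n * ((/ 2) ^ n * (/ 2) ^ n)) * (3 * (s0 * s0) * eps)) by ring.
      rewrite <- !Rpow_mult_distr.
      replace (4 * (/ 2 * / 2)) with 1 by field; rewrite pow1; ring. }
  apply Cmod_eq_0; apply Rle_antisym; [|apply Cmod_ge_0].
  apply Rle_plus_epsilon; intros e He.
  assert (Hss : 0 <= s0 * s0) by now apply Rmult_le_pos.
  eapply Rle_trans; [apply (Hsmall (e / (3 * (s0 * s0) + 1)))|].
  { apply Rdiv_lt_0_compat; lra. }
  rewrite Rplus_0_l.
  apply Rmult_le_reg_r with (3 * (s0 * s0) + 1); [lra|].
  replace (3 * (s0 * s0) * (e / (3 * (s0 * s0) + 1)) * (3 * (s0 * s0) + 1))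
    with (3 * (s0 * s0) * e) by (field; lra).
  pose proof (Rmult_le_pos _ _ Hss (Rlt_le _ _ He)); lra.
Qed.

End Goursat.

(** * Cauchy's formula on discs *)

Lemma Cmod_le_sub (a b z : C) : Cmod (a - z) <= Cmod (a - b) + Cmod (b - z).
Proof.
  replace (a - z)%C with ((a - b) + (b - z))%C by ring; apply Cmod_triangle.
Qed.

Lemma Cmod_sym (a b : C) : Cmod (a - b) = Cmod (b - a).
Proof. replace (a - b)%C with (- (b - a))%C by ring; apply Cmod_opp. Qed.

Lemma Cmod_self (a : C) : Cmod (a - a) = 0.
Proof. replace (a - a)%C with (RtoC 0) by ring; apply Cmod_0. Qed.

Lemma locC_imp (z : C) (P Q : C -> Prop) :
  (forall w : C, P w -> Q w) -> locC z P -> locC z Q.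
Proof. apply filter_imp. Qed.

Lemma locally_ball_Cmod (z0 z : C) (r : R) : Cmod (z - z0) < r ->
  locC z (fun w => Cmod (w - z0) < r).
Proof.
  intros Hz; apply locally_Cmod; exists (r - Cmod (z - z0)); split; [lra|].
  intros w Hw; pose proof (Cmod_le_sub w z z0); lra.
Qed.

(** F integrates f along the radius from z0. Goursat on the triangle z0, w, u turns F u - F w into
    the integral over the segment from w to u, where f is close to f w. *)
Lemma local_primitive (f : C -> C) (z0 : C) (r : R) :
  (forall w, Cmod (w - z0) < r -> exists d, cderiv f w d) ->
  exists F, forall w, Cmod (w - z0) < r -> primitive_at F f w.
Proof.
  intros Hf; exists (fun w => cint f [segment z0 w]); intros w Hw.
  destruct (Hf w Hw) as [d Hd]; pose proof (cderiv_continuous _ _ _ Hd) as Hc.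
  split; [|exact Hc].
  apply cderiv_bound; intros eps He.
  generalize (filter_and (F := locC w) _ _ (locally_ball_Cmod z0 w r Hw) (Hc eps He)).
  intros H; apply locally_Cmod in H; destruct H as [del [Hdel H]].
  apply locally_Cmod; exists del; split; [exact Hdel|]; intros u Hu.
  assert (Hur : Cmod (u - z0) < r) by now apply H.
  (* A closed disc inside the open one that contains both points, as [Goursat] asks. *)
  pose (rho := Rmax (Cmod (w - z0)) (Cmod (u - z0))).
  assert (Hrho : rho < r) by now apply Rmax_lub_lt.
  assert (Hf' : forall v, Cmod (v - z0) <= rho -> exists d, cderiv f v d).
  { intros v Hv; apply Hf; lra. }
  assert (Hz : Cmod (z0 - z0) <= rho).
  { rewrite Cmod_self; eapply Rle_trans; [apply Cmod_ge_0 | apply Rmax_l]. }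
  assert (Hw' : Cmod (w - z0) <= rho) by apply Rmax_l.
  assert (Hu' : Cmod (u - z0) <= rho) by apply Rmax_r.
  pose proof (Goursat f z0 rho Hf' z0 w u Hz Hw' Hu') as HG.
  rewrite cint_triangle, (segment_swap f z0 u) in HG
    by now apply (ball_segment_continuous f z0 rho).
  pose proof (ball_segment_continuous f z0 rho Hf' w u Hw' Hu') as Hwu.
  assert (E1 : (cint f [segment z0 u] - cint f [segment z0 w])%C = cint f [segment w u]).
  { set (x := cint f [segment z0 u]) in *; set (y := cint f [segment z0 w]) in *.
    set (t := cint f [segment w u]) in *.
    replace (x - y)%C with (t - (y + t + - x))%C by ring; rewrite HG; ring. }
  assert (E2 : cint (fun _ => f w) [segment w u] = (f w * (u - w))%C).
  { rewrite (arc_ftc (segment w u) (fun v => f w * v)%C).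
    - rewrite segment_0, segment_1; ring.
    - intros t _; split; [|apply clim_const].
      eapply cderiv_eq; [|apply cderiv_mult; [apply cderiv_const | apply cderiv_id]].
      cring. }
  cbv beta; rewrite E1, <- E2, <- cint_minus by auto using path_continuous_const.
  rewrite Rmult_comm; apply segment_bound;
    [apply path_continuous_minus; auto using path_continuous_const|].
  intros v Hv; apply trace_segment in Hv; destruct Hv as [t [Ht <-]].
  left; apply H.
  eapply Rle_lt_trans; [apply segment_dist with (r := Cmod (u - w)); auto|]; [|lra|lra].
  rewrite Cmod_self; apply Cmod_ge_0.
Qed.

Lemma clim_fst {T : Type} (G : (T -> Prop) -> Prop) (FG : Filter G) (z : C) :
  clim (filter_prod (locC z) G) fst z.
Proof.
  apply clim_filterlim; [typeclasses eauto|]; apply filterlim_fst; exact FG.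
Qed.

Lemma clim_snd {T : Type} (G : (T -> Prop) -> Prop) (FG : Filter G) (D : C -> Prop) (w : C) :
  clim (filter_prod G (within D (locC w))) snd w.
Proof.
  apply (clim_comp (within D (locC w)) snd (fun u => u) w).
  - apply filterlim_snd; exact FG.
  - apply clim_locally_within; [typeclasses eauto | apply clim_id].
Qed.

Lemma clim_compose {T : Type} (G : (T -> Prop) -> Prop) (FG : Filter G)
  (F : C -> C) (h : T -> C) (a b : C) :
  clim G h a -> clim (locC a) F b -> clim G (fun x => F (h x)) b.
Proof.
  intros Hh HF; apply clim_comp with (G := locC a); [|exact HF].
  apply clim_filterlim; assumption.
Qed.

(** Contracting a cycle towards [z] does not change the integral of the
    difference quotient kernel; both Cauchy's formula and Liouville's theorem are instances. *)
Lemma star_homotopy (l : list arc) (F F' : C -> C) (z : C) (r : R) :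
  cycle l -> (forall w, trace l w -> w <> z) ->
  (forall s w, Cmod s < r -> trace l w -> primitive_at F F' (z + s * (w - z))%C) ->
  forall s, Cmod s < r ->
  cint (fun w => F (z + s * (w - z)) / (w - z))%C l =
  (F z * cint (fun w => / (w - z)) l)%C.
Proof.
  intros Hl Hz HF s Hs.
  assert (Hc1 : path_continuous l (fun w => w - z)%C).
  { apply path_continuous_minus; [apply path_continuous_id | apply path_continuous_const]. }
  assert (Hc2 : path_continuous l (fun w => / (w - z))%C).
  { apply path_continuous_inv; [exact Hc1|]; intros w Hw; apply Cminus_neq_0; auto. }
  pose (phi := fun s => cint (fun w => F (z + s * (w - z)) / (w - z))%C l).
  (* Differentiation in the contraction parameter cancels w - z and leaves F'(z + u (w - z)), which
     has the primitive F(z + u (w - z)) / u in w. For u = 0 it is the constant F' z, with a linear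
     primitive. *)
  assert (Hd : forall u, Cmod (u - 0) < r -> cderiv phi u (RtoC 0)).
  { intros u Hu.
    assert (E0 : cint (fun w => F' (z + u * (w - z)))%C l = RtoC 0).
    { replace (u - 0)%C with u in Hu by ring.
      destruct (classic (u = RtoC 0)) as [-> | Hne].
      - rewrite (cint_ext _ (fun _ => F' z));
          [|intros w _; f_equal; ring].
        apply (Hl (fun w => F' z * w)%C); intros w _; split; [|apply clim_const].
        eapply cderiv_eq; [|apply cderiv_mult; [apply cderiv_const | apply cderiv_id]].
        cring.
      - apply (Hl (fun w => / u * F (z + u * (w - z)))%C); intros w Hw.
        destruct (HF u w Hu Hw) as [K1 K2]; split.
        + eapply cderiv_eq; cycle 1.
          * apply cderiv_mult; [apply cderiv_const|].
            apply cderiv_comp; [|exact K1].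
            apply cderiv_plus; [apply cderiv_const|].
            apply cderiv_mult; [apply cderiv_const|].
            apply cderiv_minus; [apply cderiv_id | apply cderiv_const].
          * cbv beta; field; exact Hne.
        + apply (clim_compose _ _ F' (fun w => z + u * (w - z))%C _ _) with (2 := K2).
          apply clim_plus; [apply clim_const|]; apply clim_mult; [apply clim_const|].
          apply clim_minus; [apply clim_id | apply clim_const]. }
    rewrite <- E0.
    apply (cint_derivative l (fun s w => F (z + s * (w - z)) / (w - z))%C
             (fun s w => F' (z + s * (w - z)))%C).
    - generalize (locally_ball_Cmod 0 u r Hu); apply locC_imp; intros v Hv.
      replace (v - 0)%C with v in Hv by ring; split.
      + apply path_continuous_mult; [|exact Hc2].
        intros w Hw.
        apply (clim_compose _ _ F (fun w => z + v * (w - z))%C (z + v * (w - z))%C).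
        * apply clim_plus; [apply clim_const|]; apply clim_mult; [apply clim_const|].
          now apply Hc1.
        * eapply cderiv_continuous, (HF v w Hv Hw).
      + intros w Hw.
        eapply cderiv_eq; cycle 1.
        * apply cderiv_mult; [|apply cderiv_const].
          apply cderiv_comp; [|apply (HF v w Hv Hw)].
          apply cderiv_plus; [apply cderiv_const|].
          apply cderiv_mult; [apply cderiv_id | apply cderiv_const].
        * cbv beta; field; apply Cminus_neq_0; auto.
    - intros w Hw; replace (u - 0)%C with u in Hu by ring.
      apply (clim_compose _ _ F' (fun p => z + fst p * (snd p - z))%C (z + u * (w - z))%C).
      + apply clim_plus; [apply clim_const|]; apply clim_mult; [apply clim_fst; typeclasses eauto|].
        apply clim_minus; [apply clim_snd; typeclasses eauto | apply clim_const].
      + apply (HF u w Hu Hw). }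
  change (phi s = (F z * cint (fun w => / (w - z)) l)%C).
  (* At parameter 0 the factor F is evaluated at z itself and leaves the integral. *)
  rewrite (cderiv_zero_constant phi (RtoC 0) r Hd s) by
    (replace (s - 0)%C with s by ring; exact Hs).
  unfold phi; rewrite <- cint_scal by exact Hc2.
  apply cint_ext; intros w Hw; unfold Cdiv; f_equal; f_equal; ring.
Qed.

Lemma cderiv_inv_pow (w z : C) (n : nat) : w <> z ->
  cderiv (fun u => Cpow (/ (w - u)) n)%C z (RtoC (INR n) * Cpow (/ (w - z)) (S n))%C.
Proof.
  intros Hwz; apply Cminus_neq_0 in Hwz; induction n as [|n IH].
  - eapply cderiv_eq; [|exact (cderiv_const (RtoC 1) z)]; simpl; ring.
  - rewrite S_INR, RtoC_plus.
    eapply cderiv_eq; cycle 1.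
    + apply (cderiv_mult (fun u => / (w - u))%C (fun u => Cpow (/ (w - u)) n)%C);
        [|exact IH].
      apply cderiv_inv; [|exact Hwz].
      apply cderiv_minus; [apply cderiv_const | apply cderiv_id].
    + simpl; field; exact Hwz.
Qed.

Lemma clim_pow {T : Type} (G : (T -> Prop) -> Prop) (FG : Filter G) (h : T -> C) (a : C) (n : nat) :
  clim G h a -> clim G (fun x => Cpow (h x) n) (Cpow a n).
Proof.
  intros Hh; induction n as [|n IH]; simpl; [apply clim_const | now apply clim_mult].
Qed.

(** A general exponent lets one rule produce the successive derivatives of a Cauchy integral. *)
Definition cauchy_kernel (phi : C -> C) (n : nat) (z w : C) : C :=
  (phi w * Cpow (/ (w - z)) n)%C.

Lemma not_trace_open (l : list arc) (z : C) : ~ trace l z ->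
  locC z (fun u => ~ trace l u).
Proof.
  intros Hz; destruct (trace_closed l z Hz) as [r [Hr H]].
  apply locally_Cmod; exists r; split; [exact Hr|]; intros u Hu Hu'.
  specialize (H u Hu'); lra.
Qed.

Lemma cauchy_kernel_continuous (l : list arc) (phi : C -> C) (n : nat) (z : C) :
  path_continuous l phi -> ~ trace l z -> path_continuous l (cauchy_kernel phi n z).
Proof.
  intros Hphi Hz; apply path_continuous_mult; [exact Hphi|].
  intros w Hw; apply clim_pow; [typeclasses eauto|].
  refine (path_continuous_inv l (fun u => u - z)%C _ _ w Hw);
    [|intros u Hu; apply Cminus_neq_0; congruence].
  apply path_continuous_minus; [apply path_continuous_id | apply path_continuous_const].
Qed.

Lemma cauchy_integral_derivative (l : list arc) (phi : C -> C) (n : nat) (z : C) :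
  path_continuous l phi -> ~ trace l z ->
  cderiv (fun u => cint (cauchy_kernel phi n u) l) z
    (RtoC (INR n) * cint (cauchy_kernel phi (S n) z) l)%C.
Proof.
  intros Hphi Hz; rewrite <- cint_scal by now apply cauchy_kernel_continuous.
  apply (cint_derivative l (cauchy_kernel phi n)
    (fun u w => RtoC (INR n) * cauchy_kernel phi (S n) u w)%C).
  - generalize (not_trace_open l z Hz); apply locC_imp; intros u Hu; split.
    + now apply cauchy_kernel_continuous.
    + intros w Hw; unfold cauchy_kernel.
      eapply cderiv_eq; cycle 1.
      * apply cderiv_mult; [apply cderiv_const | apply cderiv_inv_pow; congruence].
      * cring.
  - intros w Hw; apply clim_mult; [apply clim_const|]; apply clim_mult.
    + apply (clim_comp (within (trace l) (locC w)) snd phi (phi w)); [|now apply Hphi].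
      apply filterlim_snd; typeclasses eauto.
    + apply clim_pow; [typeclasses eauto|]; apply clim_inv.
      * apply clim_minus; [apply clim_snd | apply clim_fst]; typeclasses eauto.
      * apply Cminus_neq_0; congruence.
Qed.

(** The derivative integrates 1 / (w - z)^2, which has the primitive -1 / (w - z) along the trace.
    Winding integrals are thus locally constant off the cycle. *)
Lemma cycle_winding_derivative (l : list arc) (z : C) : cycle l -> ~ trace l z ->
  cderiv (fun u => cint (fun w => / (w - u))%C l) z (RtoC 0).
Proof.
  intros Hl Hz.
  pose proof (cauchy_integral_derivative l (fun _ => RtoC 1) 1 z
    (path_continuous_const l _) Hz) as H.
  eapply cderiv_eq; [|eapply cderiv_ext_loc; [|exact H]].
  - replace (cint (cauchy_kernel (fun _ => RtoC 1) 2 z) l) with (RtoC 0); [ring|].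
    symmetry; apply (Hl (fun w => - / (w - z))%C); intros w Hw.
    assert (Hwz : (w - z)%C <> RtoC 0) by (apply Cminus_neq_0; congruence).
    split.
    + eapply cderiv_eq; cycle 1.
      * apply cderiv_opp, cderiv_inv; [|exact Hwz].
        apply cderiv_minus; [apply cderiv_id | apply cderiv_const].
      * unfold cauchy_kernel; simpl; field; exact Hwz.
    + apply clim_mult; [apply clim_const|].
      apply clim_pow; [typeclasses eauto|]; apply clim_inv; [|exact Hwz].
      apply clim_minus; [apply clim_id | apply clim_const].
  - apply filter_forall; intros u; apply cint_ext; intros w _.
    unfold cauchy_kernel; simpl; ring.
Qed.

(** * Circles and Cauchy's integral formula *)

Lemma is_derive_RtoC (f : R -> R) (t d : R) :
  is_derive f t d -> is_derive_R (fun s => RtoC (f s)) t (RtoC d).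
Proof.
  intros H; apply (filterdiff_ext_lin (K := R_AbsRing) (U := R_NormedModule)
    (V := C_R_NormedModule) _ (fun y => RtoC (scal y d))).
  - apply (filterdiff_comp (K := R_AbsRing) (U := R_NormedModule)
      (V := R_NormedModule) (W := C_R_NormedModule) f RtoC _ RtoC H).
    apply filterdiff_linear; split.
    + intros x y; apply RtoC_plus.
    + intros k x; unfold scal; simpl; unfold prod_scal, scal; simpl.
      unfold mult, RtoC; simpl; f_equal; ring.
    + exists 1; split; [lra|]; intros x.
      rewrite <- Cmod_norm, Cmod_R, Rmult_1_l; apply Rle_refl.
  - intros y; unfold scal; simpl; unfold prod_scal, scal; simpl.
    unfold mult, RtoC; simpl; f_equal; ring.
Qed.

Definition cis (x : R) : C := (RtoC (cos x) + Ci * RtoC (sin x))%C.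

Lemma Cmod_cis (x : R) : Cmod (cis x) = 1.
Proof.
  unfold cis, Cmod; simpl.
  replace (_ + _) with 1; [apply sqrt_1|].
  pose proof (sin2_cos2 x) as H; unfold Rsqr in H; lra.
Qed.

Lemma is_derive_cis (k t : R) :
  is_derive_R (fun s => cis (k * s)) t (Ci * RtoC k * cis (k * t))%C.
Proof.
  assert (Hc : is_derive (fun s => cos (k * s)) t (- (k * sin (k * t)))).
  { auto_derive; [easy|]; ring. }
  assert (Hs : is_derive (fun s => sin (k * s)) t (k * cos (k * t))).
  { auto_derive; [easy|]; ring. }
  apply is_derive_RtoC in Hc, Hs.
  assert (Hs' : is_derive_R (fun s => Ci * RtoC (sin (k * s)))%C t
                  (Ci * RtoC (k * cos (k * t)))%C).
  { apply (is_derive_R_comp (fun w => Ci * w)%C) with (1 := Hs).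
    eapply cderiv_eq; [|apply cderiv_mult; [apply cderiv_const | apply cderiv_id]].
    cring. }
  pose proof (is_derive_plus (V := C_R_NormedModule) _ _ t _ _ Hc Hs') as H.
  replace (Ci * RtoC k * cis (k * t))%C
    with (RtoC (- (k * sin (k * t))) + Ci * RtoC (k * cos (k * t)))%C; [exact H|].
  unfold cis; rewrite RtoC_opp, !RtoC_mult.
  replace (- (RtoC k * RtoC (sin (k * t))))%C
    with (Ci * Ci * (RtoC k * RtoC (sin (k * t))))%C; [ring|].
  replace (Ci * Ci)%C with (- RtoC 1)%C; [ring|].
  unfold Ci, Cmult, Copp, RtoC; simpl; f_equal; ring.
Qed.

Definition circle (z0 : C) (r : R) : arc.
Proof.
  refine {| arc_fun := fun t => (z0 + RtoC r * cis (2 * PI * t))%C;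
            arc_der := fun t => (RtoC r * (Ci * RtoC (2 * PI) * cis (2 * PI * t)))%C |}.
  - intros t; apply (is_derive_R_comp (fun w => z0 + RtoC r * w)%C) with
      (1 := is_derive_cis (2 * PI) t).
    eapply cderiv_eq; [|apply cderiv_plus; [apply cderiv_const|];
      apply cderiv_mult; [apply cderiv_const | apply cderiv_id]].
    cring.
  - intros t; apply (clim_filterlim (locally t)); [apply locally_filter|].
    apply clim_mult; [apply clim_const|]; apply clim_mult; [apply clim_const|].
    exact (is_derive_R_continuous _ _ _ (is_derive_cis (2 * PI) t)).
Defined.

Lemma circle_cycle (z0 : C) (r : R) : cycle [circle z0 r].
Proof.
  apply chain_cycle with (circle z0 r 0); simpl; split; [reflexivity|].
  rewrite Rmult_1_r, Rmult_0_r; unfold cis.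
  now rewrite cos_2PI, sin_2PI, cos_0, sin_0.
Qed.

Lemma trace_circle (z0 w : C) (r : R) : 0 <= r -> trace [circle z0 r] w ->
  Cmod (w - z0) = r.
Proof.
  intros Hr [g [t [[<- | []] [_ <-]]]]; simpl.
  replace (z0 + RtoC r * cis (2 * PI * t) - z0)%C
    with (RtoC r * cis (2 * PI * t))%C by ring.
  rewrite Cmod_mult, Cmod_R, Cmod_cis, Rabs_pos_eq by exact Hr; ring.
Qed.

Definition two_pi_i : C := (RtoC (2 * PI) * Ci)%C.

Lemma two_pi_i_neq_0 : two_pi_i <> RtoC 0.
Proof.
  apply Cmult_neq_0.
  - intros E0; apply RtoC_inj in E0; pose proof PI_RGT_0; lra.
  - intros E0; apply (f_equal snd) in E0; simpl in E0; lra.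
Qed.

(** The integral is constant in z over the disc, and at the centre its parametrized integrand is the
    constant 2 pi i. *)
Lemma circle_winding (z0 z : C) (r : R) : Cmod (z - z0) < r ->
  cint (fun w => / (w - z))%C [circle z0 r] = two_pi_i.
Proof.
  intros Hz.
  assert (Hr : 0 < r) by (pose proof (Cmod_ge_0 (z - z0)); lra).
  rewrite (cderiv_zero_constant (fun u => cint (fun w => / (w - u))%C [circle z0 r]) z0 r)
    with (2 := Hz).
  - etransitivity; [exact (Cplus_0_r _)|].
    etransitivity.
    + apply (RInt_ext (V := C_R_CompleteNormedModule)) with (g := fun _ => two_pi_i).
      intros t _; simpl arc_fun; simpl arc_der.
      replace (z0 + RtoC r * cis (2 * PI * t) - z0)%C
        with (RtoC r * cis (2 * PI * t))%C by ring.
      assert (H1 : cis (2 * PI * t) <> RtoC 0).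
      { apply Cmod_gt_0; rewrite Cmod_cis; lra. }
      assert (H2 : RtoC r <> RtoC 0) by (intros E0; apply RtoC_inj in E0; lra).
      match goal with |- ?a = ?b => change (@eq C a b) end.
      unfold two_pi_i; field; auto.
    + etransitivity; [apply (RInt_const (V := C_R_CompleteNormedModule))|].
      rewrite Rminus_0_r; apply (scal_one (V := C_R_NormedModule)).
  - intros w Hw; apply cycle_winding_derivative; [apply circle_cycle|].
    intros Ht; apply trace_circle in Ht; lra.
Qed.

(** Continuity of F' is part of the hypothesis, so at this stage the formula is applied to a local
    primitive of a holomorphic function. *)
Lemma Cauchy_formula (F F' : C -> C) (z0 z : C) (r : R) :
  (forall w, Cmod (w - z0) < 2 * r -> primitive_at F F' w) ->
  Cmod (z - z0) < r / 4 ->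
  F z = (/ two_pi_i * cint (cauchy_kernel F 1 z) [circle z0 r])%C.
Proof.
  intros HF Hz.
  assert (Hr : 0 < r) by (pose proof (Cmod_ge_0 (z - z0)); lra).
  (* Any radius above 1 admits the parameter 1. On the circle |w - z| <= 5 r / 4, so z + s (w - z)
     stays within r / 4 + (6 / 5)(5 r / 4) = 7 r / 4 < 2 r of z0. *)
  pose proof (star_homotopy [circle z0 r] F F' z (6 / 5) (circle_cycle z0 r)) as H.
  rewrite circle_winding in H by lra.
  rewrite (cint_ext _ (fun w => F (z + RtoC 1 * (w - z)) / (w - z))%C).
  - rewrite H; [field; apply two_pi_i_neq_0 | | | rewrite Cmod_1; lra].
    + intros w Hw ->; apply trace_circle in Hw; lra.
    + intros s w Hs Hw; apply trace_circle in Hw; [|lra]; apply HF.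
      replace (z + s * (w - z) - z0)%C with ((z - z0) + s * (w - z))%C by ring.
      eapply Rle_lt_trans; [apply Cmod_triangle|]; rewrite Cmod_mult.
      pose proof (Cmod_le_sub w z0 z) as K; rewrite (Cmod_sym z0 z) in K.
      pose proof (Cmod_ge_0 s); pose proof (Cmod_ge_0 (w - z)).
      assert (Cmod s * Cmod (w - z) <= 6 / 5 * (5 / 4 * r)).
      { apply Rmult_le_compat; lra. }
      lra.
  - intros w Hw; unfold cauchy_kernel; simpl.
    replace (z + 1 * (w - z))%C with w by ring; unfold Cdiv; ring.
Qed.

Definition holo (U : C -> Prop) (f : C -> C) : Prop :=
  forall z, U z -> exists d, cderiv f z d.

(** A primitive F of f is a Cauchy integral with kernel exponent 1; so f = F' is one with exponent 2
    and f' one with exponent 3, which can be differentiated again. *)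
Lemma holo_local_second_derivative (f : C -> C) (z0 : C) (r : R) : 0 < r ->
  (forall w, Cmod (w - z0) < r -> exists d, cderiv f w d) ->
  exists f1, locC z0 (fun w => cderiv f w (f1 w)) /\ exists d, cderiv f1 z0 d.
Proof.
  intros Hr Hf; destruct (local_primitive f z0 r Hf) as [F HF].
  (* [Cauchy_formula] looks at twice the radius of the circle, here exactly r. *)
  pose (rho := r / 2); pose (l := [circle z0 rho]).
  assert (HF' : forall w, Cmod (w - z0) < 2 * rho -> primitive_at F f w).
  { intros w Hw; apply HF; unfold rho in Hw; lra. }
  assert (HFc : path_continuous l F).
  { apply continuous_path_continuous; intros w Hw; apply trace_circle in Hw;
      [|unfold rho; lra].
    eapply cderiv_continuous, HF; unfold rho in Hw; lra. }
  pose (J := fun n u => cint (cauchy_kernel F n u) l).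
  assert (HJ : forall n u, Cmod (u - z0) < rho / 4 ->
            cderiv (J n) u (RtoC (INR n) * J (S n) u)%C).
  { intros n u Hu; apply cauchy_integral_derivative; [exact HFc|].
    intros Ht; apply trace_circle in Ht; unfold rho in *; lra. }
  assert (Hz0 : Cmod (z0 - z0) < rho / 4) by (rewrite Cmod_self; unfold rho; lra).
  assert (HfJ : forall u, Cmod (u - z0) < rho / 4 -> f u = (/ two_pi_i * J 2%nat u)%C).
  { intros u Hu; apply (cderiv_unique F u).
    - apply HF'; unfold rho in *; lra.
    - apply cderiv_ext_loc with (fun v => / two_pi_i * J 1%nat v)%C.
      + generalize (locally_ball_Cmod z0 u _ Hu); apply locC_imp; intros v Hv.
        symmetry; now apply (Cauchy_formula F f z0 v rho).
      + eapply cderiv_eq; [|apply cderiv_mult; [apply cderiv_const | apply HJ, Hu]].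
        simpl INR; cring. }
  exists (fun u => / two_pi_i * (RtoC (INR 2) * J 3%nat u))%C; split.
  - generalize (locally_ball_Cmod z0 z0 _ Hz0); apply locC_imp; intros u Hu.
    apply cderiv_ext_loc with (fun v => / two_pi_i * J 2%nat v)%C.
    + generalize (locally_ball_Cmod z0 u _ Hu); apply locC_imp; intros v Hv.
      symmetry; now apply HfJ.
    + eapply cderiv_eq; [|apply cderiv_mult; [apply cderiv_const | apply HJ, Hu]].
      cring.
  - eexists; apply cderiv_mult; [apply cderiv_const|].
    apply cderiv_mult; [apply cderiv_const | apply HJ, Hz0].
Qed.

(** The derivative is selected point by point; uniqueness identifies it near each point with the
    local one. *)
Lemma holo_derivative (U : C -> Prop) (f : C -> C) :
  (forall z, U z -> locC z U) -> holo U f ->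
  exists f', (forall z, U z -> cderiv f z (f' z)) /\ holo U f'.
Proof.
  intros HU Hf.
  pose (f' := fun z => epsilon (inhabits (RtoC 0)) (cderiv f z)).
  assert (Hf' : forall z, U z -> cderiv f z (f' z)).
  { intros z Hz; unfold f'; apply epsilon_spec; auto. }
  exists f'; split; [exact Hf'|]; intros z Hz.
  pose proof (HU z Hz) as Hloc; apply locally_Cmod in Hloc.
  destruct Hloc as [r [Hr Hloc]].
  destruct (holo_local_second_derivative f z r Hr) as [f1 [Hf1 [d Hd]]].
  { intros w Hw; auto. }
  exists d; apply cderiv_ext_loc with f1; [|exact Hd].
  generalize (filter_and (F := locC z) _ _ Hf1 (HU z Hz)); apply locC_imp.
  intros w [H1 H2]; apply (cderiv_unique f w); auto.
Qed.

(** * Cauchy's theorem for cycles *)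

(** [star_homotopy] dilates the unit circle about z0 by an arbitrarily large factor: the integral
    keeps the value 2 pi i h z0 while h tends to 0 on the dilated circle. *)
Lemma Liouville_vanishing (h : C -> C) (z0 : C) : holo (fun _ => True) h ->
  (forall eps, 0 < eps -> exists R0, forall z, R0 <= Cmod z -> Cmod (h z) <= eps) ->
  h z0 = RtoC 0.
Proof.
  intros Hh Hinf.
  destruct (holo_derivative _ h (fun z _ => filter_true) Hh) as [h' [Hh' Hh'']].
  assert (Hprim : forall z, primitive_at h h' z).
  { intros z; split; [now apply Hh'|].
    destruct (Hh'' z I) as [d Hd]; eapply cderiv_continuous, Hd. }
  destruct (cint_bound [circle z0 1]) as [L [HL HB]].
  assert (Hw1 : cint (fun w => / (w - z0))%C [circle z0 1] = two_pi_i).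
  { apply circle_winding; rewrite Cmod_self; lra. }
  assert (Hsmall : forall eps, 0 < eps -> Cmod (h z0 * two_pi_i) <= L * eps).
  { intros eps He; destruct (Hinf eps He) as [R0 HR0].
    (* Then |z0 + s (w - z0)| >= s - |z0| >= R0 for w on the unit circle about z0. *)
    pose (s := Rabs R0 + Cmod z0).
    assert (Hs0 : 0 <= s).
    { unfold s; pose proof (Cmod_ge_0 z0); pose proof (Rabs_pos R0); lra. }
    assert (Hne : forall w, trace [circle z0 1] w -> w <> z0).
    { intros w Hw ->; apply trace_circle in Hw; [|lra].
      rewrite Cmod_self in Hw; lra. }
    rewrite <- Hw1.
    rewrite <- (star_homotopy [circle z0 1] h h' z0 (s + 1)) with (s := RtoC s).
    - apply HB.
      + apply path_continuous_div.
        * apply continuous_path_continuous; intros w _.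
          apply (clim_compose _ _ h (fun w => z0 + RtoC s * (w - z0))%C
                   (z0 + RtoC s * (w - z0))%C).
          -- apply clim_plus; [apply clim_const|]; apply clim_mult; [apply clim_const|].
             apply clim_minus; [apply clim_id | apply clim_const].
          -- eapply cderiv_continuous, Hprim.
        * apply path_continuous_minus; [apply path_continuous_id | apply path_continuous_const].
        * intros w Hw; apply Cminus_neq_0; auto.
      + intros w Hw; rewrite Cmod_div by (apply Cminus_neq_0; auto).
        apply trace_circle in Hw; [|lra]; rewrite Hw.
        unfold Rdiv; rewrite Rinv_1, Rmult_1_r; apply HR0.
        pose proof (Cmod_triangle (z0 + RtoC s * (w - z0)) (- z0)) as K.
        replace (z0 + RtoC s * (w - z0) + - z0)%C with (RtoC s * (w - z0))%C in K by ring.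
        rewrite Cmod_mult, Cmod_R, Hw, Cmod_opp, Rabs_pos_eq in K by exact Hs0.
        pose proof (Rle_abs R0); unfold s in K; fold s in K; unfold s in *; lra.
    - apply circle_cycle.
    - exact Hne.
    - intros u w _ _; apply Hprim.
    - rewrite Cmod_R, Rabs_pos_eq; lra. }
  assert (E0 : (h z0 * two_pi_i)%C = RtoC 0).
  { apply Cmod_eq_0, Rle_antisym; [|apply Cmod_ge_0].
    apply Rle_plus_epsilon; intros e He.
    eapply Rle_trans; [apply (Hsmall (e / (L + 1))); apply Rdiv_lt_0_compat; lra|].
    apply Rmult_le_reg_r with (L + 1); [lra|].
    replace (L * (e / (L + 1)) * (L + 1)) with (L * e) by (field; lra); lra. }
  replace (h z0) with (h z0 * two_pi_i / two_pi_i)%C by (field; apply two_pi_i_neq_0).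
  rewrite E0; unfold Cdiv; ring.
Qed.

(** [star_homotopy] about p for F v = (v - p) / (v - z): at parameter 1 the integrand is 1 / (w -
    z), and F p = 0 makes the other side vanish. *)
Lemma winding_far (l : list arc) (R0 : R) (z : C) : cycle l -> 0 <= R0 ->
  (forall w, trace l w -> Cmod w <= R0) -> 10 * (R0 + 1) < Cmod z ->
  cint (fun w => / (w - z))%C l = RtoC 0.
Proof.
  intros Hl HR0 HR Hz.
  (* This p lies off the trace. For |s| < 2 the point p + s (w - p) has modulus at most R0 + 1 + 2
     (2 R0 + 1), below 10 (R0 + 1), so it never meets z. *)
  pose (p := RtoC (R0 + 1)).
  assert (Hp : Cmod p = R0 + 1) by (unfold p; rewrite Cmod_R, Rabs_pos_eq; lra).
  assert (Hwp : forall w, trace l w -> w <> p).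
  { intros w Hw ->; apply HR in Hw; lra. }
  pose proof (star_homotopy l (fun v => (v - p) / (v - z))%C
    (fun v => (p - z) * (/ (v - z) * / (v - z)))%C p 2 Hl Hwp) as H.
  assert (Hprim : forall s w, Cmod s < 2 -> trace l w -> primitive_at
      (fun v => (v - p) / (v - z))%C (fun v => (p - z) * (/ (v - z) * / (v - z)))%C
      (p + s * (w - p))%C).
  { intros s w Hs Hw.
    assert (Hne : (p + s * (w - p) - z)%C <> RtoC 0).
    { apply Cminus_neq_0; intros E0; rewrite <- E0 in Hz.
      pose proof (Cmod_triangle p (s * (w - p))) as K1; rewrite Cmod_mult in K1.
      pose proof (Cmod_triangle w (- p)) as K2; rewrite Cmod_opp in K2.
      pose proof (HR w Hw) as K3.
      assert (Cmod s * Cmod (w - p) <= 2 * (2 * R0 + 1)).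
      { apply Rmult_le_compat; try apply Cmod_ge_0; [lra|].
        change (w - p)%C with (w + - p)%C; lra. }
      lra. }
    split.
    - eapply cderiv_eq; cycle 1.
      + apply cderiv_mult; [apply cderiv_minus; [apply cderiv_id | apply cderiv_const]|].
        apply cderiv_inv; [|exact Hne].
        apply cderiv_minus; [apply cderiv_id | apply cderiv_const].
      + cbv beta; field; exact Hne.
    - apply clim_mult; [apply clim_const|].
      apply clim_mult; (apply clim_inv; [|exact Hne]);
        (apply clim_minus; [apply clim_id | apply clim_const]). }
  specialize (H Hprim (RtoC 1)).
  rewrite (cint_ext _ (fun w => (p + RtoC 1 * (w - p) - p) /
             (p + RtoC 1 * (w - p) - z) / (w - p))%C).
  - rewrite H by (rewrite Cmod_1; lra); unfold Cdiv; ring.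
  - intros w Hw.
    replace (p + RtoC 1 * (w - p))%C with w by ring.
    field; repeat split; apply Cminus_neq_0; auto.
    intros ->; apply HR in Hw; lra.
Qed.

(** * Divided differences *)

Lemma second_order_bound (f f1 f2 : C -> C) (z0 A : C) (d eps : R) :
  (forall u, Cmod (u - z0) < d ->
     cderiv f u (f1 u) /\ cderiv f1 u (f2 u) /\ Cmod (f2 u - A) <= eps) ->
  forall z w, Cmod (z - z0) < d / 3 -> Cmod (w - z0) < d / 3 ->
  Cmod (f w - f z - f1 z * (w - z) - A * / RtoC 2 * ((w - z) * (w - z)))
    <= 4 * eps * (Cmod (w - z) * Cmod (w - z)).
Proof.
  intros Hf z w Hz Hw.
  pose proof RtoC_2_neq_0 as H2.
  (* The radius d / 3 leaves room for u: it is within 2 d / 3 of z, which is within d / 3 of z0. *)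
  assert (Hin : forall u, Cmod (u - z) <= Cmod (w - z) -> Cmod (u - z0) < d).
  { intros u Hu; pose proof (Cmod_le_sub u z z0); pose proof (Cmod_le_sub w z0 z).
    rewrite (Cmod_sym z0 z) in *; lra. }
  (* The mean value bound is used twice, for f1 to bound k' and then for k, so the constant is 2 *
     2. *)
  pose (k := fun u => (f u - f z - f1 z * (u - z) - A * / RtoC 2 * ((u - z) * (u - z)))%C).
  assert (Hk : forall u, Cmod (u - z) <= Cmod (w - z) ->
            cderiv k u (f1 u - f1 z - A * (u - z))%C /\
            Cmod (f1 u - f1 z - A * (u - z) - 0) <= 2 * eps * Cmod (w - z)).
  { intros u Hu; split.
    - unfold k; eapply cderiv_eq; cycle 1.
      + apply cderiv_minus; [apply cderiv_minus; [apply cderiv_minus|]|].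
        * apply (Hf u (Hin u Hu)).
        * apply cderiv_const.
        * apply cderiv_mult; [apply cderiv_const|].
          apply cderiv_minus; [apply cderiv_id | apply cderiv_const].
        * apply cderiv_mult; [apply cderiv_const|].
          apply cderiv_mult; (apply cderiv_minus; [apply cderiv_id | apply cderiv_const]).
      + cbv beta; replace (RtoC 2) with (RtoC 1 + RtoC 1)%C in *
          by (rewrite <- RtoC_plus; f_equal; ring).
        field; exact H2.
    - replace (f1 u - f1 z - A * (u - z) - 0)%C with (f1 u - f1 z - A * (u - z))%C by ring.
      eapply Rle_trans.
      + apply (mean_value_bound f1 f2 z A (Cmod (u - z)) eps); [|apply Rle_refl].
        intros v Hv; apply (Hf v (Hin v ltac:(lra))).
      + apply Rmult_le_compat_l; [|exact Hu].
        destruct (Hf z (Hin z ltac:(rewrite Cmod_self; apply Cmod_ge_0))) as [_ [_ K]].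
        pose proof (Cmod_ge_0 (f2 z - A)); lra. }
  pose proof (mean_value_bound k _ z (RtoC 0) (Cmod (w - z)) (2 * eps * Cmod (w - z)) Hk
                w (Rle_refl _)) as K.
  replace (k w - k z - 0 * (w - z))%C with (k w) in K by (unfold k; ring).
  unfold k in K; lra.
Qed.

Definition divdiff (f f1 : C -> C) (z w : C) : C :=
  if excluded_middle_informative (z = w) then f1 z else ((f w - f z) / (w - z))%C.

(** The derivative of [divdiff f f1 z w] in [z]. *)
Definition divdiff1 (f f1 f2 : C -> C) (z w : C) : C :=
  if excluded_middle_informative (z = w) then (f2 z * / RtoC 2)%C
  else ((f w - f z - f1 z * (w - z)) / ((w - z) * (w - z)))%C.

Lemma divdiff_neq (f f1 : C -> C) (z w : C) : z <> w ->
  divdiff f f1 z w = ((f w - f z) / (w - z))%C.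
Proof. intros Hzw; unfold divdiff; now destruct excluded_middle_informative. Qed.

Lemma divdiff_diag (f f1 : C -> C) (z : C) : divdiff f f1 z z = f1 z.
Proof. unfold divdiff; now destruct excluded_middle_informative. Qed.

Lemma divdiff1_neq (f f1 f2 : C -> C) (z w : C) : z <> w ->
  divdiff1 f f1 f2 z w = ((f w - f z - f1 z * (w - z)) / ((w - z) * (w - z)))%C.
Proof. intros Hzw; unfold divdiff1; now destruct excluded_middle_informative. Qed.

Lemma divdiff1_diag (f f1 f2 : C -> C) (z : C) : divdiff1 f f1 f2 z z = (f2 z * / RtoC 2)%C.
Proof. unfold divdiff1; now destruct excluded_middle_informative. Qed.

Lemma locC_neq (z w : C) : z <> w -> locC z (fun u => u <> w).
Proof.
  intros Hzw.
  generalize (clim_neq_0 (F := locC z) (fun u => u - w)%C (z - w)%C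
    (clim_minus _ _ _ _ (clim_id z) (clim_const w)) (Cminus_neq_0 _ _ Hzw)).
  apply locC_imp; intros u Hu ->; apply Hu; ring.
Qed.

Lemma divdiff_continuous (f f1 : C -> C) (z w : C) :
  cderiv f z (f1 z) -> clim (locC w) f (f w) ->
  clim (locC w) (divdiff f f1 z) (divdiff f f1 z w).
Proof.
  intros Dz Hw; destruct (classic (z = w)) as [<- | Hne].
  (* On the diagonal the Caratheodory quotient at z is the divided difference itself. *)
  - rewrite divdiff_diag; destruct Dz as [q [Hq Hf]].
    apply clim_ext_loc with q; [|exact Hq].
    revert Hf; apply locC_imp; intros u Hu.
    destruct (classic (z = u)) as [<- | Hzu].
    + rewrite divdiff_diag; now apply clim_at_point.
    + rewrite divdiff_neq, Hu by exact Hzu.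
      field; apply Cminus_neq_0; congruence.
  - rewrite divdiff_neq by exact Hne.
    apply clim_ext_loc with (fun u => (f u - f z) / (u - z))%C.
    + generalize (locC_neq w z ltac:(congruence)); apply locC_imp.
      intros u Hu; rewrite divdiff_neq; congruence.
    + apply clim_div.
      * apply clim_minus; [exact Hw | apply clim_const].
      * apply clim_minus; [apply clim_id | apply clim_const].
      * apply Cminus_neq_0; congruence.
Qed.

Section DividedDifference.
Variables (U : C -> Prop) (f f1 f2 : C -> C).
Hypothesis HU : forall z, U z -> locC z U.
Hypothesis Hf1 : forall z, U z -> cderiv f z (f1 z).
Hypothesis Hf2 : forall z, U z -> cderiv f1 z (f2 z).
Hypothesis Cf2 : forall z, U z -> clim (locC z) f2 (f2 z).

(** Both points vary and the coefficient is frozen at z0. This uniformity gives differentiability of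
    the divided difference at the diagonal and also joint continuity of its derivative there. *)
Lemma holo_second_order (z0 : C) (eps : R) : U z0 -> 0 < eps ->
  exists d, 0 < d /\ forall z w, Cmod (z - z0) < d -> Cmod (w - z0) < d ->
    Cmod (f w - f z - f1 z * (w - z) - f2 z0 * / RtoC 2 * ((w - z) * (w - z)))
      <= eps * (Cmod (w - z) * Cmod (w - z)).
Proof.
  intros Hz0 He.
  pose proof (filter_and (F := locC z0) _ _ (HU z0 Hz0) (Cf2 z0 Hz0 (eps / 4) ltac:(lra))) as H.
  apply locally_Cmod in H; destruct H as [d [Hd H]].
  exists (d / 3); split; [lra|]; intros z w Hz Hw.
  replace eps with (4 * (eps / 4)) by field.
  apply (second_order_bound f f1 f2 z0 (f2 z0) d (eps / 4)); [|exact Hz | exact Hw].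
  intros u Hu; destruct (H u Hu) as [K1 K2]; repeat split; auto; lra.
Qed.

Lemma divdiff_cderiv (z w : C) : U z -> U w ->
  cderiv (fun u => divdiff f f1 u w) z (divdiff1 f f1 f2 z w).
Proof.
  intros Hz Hw; destruct (classic (z = w)) as [<- | Hne].
  - rewrite divdiff1_diag; apply cderiv_bound; intros eps He.
    destruct (holo_second_order z eps Hz He) as [d [Hd H]].
    apply locally_Cmod; exists d; split; [exact Hd|]; intros u Hu.
    rewrite divdiff_diag; destruct (classic (u = z)) as [-> | Huz].
    + rewrite divdiff_diag, Cmod_self.
      replace (f1 z - f1 z - f2 z * / RtoC 2 * (z - z))%C with (RtoC 0) by ring.
      rewrite Cmod_0; lra.
    + rewrite divdiff_neq by exact Huz.
      assert (Hz0 : Cmod (z - z) < d) by (rewrite Cmod_self; exact Hd).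
      pose proof (H z u Hz0 Hu) as K.
      assert (Hzu : (u - z)%C <> RtoC 0) by now apply Cminus_neq_0.
      pose proof (proj1 (Cmod_gt_0 _) Hzu) as Hpos.
      replace ((f z - f u) / (z - u) - f1 z - f2 z * / RtoC 2 * (u - z))%C
        with ((f u - f z - f1 z * (u - z) - f2 z * / RtoC 2 * ((u - z) * (u - z)))
              / (u - z))%C.
      * rewrite Cmod_div by exact Hzu.
        apply Rmult_le_reg_r with (Cmod (u - z)); [exact Hpos|].
        unfold Rdiv; rewrite Rmult_assoc, Rinv_l, Rmult_1_r by lra; lra.
      * pose proof RtoC_2_neq_0 as H2.
        assert (Huz' : (z - u)%C <> RtoC 0) by (apply Cminus_neq_0; congruence).
        field; auto.
  - rewrite divdiff1_neq by exact Hne.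
    assert (Hwz : (w - z)%C <> RtoC 0) by (apply Cminus_neq_0; congruence).
    apply cderiv_ext_loc with (fun u => (f w - f u) / (w - u))%C.
    + generalize (locC_neq z w Hne); apply locC_imp; intros u Hu.
      now rewrite divdiff_neq.
    + eapply cderiv_eq; cycle 1.
      * apply cderiv_mult.
        -- apply cderiv_minus; [apply cderiv_const | apply Hf1, Hz].
        -- apply cderiv_inv; [|exact Hwz].
           apply cderiv_minus; [apply cderiv_const | apply cderiv_id].
      * cbv beta; field; exact Hwz.
Qed.

Lemma divdiff1_continuous (D : C -> Prop) (z w : C) : U z -> U w ->
  clim (filter_prod (locC z) (within D (locC w)))
    (fun p => divdiff1 f f1 f2 (fst p) (snd p)) (divdiff1 f f1 f2 z w).
Proof.
  intros Hz Hw; destruct (classic (z = w)) as [<- | Hne].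
  - intros eps He; rewrite divdiff1_diag.
    destruct (holo_second_order z (eps / 2) Hz ltac:(lra)) as [d [Hd H]].
    assert (Hc : clim (locC z) (fun u => f2 u * / RtoC 2)%C (f2 z * / RtoC 2)%C).
    { apply clim_mult; [now apply Cf2 | apply clim_const]. }
    apply (Filter_prod _ _ _
      (fun u => Cmod (u - z) < d /\ Cmod (f2 u * / RtoC 2 - f2 z * / RtoC 2) < eps)
      (fun v => Cmod (v - z) < d)).
    + apply filter_and; [apply locally_ball_Cmod; rewrite Cmod_self; exact Hd|].
      exact (Hc eps He).
    + apply (clim_locally_within (locC z) _ D (fun v => v) z (clim_id z)); exact Hd.
    + intros u v [Hu Hu2] Hv; simpl.
      destruct (classic (u = v)) as [<- | Huv]; [now rewrite divdiff1_diag|].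
      rewrite divdiff1_neq by exact Huv.
      assert (Hvu : (v - u)%C <> RtoC 0) by (apply Cminus_neq_0; congruence).
      pose proof (proj1 (Cmod_gt_0 _) Hvu) as Hpos.
      pose proof RtoC_2_neq_0 as H2.
      replace ((f v - f u - f1 u * (v - u)) / ((v - u) * (v - u)) - f2 z * / RtoC 2)%C
        with ((f v - f u - f1 u * (v - u) - f2 z * / RtoC 2 * ((v - u) * (v - u)))
              / ((v - u) * (v - u)))%C by (field; auto).
      rewrite Cmod_div, Cmod_mult by now apply Cmult_neq_0.
      assert (Hpos2 : 0 < Cmod (v - u) * Cmod (v - u)) by now apply Rmult_lt_0_compat.
      apply Rmult_lt_reg_r with (Cmod (v - u) * Cmod (v - u)); [exact Hpos2|].
      unfold Rdiv; rewrite Rmult_assoc, Rinv_l, Rmult_1_r by lra.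
      eapply Rle_lt_trans; [apply (H u v Hu Hv)|].
      apply Rmult_lt_compat_r; lra.
  - rewrite divdiff1_neq by exact Hne.
    pose (FP := filter_prod (locC z) (within D (locC w))).
    assert (FFP : Filter FP) by (unfold FP; typeclasses eauto).
    assert (C1 : clim FP fst z) by (apply clim_fst; typeclasses eauto).
    assert (C2 : clim FP snd w) by (apply clim_snd; typeclasses eauto).
    assert (C3 : clim FP (fun p => f (fst p)) (f z)).
    { apply (clim_compose FP _ f fst z _ C1); eapply cderiv_continuous, Hf1, Hz. }
    assert (C4 : clim FP (fun p => f (snd p)) (f w)).
    { apply (clim_compose FP _ f snd w _ C2); eapply cderiv_continuous, Hf1, Hw. }
    assert (C5 : clim FP (fun p => f1 (fst p)) (f1 z)).
    { apply (clim_compose FP _ f1 fst z _ C1); eapply cderiv_continuous, Hf2, Hz. }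
    pose proof (clim_minus _ _ _ _ C2 C1) as C6.
    assert (Hwz : (w - z)%C <> RtoC 0) by (apply Cminus_neq_0; congruence).
    apply clim_ext_loc with (fun p => (f (snd p) - f (fst p) - f1 (fst p) * (snd p - fst p)) /
        ((snd p - fst p) * (snd p - fst p)))%C.
    + generalize (clim_neq_0 _ _ C6 Hwz); apply filter_imp; intros [u v] Huv.
      simpl in *; rewrite divdiff1_neq; [reflexivity|]; intros ->; apply Huv; ring.
    + apply clim_div; [|now apply clim_mult | now apply Cmult_neq_0].
      apply clim_minus; [now apply clim_minus | now apply clim_mult].
Qed.

End DividedDifference.

(** Dixon's argument: the integral of the divided difference over the cycle extends to
    an entire function vanishing at infinity. *)
Theorem Cauchy_homology (U : C -> Prop) (f : C -> C) (l : list arc) (z0 : C) :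
  (forall z, U z -> locC z U) -> holo U f -> cycle l ->
  (forall w, trace l w -> U w) ->
  (forall z, ~ U z -> cint (fun w => / (w - z))%C l = RtoC 0) ->
  U z0 -> ~ trace l z0 ->
  cint (fun w => (f w - f z0) / (w - z0))%C l = RtoC 0.
Proof.
  intros HU Hf Hl HlU Hwind Hz0 Hz0l.
  destruct (holo_derivative U f HU Hf) as [f1 [Hf1 Hf1']].
  destruct (holo_derivative U f1 HU Hf1') as [f2 [Hf2 Hf2']].
  assert (Cf2 : forall z, U z -> clim (locC z) f2 (f2 z)).
  { intros z Hz; destruct (Hf2' z Hz) as [d Hd]; eapply cderiv_continuous, Hd. }
  assert (Cf : path_continuous l f).
  { apply continuous_path_continuous; intros w Hw.
    eapply cderiv_continuous, Hf1, HlU, Hw. }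
  (* Dixon's function: the divided difference makes sense even on the cycle, the Cauchy integral
     outside [U]. *)
  pose (h := fun z => if excluded_middle_informative (U z) then cint (divdiff f f1 z) l
                      else cint (cauchy_kernel f 1 z) l).
  assert (hin : forall z, U z -> h z = cint (divdiff f f1 z) l).
  { intros z Hz; unfold h; now destruct excluded_middle_informative. }
  (* Off the trace the two formulas differ by f z times the winding integral, so they agree wherever
     that integral vanishes. *)
  assert (hker : forall z, ~ trace l z -> cint (fun w => / (w - z))%C l = RtoC 0 ->
            h z = cint (cauchy_kernel f 1 z) l).
  { intros z Hz Hw0; unfold h; destruct excluded_middle_informative as [Uz|]; [|reflexivity].
    assert (Ck : path_continuous l (fun w => / (w - z))%C).
    { apply path_continuous_inv.
      - apply path_continuous_minus; [apply path_continuous_id | apply path_continuous_const].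
      - intros w Hw; apply Cminus_neq_0; congruence. }
    rewrite (cint_ext _ (fun w => cauchy_kernel f 1 z w - f z * / (w - z))%C).
    - rewrite cint_minus, cint_scal, Hw0.
      + ring.
      + exact Ck.
      + now apply cauchy_kernel_continuous.
      + apply path_continuous_mult; [apply path_continuous_const | exact Ck].
    - intros w Hw; rewrite divdiff_neq by congruence.
      unfold cauchy_kernel; simpl; field; apply Cminus_neq_0; congruence. }
  assert (hholo : holo (fun _ => True) h).
  { intros z _; destruct (classic (U z)) as [Uz | Uz].
    - exists (cint (divdiff1 f f1 f2 z) l).
      apply cderiv_ext_loc with (fun u => cint (divdiff f f1 u) l).
      + generalize (HU z Uz); apply locC_imp; intros u Hu; symmetry; now apply hin.
      + apply cint_derivative.
        * generalize (HU z Uz); apply locC_imp; intros u Hu; split.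
          -- apply continuous_path_continuous; intros w Hw.
             apply divdiff_continuous; [now apply Hf1|].
             eapply cderiv_continuous, Hf1, HlU, Hw.
          -- intros w Hw; apply divdiff_cderiv with U; auto.
        * intros w Hw; apply divdiff1_continuous with U; auto.
    - assert (Hzl : ~ trace l z) by (intros Hz; apply Uz, HlU, Hz).
      destruct (trace_closed l z Hzl) as [r [Hr Hrl]].
      (* On this disc the winding integral is constant, hence zero as at its centre. So h is a
         Cauchy integral on the whole disc, including its points in [U]. *)
      assert (Hout : forall u, Cmod (u - z) < r -> ~ trace l u).
      { intros u Hu Hul; specialize (Hrl u Hul); lra. }
      eexists; apply cderiv_ext_loc with (fun u => cint (cauchy_kernel f 1 u) l).
      + apply locally_Cmod; exists r; split; [exact Hr|]; intros u Hu.
        symmetry; apply hker; [now apply Hout|].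
        rewrite <- (Hwind z Uz).
        apply (cderiv_zero_constant (fun u => cint (fun w => / (w - u))%C l) z r);
          [|exact Hu].
        intros v Hv; apply cycle_winding_derivative; [exact Hl | now apply Hout].
      + now apply cauchy_integral_derivative. }
  assert (hinf : forall eps, 0 < eps ->
            exists R0, forall z, R0 <= Cmod z -> Cmod (h z) <= eps).
  { intros eps He.
    destruct (bounded_trace l (fun w => w) (path_continuous_id l)) as [R0 [HR0 HR]].
    destruct (bounded_trace l f Cf) as [M [HM HfM]].
    destruct (cint_bound l) as [L [HL HB]].
    assert (HLM : 0 <= L * M) by now apply Rmult_le_pos.
    assert (HLe : 0 <= L * M / eps) by (apply Rdiv_le_0_compat; lra).
    (* The first term triggers [winding_far]; the rest keeps z at distance 1 + L M / eps from the
       trace, so the Cauchy integral is at most L M / (1 + L M / eps) <= eps. *)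
    exists (10 * (R0 + 1) + 1 + L * M / eps); intros z Hz.
    assert (Hzl : ~ trace l z).
    { intros Hzl; specialize (HR z Hzl); lra. }
    rewrite hker; [|exact Hzl | apply winding_far with R0; auto; lra].
    assert (Hd : forall w, trace l w -> 1 + L * M / eps <= Cmod (w - z)).
    { intros w Hw; specialize (HR w Hw); rewrite Cmod_sym.
      pose proof (Cmod_triangle (z - w) w) as K.
      replace (z - w + w)%C with z in K by ring; lra. }
    eapply Rle_trans.
    - apply HB with (M := M / (1 + L * M / eps)).
      + now apply cauchy_kernel_continuous.
      + intros w Hw; unfold cauchy_kernel; simpl; specialize (Hd w Hw).
        assert (Hne : (w - z)%C <> RtoC 0) by (apply Cminus_neq_0; congruence).
        replace (f w * (/ (w - z) * 1))%C with (f w / (w - z))%C by (field; exact Hne).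
        rewrite Cmod_div by exact Hne; unfold Rdiv at 1 2.
        apply Rmult_le_compat; [apply Cmod_ge_0 | | now apply HfM |].
        * left; apply Rinv_0_lt_compat; lra.
        * apply Rinv_le_contravar; lra.
    - apply Rmult_le_reg_r with (1 + L * M / eps); [lra|].
      replace (L * (M / (1 + L * M / eps)) * (1 + L * M / eps)) with (L * M) by (field; lra).
      replace (eps * (1 + L * M / eps)) with (eps + L * M) by (field; lra); lra. }
  rewrite (cint_ext _ (divdiff f f1 z0)).
  - rewrite <- hin by exact Hz0; now apply Liouville_vanishing.
  - intros w Hw; rewrite divdiff_neq; congruence.
Qed.

(** * Resolvents *)

Section OperatorAlgebra.
Context {H : HilbertSpace}.
Implicit Types A B T : BOp H.

Lemma inner_opp_l (x y : H) : inner (opp x) y = (- inner x y)%C.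
Proof.
  rewrite <- scal_m1, inner_scal_l.
  replace (RtoC (-1)) with (- RtoC 1)%C by (rewrite <- RtoC_opp; reflexivity); ring.
Qed.

Lemma inner_minus_l (x y z : H) : inner (minus x y) z = (inner x z - inner y z)%C.
Proof. unfold minus; now rewrite inner_plus_l, inner_opp_l. Qed.

Lemma inner_ext (x y : H) : (forall z, inner x z = inner y z) -> x = y.
Proof.
  intros Hxy; apply hs_minus_eq0, hs_norm_eq_zero.
  pose proof (inner_norm H (minus x y)) as Hn.
  rewrite inner_minus_l, Hxy in Hn.
  replace (inner y (minus x y) - inner y (minus x y))%C with (RtoC 0) in Hn by ring.
  apply RtoC_inj in Hn; symmetry in Hn.
  destruct (Req_dec (norm (minus x y)) 0) as [|Hne]; [assumption|].
  exfalso; revert Hn; now apply pow_nonzero.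
Qed.

Lemma bop_plus A (x y : H) : A (plus x y) = plus (A x) (A y).
Proof. apply (linear_plus A (bop_linear A)). Qed.

Lemma bop_scal A (a : C) (x : H) : A (scal a x) = scal a (A x).
Proof. apply (linear_scal A (bop_linear A)). Qed.

Lemma bop_opp A (x : H) : A (opp x) = opp (A x).
Proof. rewrite <- !scal_m1; apply bop_scal. Qed.

Lemma bop_minus A (x y : H) : A (minus x y) = minus (A x) (A y).
Proof. unfold minus; now rewrite bop_plus, bop_opp. Qed.

Lemma plus_apply A B (x : H) : (plus A B : BOp H) x = plus (A x) (B x).
Proof. reflexivity. Qed.

Lemma scal_apply (a : C) A (x : H) : op_scal a A x = scal a (A x).
Proof. reflexivity. Qed.

Lemma comp_apply A B (x : H) : op_comp A B x = A (B x).
Proof. reflexivity. Qed.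

Lemma id_apply (x : H) : op_id x = x.
Proof. reflexivity. Qed.

End OperatorAlgebra.

Ltac op_expand := match goal with |- context [@inner ?H _ _] =>
  repeat progress rewrite ?(@minus_apply H), ?(@plus_apply H), ?(@scal_apply H),
    ?(@comp_apply H), ?(@id_apply H), ?(@bop_plus H), ?(@bop_scal H), ?(@bop_minus H),
    ?(@inner_minus_l H), ?(@inner_plus_l H), ?(@inner_scal_l H)
  end.

(** Vectors are compared through their inner products, so that identities
    between operators become identities between complex numbers. *)
Ltac op_ring := apply BOp_eq; let x := fresh "x" in intros x;
  apply inner_ext; let y := fresh "y" in intros y; op_expand; ring.

Section Operators.
Context {H : HilbertSpace}.
Implicit Types A B T : BOp H.

Lemma opnorm_comp A B : opnorm (op_comp A B) <= opnorm A * opnorm B.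
Proof.
  apply opnorm_le.
  - apply Rmult_le_pos; apply opnorm_ge_0.
  - intros x; rewrite comp_apply, Rmult_assoc.
    eapply Rle_trans; [apply opnorm_bound|].
    apply Rmult_le_compat_l; [apply opnorm_ge_0 | apply opnorm_bound].
Qed.

Lemma opnorm_le_sub A B : opnorm A <= opnorm (minus A B) + opnorm B.
Proof.
  replace A with (plus (minus A B) B) at 1; [apply opnorm_triangle | op_ring].
Qed.

Definition oplim {X : Type} (F : (X -> Prop) -> Prop) (f : X -> BOp H) (A : BOp H) : Prop :=
  forall eps, 0 < eps -> F (fun u => opnorm (minus (f u) A) < eps).

Lemma oplim_filterlim {X : Type} (F : (X -> Prop) -> Prop) (FF : Filter F)
  (f : X -> BOp H) A : oplim F f A <-> filterlim f F (locally A).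
Proof.
  split.
  - intros Hf P [e He]; unfold filtermap; generalize (Hf e (cond_pos e)).
    apply filter_imp; intros u Hu; apply He, Hu.
  - intros Hf eps He; apply (Hf (fun B => opnorm (minus B A) < eps)).
    exists (mkposreal eps He); intros B HB; exact HB.
Qed.

Lemma oplim_bound {X : Type} (F : (X -> Prop) -> Prop) (FF : Filter F)
  (f : X -> BOp H) A (u : X -> R) :
  (forall eps, 0 < eps -> F (fun x => u x < eps)) ->
  F (fun x => opnorm (minus (f x) A) <= u x) -> oplim F f A.
Proof.
  intros Hu Hf eps He; generalize (filter_and (F := F) _ _ (Hu eps He) Hf).
  apply filter_imp; intros x [H1 H2]; lra.
Qed.

Lemma oplim_plus {X : Type} (F : (X -> Prop) -> Prop) (FF : Filter F)
  (f g : X -> BOp H) A B :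
  oplim F f A -> oplim F g B -> oplim F (fun x => plus (f x) (g x)) (plus A B).
Proof.
  intros Hf Hg eps He.
  generalize (filter_and (F := F) _ _ (Hf (eps / 2) ltac:(lra)) (Hg (eps / 2) ltac:(lra))).
  apply filter_imp; intros x [H1 H2].
  replace (minus (plus (f x) (g x)) (plus A B)) with (plus (minus (f x) A) (minus (g x) B))
    by op_ring.
  eapply Rle_lt_trans; [apply opnorm_triangle|]; lra.
Qed.

Lemma small_mult {X : Type} (F : (X -> Prop) -> Prop) (FF : Filter F)
  (u : X -> R) (K : R) : 0 <= K ->
  (forall eps, 0 < eps -> F (fun x => u x < eps)) ->
  forall eps, 0 < eps -> F (fun x => K * u x < eps).
Proof.
  intros HK Hu eps He; generalize (Hu (eps / (K + 1)) ltac:(apply Rdiv_lt_0_compat; lra)).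
  apply filter_imp; intros x Hx.
  apply Rle_lt_trans with (K * (eps / (K + 1))).
  - apply Rmult_le_compat_l; lra.
  - apply Rmult_lt_reg_r with (K + 1); [lra|].
    replace (K * (eps / (K + 1)) * (K + 1)) with (K * eps) by (field; lra); lra.
Qed.

Lemma oplim_scal {X : Type} (F : (X -> Prop) -> Prop) (FF : Filter F)
  (a : X -> C) (b : C) (f : X -> BOp H) A :
  clim F a b -> oplim F f A -> oplim F (fun x => op_scal (a x) (f x)) (op_scal b A).
Proof.
  intros Ha Hf eps He.
  pose proof (opnorm_ge_0 A) as HA.
  generalize (filter_and (F := F) _ _ (Ha 1 Rlt_0_1) (filter_and (F := F) _ _
    (small_mult F FF (fun x => Cmod (a x - b)) _ HA Ha (eps / 2) ltac:(lra))
    (small_mult F FF (fun x => opnorm (minus (f x) A)) (Cmod b + 1)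
      ltac:(pose proof (Cmod_ge_0 b); lra) Hf (eps / 2) ltac:(lra)))).
  apply filter_imp; intros x [H1 [H2 H3]].
  replace (minus (op_scal (a x) (f x)) (op_scal b A))
    with (plus (op_scal (a x) (minus (f x) A)) (op_scal (a x - b)%C A)) by op_ring.
  eapply Rle_lt_trans; [apply opnorm_triangle|].
  pose proof (opnorm_op_scal (a x) (minus (f x) A)) as K1.
  pose proof (opnorm_op_scal (a x - b) A) as K2.
  assert (K3 : Cmod (a x) <= Cmod b + 1).
  { pose proof (Cmod_triangle (a x - b) b) as K.
    replace (a x - b + b)%C with (a x) in K by ring; lra. }
  pose proof (Rmult_le_compat_r _ _ _ (opnorm_ge_0 (minus (f x) A)) K3).
  lra.
Qed.

Lemma op_scal_R_linear A :
  is_linear (U := C_R_NormedModule) (V := BOp_NormedModule) (fun z => op_scal z A).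
Proof.
  split.
  - intros x y; change (plus x y) with (x + y)%C; op_ring.
  - intros k x.
    change (op_scal (scal k x) A = op_scal (RtoC k) (op_scal x A)).
    replace (scal k x) with (RtoC k * x)%C; [op_ring|].
    destruct x as [u v]; unfold scal; simpl; unfold prod_scal, scal; simpl.
    unfold mult, Cmult, RtoC; simpl; f_equal; ring.
  - exists (opnorm A + 1); pose proof (opnorm_ge_0 A); split; [lra|]; intros x.
    change (opnorm (op_scal x A) <= (opnorm A + 1) * norm x).
    rewrite <- Cmod_norm; eapply Rle_trans; [apply opnorm_op_scal|].
    pose proof (Cmod_ge_0 x); rewrite Rmult_comm; apply Rmult_le_compat_r; lra.
Qed.

Lemma op_sandwich_R_linear A B :
  is_linear (U := BOp_NormedModule) (V := BOp_NormedModule)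
    (fun T : BOp H => op_comp A (op_comp T B)).
Proof.
  split.
  - intros x y; op_ring.
  - intros k x.
    change (op_comp A (op_comp (op_scal (RtoC k) x) B) =
            op_scal (RtoC k) (op_comp A (op_comp x B))); op_ring.
  - pose proof (opnorm_ge_0 A) as HA; pose proof (opnorm_ge_0 B) as HB.
    pose proof (Rmult_le_pos _ _ HA HB).
    exists (opnorm A * opnorm B + 1); split; [lra|]; intros T.
    change (opnorm (op_comp A (op_comp T B)) <= (opnorm A * opnorm B + 1) * opnorm T).
    pose proof (opnorm_ge_0 T).
    eapply Rle_trans; [apply opnorm_comp|].
    eapply Rle_trans; [apply Rmult_le_compat_l; [exact HA | apply opnorm_comp]|].
    replace (opnorm A * (opnorm T * opnorm B)) with (opnorm A * opnorm B * opnorm T) by ring.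
    apply Rmult_le_compat_r; lra.
Qed.

Lemma op_path_integrable (l : list arc) (X : C -> BOp H) :
  (forall w, trace l w -> oplim (within (trace l) (locC w)) X (X w)) ->
  path_integrable (V := BOp_CompleteNormedModule) op_scal X l.
Proof.
  intros HX g Hg; apply within_continuous_ex_RInt; intros t Ht.
  apply (oplim_filterlim (within I01 (locally t)) _ (fun s => op_scal (arc_der g s) (X (g s)))).
  apply oplim_scal; [typeclasses eauto | |].
  - apply clim_locally_within; [typeclasses eauto | apply arc_der_clim].
  - intros eps He; apply (arc_continuous l g t Hg (fun u => opnorm (minus (X u) (X (g t))) < eps)).
    apply HX; [now apply trace_in | exact He].
Qed.

Lemma is_inverse_unique A B B' : is_inverse A B -> is_inverse A B' -> B = B'.
Proof.
  intros [_ HBA] [HAB' _].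
  apply BOp_eq; intros x.
  transitivity (B (A (B' x))).
  - f_equal; symmetry; exact (f_equal (fun T : BOp H => T x) HAB').
  - exact (f_equal (fun T : BOp H => T (B' x)) HBA).
Qed.

(** Uniqueness of the inverse is what entitles [iota] to return it. *)
Lemma resolvent_spec (c : BOp H) (z : C) : ~ spectrum c z ->
  is_inverse (minus (op_scal z op_id) c) (resolvent c z).
Proof.
  intros Hz; apply NNPP in Hz; destruct Hz as [B HB].
  apply (iota_correct (V := BOp_CompleteNormedModule)
           (is_inverse (minus (op_scal z op_id) c))).
  exists B; split; [exact HB|]; intros B' HB'; now apply is_inverse_unique with (2 := HB').
Qed.

Lemma resolvent_right (c : BOp H) (z : C) (x : H) : ~ spectrum c z ->
  minus (scal z (resolvent c z x)) (c (resolvent c z x)) = x.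
Proof.
  intros Hz; destruct (resolvent_spec c z Hz) as [K _].
  apply (f_equal (fun T : BOp H => T x)) in K.
  rewrite comp_apply, minus_apply in K; exact K.
Qed.

Lemma resolvent_left (c : BOp H) (z : C) (x : H) : ~ spectrum c z ->
  resolvent c z (minus (scal z x) (c x)) = x.
Proof.
  intros Hz; destruct (resolvent_spec c z Hz) as [_ K].
  apply (f_equal (fun T : BOp H => T x)) in K.
  rewrite comp_apply, minus_apply in K; exact K.
Qed.

Lemma resolvent_identity (c : BOp H) (z w : C) : ~ spectrum c z -> ~ spectrum c w ->
  minus (resolvent c w) (resolvent c z) =
  op_scal (z - w)%C (op_comp (resolvent c w) (resolvent c z)).
Proof.
  intros Hz Hw; apply BOp_eq; intros x; apply inner_ext; intros y.
  op_expand.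
  set (u := resolvent c z x).
  (* Since (z - c) u = x; applying the resolvent at w then gives the identity. *)
  assert (Hu : minus (scal w u) (c u) = plus x (scal (w - z)%C u)).
  { apply inner_ext; intros v; rewrite <- (resolvent_right c z x Hz) at 1; fold u.
    op_expand; ring. }
  pose proof (resolvent_left c w u Hw) as K; rewrite Hu in K.
  apply (f_equal (fun v => inner v y)) in K; revert K; op_expand; intros K.
  rewrite <- K; ring.
Qed.

(** Limits are taken within points already known to lie off the spectrum, so the resolvent identity
    suffices. *)
Lemma resolvent_continuous (c : BOp H) (D : C -> Prop) (z : C) :
  (forall w, D w -> ~ spectrum c w) -> D z ->
  oplim (within D (locC z)) (resolvent c) (resolvent c z).
Proof.
  intros HD Hz.
  pose proof (opnorm_ge_0 (resolvent c z)) as HR; set (r := opnorm (resolvent c z)) in *.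
  assert (Hd : forall w, D w -> opnorm (minus (resolvent c w) (resolvent c z)) <=
             Cmod (w - z) * (opnorm (resolvent c w) * r)).
  { intros w Hw; rewrite resolvent_identity by auto.
    eapply Rle_trans; [apply opnorm_op_scal|].
    rewrite Cmod_sym; apply Rmult_le_compat_l; [apply Cmod_ge_0 | apply opnorm_comp]. }
  apply oplim_bound with (u := fun w => 2 * r * r * Cmod (w - z)); [typeclasses eauto | |].
  - apply small_mult; [typeclasses eauto | | ].
    + pose proof (Rmult_le_pos _ _ HR HR); lra.
    + apply clim_locally_within; [typeclasses eauto | apply clim_id].
  - assert (Hp : 0 < / (2 * (r + 1))) by (apply Rinv_0_lt_compat; lra).
    unfold within; apply locally_Cmod; exists (/ (2 * (r + 1))); split; [exact Hp|].
    intros w Hw HDw; specialize (Hd w HDw).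
    pose proof (opnorm_le_sub (resolvent c w) (resolvent c z)) as K; fold r in K.
    pose proof (Cmod_ge_0 (w - z)); pose proof (opnorm_ge_0 (resolvent c w)) as HRw.
    set (s := opnorm (resolvent c w)) in *.
    (* Bootstrap: the resolvent identity gives s <= |w - z| s r + r, and for |w - z| < 1 / (2 (r +
       1)) the first term is absorbed, leaving s <= 2 r. *)
    assert (Hsr : Cmod (w - z) * (s * r) <= s / 2).
    { apply Rle_trans with (/ (2 * (r + 1)) * (s * (r + 1))).
      - apply Rmult_le_compat; [lra | now apply Rmult_le_pos | lra |].
        apply Rmult_le_compat_l; lra.
      - right; field; lra. }
    assert (Hs : s <= 2 * r) by lra.
    eapply Rle_trans; [exact Hd|].
    replace (2 * r * r * Cmod (w - z)) with (Cmod (w - z) * (2 * r * r)) by ring.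
    apply Rmult_le_compat_l; [lra|]; apply Rmult_le_compat_r; lra.
Qed.

(** From z R = 1 + c R and z R = 1 + R c: substituting the second into the first puts [c] on both
    sides of R. *)
Lemma resolvent_expansion (c : BOp H) (z : C) : ~ spectrum c z -> z <> RtoC 0 ->
  resolvent c z = plus (op_scal (/ z)%C op_id)
    (plus (op_scal (/ (z * z))%C c)
          (op_scal (/ (z * z))%C (op_comp c (op_comp (resolvent c z) c)))).
Proof.
  intros Hz Hz0; apply BOp_eq; intros x; apply inner_ext; intros y.
  assert (HR : forall v, scal z (resolvent c z v) = plus v (c (resolvent c z v))).
  { intros v; apply inner_ext; intros w.
    rewrite <- (resolvent_right c z v Hz) at 2; op_expand; ring. }
  assert (HL : scal z (resolvent c z x) = plus x (resolvent c z (c x))).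
  { apply inner_ext; intros w; pose proof (resolvent_left c z x Hz) as K.
    rewrite <- K at 2; op_expand; ring. }
  pose proof (f_equal (fun v => inner v y) (HR x)) as K1.
  pose proof (f_equal (fun v => inner (c v) y) HL) as K2.
  revert K1 K2; op_expand; intros K1 K2.
  set (p := inner (resolvent c z x) y) in *.
  set (q := inner (c (resolvent c z x)) y) in *.
  assert (E1 : p = (/ z * (inner x y + q))%C) by (rewrite <- K1; field; exact Hz0).
  assert (E2 : q = (/ z * (inner (c x) y + inner (c (resolvent c z (c x))) y))%C)
    by (rewrite <- K2; field; exact Hz0).
  rewrite E1, E2; field; exact Hz0.
Qed.

End Operators.

(** * Smooth compact operators *)

Lemma sum_n_additive {G G' : AbelianMonoid} (phi : G -> G') :
  (forall x y, phi (plus x y) = plus (phi x) (phi y)) ->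
  forall (u : nat -> G) n, phi (sum_n u n) = sum_n (fun k => phi (u k)) n.
Proof.
  intros Hphi u n; induction n as [|n IH]; [now rewrite !sum_O|].
  now rewrite !sum_Sn, Hphi, IH.
Qed.

(** N is any subadditive size, such as the modulus of one coordinate or the norm of one column; a
    double sum is thereby reduced to a single row or column. *)
Lemma sum_n_bound_single {G : AbelianMonoid} (N : G -> R) (u : nat -> G) (k : nat) (b : R) :
  (forall x y, N (plus x y) <= N x + N y) -> 0 <= b ->
  (forall j, j <> k -> N (u j) <= 0) -> N (u k) <= b ->
  forall n, N (sum_n u n) <= b.
Proof.
  intros HN Hb H0 Hk n.
  enough (N (sum_n u n) <= if le_dec k n then b else 0) by (destruct le_dec; lra).
  induction n as [|n IH].
  - rewrite sum_O; destruct (Nat.eq_dec k 0) as [-> | Hne].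
    + destruct le_dec as [|Hn]; [exact Hk | exfalso; apply Hn, le_n].
    + specialize (H0 0%nat ltac:(congruence)); destruct le_dec; lra.
  - rewrite sum_Sn; eapply Rle_trans; [apply HN|].
    destruct (Nat.eq_dec k (S n)) as [-> | Hne].
    + destruct (le_dec (S n) n) as [Hl|_]; [exfalso; exact (Nat.nle_succ_diag_l _ Hl)|].
      destruct le_dec as [|Hn]; [lra | exfalso; apply Hn, le_n].
    + specialize (H0 (S n) ltac:(congruence)).
      destruct (le_dec k n) as [Hl|Hl], (le_dec k (S n)) as [Hl'|Hl']; try lra.
      exfalso; apply Hl', Nat.le_trans with n; [exact Hl | apply Nat.le_succ_diag_r].
Qed.

(** [sum 1 / (1 + k)^2 <= 2], by comparison with the telescoping series of [1 / (k (1 + k))]. *)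
Lemma sum_n_bound_square {G : AbelianMonoid} (N : G -> R) (u : nat -> G) (b : R) :
  (forall x y, N (plus x y) <= N x + N y) -> 0 <= b ->
  (forall k, (1 + INR k) ^ 2 * N (u k) <= b) -> forall n, N (sum_n u n) <= 2 * b.
Proof.
  intros HN Hb Hu n.
  enough (N (sum_n u n) <= b * (2 - / (1 + INR n))).
  { pose proof (pos_INR n).
    assert (0 <= b * / (1 + INR n)).
    { apply Rmult_le_pos; [exact Hb|]; left; apply Rinv_0_lt_compat; lra. }
    lra. }
  induction n as [|n IH].
  - rewrite sum_O; specialize (Hu 0%nat); simpl in *; lra.
  - rewrite sum_Sn; eapply Rle_trans; [apply HN|].
    specialize (Hu (S n)); pose proof (pos_INR n) as Hn; rewrite S_INR in *.
    set (x := INR n) in *.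
    assert (H1 : N (u (S n)) <= b / (1 + (x + 1)) ^ 2).
    { apply Rmult_le_reg_l with ((1 + (x + 1)) ^ 2); [apply pow_lt; lra|].
      replace ((1 + (x + 1)) ^ 2 * (b / (1 + (x + 1)) ^ 2)) with b by (field; lra).
      exact Hu. }
    assert (H2 : b / (1 + (x + 1)) ^ 2 <= b * (/ (1 + x) - / (1 + (x + 1)))).
    { unfold Rdiv; apply Rmult_le_compat_l; [exact Hb|].
      replace (/ (1 + x) - / (1 + (x + 1))) with (/ ((1 + x) * (1 + (x + 1))))
        by (field; lra).
      apply Rinv_le_contravar; [apply Rmult_lt_0_compat; lra|].
      simpl; rewrite Rmult_1_r; apply Rmult_le_compat_r; lra. }
    lra.
Qed.

Section SmoothCompact.
Context {H : HilbertSpace}.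
Variable E : nat -> H.
Hypothesis hE : orthonormal_basis E.
Implicit Types A B T c : BOp H.

Lemma basis_norm (k : nat) : norm (E k) = 1.
Proof.
  pose proof (inner_norm H (E k)) as K; rewrite (proj1 hE), Nat.eqb_refl in K.
  apply RtoC_inj in K; pose proof (hs_norm_ge_0 H (E k)).
  assert (K2 : (norm (E k) - 1) * (norm (E k) + 1) = 0) by (simpl in K; lra).
  apply Rmult_integral in K2; lra.
Qed.

Lemma inner_basis_le (x : H) (k : nat) : Cmod (inner x (E k)) <= norm x.
Proof.
  eapply Rle_trans; [apply Cauchy_Schwarz|]; rewrite basis_norm; lra.
Qed.

Definition square_sum (a : nat -> nat -> C) (n : nat) : BOp H :=
  sum_n (fun k => sum_n (fun l => op_scal (a k l) (matrix_unit E k l)) n) n.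

Lemma smooth_compact_oplim c : smooth_compact E c <->
  exists a, rapid_decay a /\ oplim eventually (square_sum a) c.
Proof.
  split; intros [a [Ha Hc]]; exists a; (split; [exact Ha|]);
    apply (oplim_filterlim eventually _ (square_sum a) c); exact Hc.
Qed.

Lemma smooth_compact_plus A B :
  smooth_compact E A -> smooth_compact E B -> smooth_compact E (plus A B).
Proof.
  intros HA HB; apply smooth_compact_oplim in HA, HB; apply smooth_compact_oplim.
  destruct HA as [a [Ha HA]], HB as [b [Hb HB]].
  exists (fun k l => a k l + b k l)%C; split.
  - intros M N; destruct (Ha M N) as [C1 H1], (Hb M N) as [C2 H2].
    exists (C1 + C2); intros k l; specialize (H1 k l); specialize (H2 k l).
    assert (0 <= (1 + INR k) ^ M * (1 + INR l) ^ N).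
    { pose proof (pos_INR k); pose proof (pos_INR l).
      apply Rmult_le_pos; apply pow_le; lra. }
    pose proof (Rmult_le_compat_l _ _ _ H0 (Cmod_triangle (a k l) (b k l))); lra.
  - intros eps He; generalize (oplim_plus eventually _ _ _ _ _ HA HB eps He).
    apply filter_imp; intros n Hn.
    replace (square_sum (fun k l => a k l + b k l)%C n)
      with (plus (square_sum a n) (square_sum b n)); [exact Hn|].
    unfold square_sum.
    etransitivity; [symmetry; apply (sum_n_plus (G := BOp_AbelianMonoid))|].
    apply sum_n_ext; intros k.
    etransitivity; [symmetry; apply (sum_n_plus (G := BOp_AbelianMonoid))|].
    apply sum_n_ext; intros l; op_ring.
Qed.

Lemma smooth_compact_scal (a : C) A : smooth_compact E A -> smooth_compact E (op_scal a A).
Proof.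
  intros HA; apply smooth_compact_oplim in HA; apply smooth_compact_oplim.
  destruct HA as [b [Hb HA]]; exists (fun k l => a * b k l)%C; split.
  - intros M N; destruct (Hb M N) as [C1 H1].
    exists (Cmod a * C1); intros k l; specialize (H1 k l); rewrite Cmod_mult.
    pose proof (Rmult_le_compat_l _ _ _ (Cmod_ge_0 a) H1); lra.
  - intros eps He.
    generalize (oplim_scal eventually _ (fun _ => a) a _ _ (clim_const a) HA eps He).
    apply filter_imp; intros n Hn.
    replace (square_sum (fun k l => a * b k l)%C n) with (op_scal a (square_sum b n));
      [exact Hn|].
    unfold square_sum.
    assert (Hadd : forall x y : BOp H, op_scal a (plus x y) = plus (op_scal a x) (op_scal a y))
      by (intros; op_ring).
    rewrite (sum_n_additive (G := BOp_AbelianMonoid) (G' := BOp_AbelianMonoid)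
               (op_scal a) Hadd).
    apply sum_n_ext; intros k.
    rewrite (sum_n_additive (G := BOp_AbelianMonoid) (G' := BOp_AbelianMonoid)
               (op_scal a) Hadd).
    apply sum_n_ext; intros l; op_ring.
Qed.

Lemma matrix_unit_apply (k l : nat) (x : H) :
  matrix_unit E k l x = scal (inner x (E l)) (E k).
Proof. reflexivity. Qed.

Lemma inner_matrix_unit (k l j : nat) (x : H) :
  inner (matrix_unit E k l x) (E j) =
  (inner x (E l) * if Nat.eqb k j then RtoC 1 else RtoC 0)%C.
Proof. now rewrite matrix_unit_apply, inner_scal_l, (proj1 hE). Qed.

(** Only the units in row k reach the k-th coordinate, and quadratic decay in l makes that row
    summable. The bound does not depend on n, so it survives the limit. *)
Lemma square_sum_row (a : nat -> nat -> C) (k : nat) (x : H) (b : R) (n : nat) : 0 <= b ->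
  (forall l, (1 + INR l) ^ 2 * Cmod (a k l) <= b) ->
  Cmod (inner (square_sum a n x) (E k)) <= 2 * (b * norm x).
Proof.
  intros Hb Ha; pose proof (hs_norm_ge_0 H x) as Hx.
  assert (HN : forall A B : BOp H, Cmod (inner (plus A B x : H) (E k)) <=
            Cmod (inner (A x) (E k)) + Cmod (inner (B x) (E k))).
  { intros A B; rewrite plus_apply, inner_plus_l; apply Cmod_triangle. }
  assert (Hbx : 0 <= b * norm x) by now apply Rmult_le_pos.
  unfold square_sum.
  apply (sum_n_bound_single (G := BOp_AbelianMonoid)
    (fun A : BOp H => Cmod (inner (A x) (E k))) _ k); [exact HN | lra | |].
  - intros j Hj; rewrite <- (Rmult_0_r 2).
    apply (sum_n_bound_square (G := BOp_AbelianMonoid)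
      (fun A : BOp H => Cmod (inner (A x) (E k)))); [exact HN | lra|].
    intros l; rewrite scal_apply, inner_scal_l, inner_matrix_unit.
    rewrite (proj2 (Nat.eqb_neq j k) Hj), !Cmult_0_r, Cmod_0, Rmult_0_r; lra.
  - apply (sum_n_bound_square (G := BOp_AbelianMonoid)
      (fun A : BOp H => Cmod (inner (A x) (E k)))); [exact HN | exact Hbx|].
    intros l; rewrite scal_apply, inner_scal_l, inner_matrix_unit, Nat.eqb_refl.
    rewrite Cmult_1_r, Cmod_mult, <- Rmult_assoc.
    pose proof (pos_INR l).
    apply Rmult_le_compat; [|apply Cmod_ge_0 | apply Ha | apply inner_basis_le].
    apply Rmult_le_pos; [apply pow_le; lra | apply Cmod_ge_0].
Qed.

Lemma square_sum_column (a : nat -> nat -> C) (l : nat) (b : R) (n : nat) : 0 <= b ->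
  (forall k, (1 + INR k) ^ 2 * Cmod (a k l) <= b) ->
  norm (square_sum a n (E l)) <= 2 * b.
Proof.
  intros Hb Ha.
  assert (HN : forall A B : BOp H, norm (plus A B (E l) : H) <=
            norm (A (E l)) + norm (B (E l))).
  { intros A B; rewrite plus_apply; apply hs_triangle. }
  unfold square_sum.
  apply (sum_n_bound_square (G := BOp_AbelianMonoid)
    (fun A : BOp H => norm (A (E l)))); [exact HN | exact Hb|]; intros k.
  apply Rle_trans with ((1 + INR k) ^ 2 * Cmod (a k l)); [|apply Ha].
  pose proof (pos_INR k); apply Rmult_le_compat_l; [apply pow_le; lra|].
  assert (Hn : forall j, norm (op_scal (a k j) (matrix_unit E k j) (E l)) <=
            Cmod (a k j) * if Nat.eqb l j then 1 else 0).
  { intros j; rewrite scal_apply, matrix_unit_apply, (proj1 hE).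
    eapply Rle_trans; [apply hs_norm_scal|].
    apply Rmult_le_compat_l; [apply Cmod_ge_0|].
    eapply Rle_trans; [apply hs_norm_scal|].
    rewrite basis_norm; destruct Nat.eqb; rewrite ?Cmod_1, ?Cmod_0; lra. }
  apply (sum_n_bound_single (G := BOp_AbelianMonoid)
    (fun A : BOp H => norm (A (E l))) _ l); [exact HN | apply Cmod_ge_0 | |].
  - intros j Hj; eapply Rle_trans; [apply Hn|].
    rewrite (proj2 (Nat.eqb_neq l j)) by congruence; lra.
  - eapply Rle_trans; [apply Hn|]; rewrite Nat.eqb_refl; lra.
Qed.

Lemma rapid_decay_nonneg (a : nat -> nat -> C) (M N : nat) : rapid_decay a ->
  exists b, 0 <= b /\ forall k l, (1 + INR k) ^ M * ((1 + INR l) ^ N * Cmod (a k l)) <= b.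
Proof.
  intros Ha; destruct (Ha M N) as [b Hb]; exists b; split.
  - eapply Rle_trans; [|apply (Hb 0%nat 0%nat)]; simpl.
    rewrite Rplus_0_r, !pow1, !Rmult_1_l; apply Cmod_ge_0.
  - intros k l; rewrite <- Rmult_assoc; apply Hb.
Qed.

(** The vector x is arbitrary because this is later applied to the images B (c (E l)). Decay of
    order 2 in the column index is spent on summability. *)
Lemma smooth_compact_row c (M : nat) : smooth_compact E c ->
  exists D, 0 <= D /\ forall k x, (1 + INR k) ^ M * Cmod (inner (c x) (E k)) <= D * norm x.
Proof.
  intros Hc; apply smooth_compact_oplim in Hc; destruct Hc as [a [Ha Hc]].
  destruct (rapid_decay_nonneg a M 2 Ha) as [b [Hb Hab]].
  exists (2 * b); split; [lra|]; intros k x.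
  pose proof (pos_INR k) as Hk; pose proof (hs_norm_ge_0 H x) as Hx.
  assert (HP : 0 < (1 + INR k) ^ M) by (apply pow_lt; lra).
  set (P := (1 + INR k) ^ M) in *.
  assert (Hn : forall n, Cmod (inner (square_sum a n x) (E k)) <= 2 * (b / P * norm x)).
  { intros n; apply square_sum_row; [apply Rdiv_le_0_compat; lra|]; intros l.
    apply Rmult_le_reg_l with P; [exact HP|].
    replace (P * (b / P)) with b by (field; lra); apply Hab. }
  apply Rmult_le_reg_l with (/ P); [now apply Rinv_0_lt_compat|].
  rewrite <- Rmult_assoc, Rinv_l, Rmult_1_l by lra.
  apply Rle_plus_epsilon; intros e He.
  destruct (Hc (e / (norm x + 1)) ltac:(apply Rdiv_lt_0_compat; lra)) as [n0 Hn0].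
  specialize (Hn0 n0 (le_n n0)); specialize (Hn n0).
  set (A := square_sum a n0) in *.
  replace (c x) with (minus (A x) (minus A c x : H)) by
    (apply inner_ext; intros y; op_expand; ring).
  rewrite inner_minus_l; change (inner (A x) (E k) - inner (minus A c x : H) (E k))%C
    with (inner (A x) (E k) + - inner (minus A c x : H) (E k))%C.
  eapply Rle_trans; [apply Cmod_triangle|]; rewrite Cmod_opp.
  assert (K : Cmod (inner (minus A c x : H) (E k)) <= e).
  { eapply Rle_trans; [apply inner_basis_le|].
    eapply Rle_trans; [apply opnorm_bound|].
    apply Rle_trans with (e / (norm x + 1) * norm x); [apply Rmult_le_compat_r; lra|].
    apply Rmult_le_reg_r with (norm x + 1); [lra|].
    replace (e / (norm x + 1) * norm x * (norm x + 1)) with (e * norm x) by (field; lra).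
    lra. }
  apply Rplus_le_compat; [|exact K].
  eapply Rle_trans; [exact Hn|]; right; field; lra.
Qed.

(** The counterpart for the right-hand factor; here decay of order 2 in the row index is spent on
    summability. *)
Lemma smooth_compact_column c (N : nat) : smooth_compact E c ->
  exists D, 0 <= D /\ forall l, (1 + INR l) ^ N * norm (c (E l)) <= D.
Proof.
  intros Hc; apply smooth_compact_oplim in Hc; destruct Hc as [a [Ha Hc]].
  destruct (rapid_decay_nonneg a 2 N Ha) as [b [Hb Hab]].
  exists (2 * b); split; [lra|]; intros l.
  pose proof (pos_INR l) as Hl.
  assert (HP : 0 < (1 + INR l) ^ N) by (apply pow_lt; lra).
  set (P := (1 + INR l) ^ N) in *.
  assert (Hn : forall n, norm (square_sum a n (E l)) <= 2 * (b / P)).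
  { intros n; apply square_sum_column; [apply Rdiv_le_0_compat; lra|]; intros k.
    apply Rmult_le_reg_l with P; [exact HP|].
    replace (P * (b / P)) with b by (field; lra).
    specialize (Hab k l); fold P in Hab; lra. }
  apply Rmult_le_reg_l with (/ P); [now apply Rinv_0_lt_compat|].
  rewrite <- Rmult_assoc, Rinv_l, Rmult_1_l by lra.
  apply Rle_plus_epsilon; intros e He.
  destruct (Hc e He) as [n0 Hn0].
  specialize (Hn0 n0 (le_n n0)); specialize (Hn n0).
  set (A := square_sum a n0) in *.
  replace (c (E l)) with (plus (A (E l)) (opp (minus A c (E l) : H))) by
    (apply inner_ext; intros y; op_expand; rewrite inner_opp_l; op_expand; ring).
  eapply Rle_trans; [apply hs_triangle|]; rewrite hs_norm_opp.
  pose proof (opnorm_bound (minus A c) (E l)) as K; rewrite basis_norm in K.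
  apply Rplus_le_compat; [|lra].
  eapply Rle_trans; [exact Hn|]; right; field; lra.
Qed.

Lemma smooth_compact_spectrum_0 c : smooth_compact E c -> spectrum c (RtoC 0).
Proof.
  intros Hc [B [_ HB]].
  destruct (smooth_compact_column c 1 Hc) as [D [HD HDl]].
  pose proof (opnorm_ge_0 B) as HB0.
  (* An inverse B of -c would give 1 = |E l| <= |B| D / (1 + l), false for this l. *)
  destruct (INR_unbounded (opnorm B * D)) as [l Hl].
  specialize (HDl l); rewrite pow_1 in HDl; pose proof (pos_INR l).
  apply (f_equal (fun T : BOp H => T (E l))) in HB.
  rewrite comp_apply, id_apply in HB.
  assert (K : norm (E l) <= opnorm B * norm (c (E l))).
  { rewrite <- HB at 1; eapply Rle_trans; [apply opnorm_bound|].
    apply Rmult_le_compat_l; [exact HB0|].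
    replace (minus (op_scal 0 op_id) c (E l) : H) with (opp (c (E l))).
    - rewrite hs_norm_opp; lra.
    - apply inner_ext; intros y; rewrite inner_opp_l; op_expand; ring. }
  rewrite basis_norm in K.
  assert (1 * (1 + INR l) <= opnorm B * norm (c (E l)) * (1 + INR l)).
  { apply Rmult_le_compat_r; lra. }
  assert (opnorm B * ((1 + INR l) * norm (c (E l))) <= opnorm B * D).
  { now apply Rmult_le_compat_l. }
  lra.
Qed.

Definition basis_proj (n : nat) : BOp H := sum_n (fun k => matrix_unit E k k) n.

Lemma basis_proj_inner (n k : nat) (x : H) : (k <= n)%nat ->
  inner (basis_proj n x) (E k) = inner x (E k).
Proof.
  enough (K : inner (basis_proj n x) (E k) =
              if le_dec k n then inner x (E k) else RtoC 0).
  { rewrite K; intros Hkn; destruct le_dec; [reflexivity | contradiction]. }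
  unfold basis_proj; induction n as [|n IH].
  - rewrite sum_O, inner_matrix_unit; destruct k as [|k]; simpl; ring.
  - rewrite sum_Sn.
    etransitivity; [apply (inner_plus_l H)|].
    rewrite IH, inner_matrix_unit.
    destruct (Nat.eqb_spec (S n) k) as [<- | Hne].
    + destruct (le_dec (S n) n) as [Hl|_]; [exfalso; exact (Nat.nle_succ_diag_l _ Hl)|].
      destruct le_dec as [|Hn]; [ring | exfalso; apply Hn, le_n].
    + destruct (le_dec k n) as [Hl|Hl], (le_dec k (S n)) as [Hl'|Hl']; try ring.
      * exfalso; apply Hl', Nat.le_trans with n; [exact Hl | apply Nat.le_succ_diag_r].
      * exfalso; apply Nat.le_succ_r in Hl'; destruct Hl'; congruence.
Qed.

(** For P = [basis_proj n], |P x|^2 equals the inner product of P x with x, and Cauchy-Schwarz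
    bounds it by |P x| |x|. The induction needs smaller projections on the left with n fixed on the
    right. *)
Lemma basis_proj_norm (n : nat) : opnorm (basis_proj n) <= 1.
Proof.
  apply opnorm_le; [lra|]; intros x; rewrite Rmult_1_l.
  assert (Hadd : forall y (A B : BOp H), inner (plus A B x : H) y =
            (inner (A x) y + inner (B x) y)%C).
  { intros y A B; rewrite plus_apply; apply inner_plus_l. }
  assert (K : forall m, (m <= n)%nat ->
            inner (basis_proj m x) (basis_proj n x) = inner (basis_proj m x) x).
  { assert (Ku : forall k, (k <= n)%nat ->
      inner (matrix_unit E k k x) (basis_proj n x) = inner (matrix_unit E k k x) x).
    { intros k Hk; rewrite !matrix_unit_apply, !inner_scal_l; f_equal.
      rewrite (inner_conj H (basis_proj n x)), (inner_conj H x).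
      now rewrite basis_proj_inner. }
    induction m as [|m IH]; intros Hm; unfold basis_proj at 1 3.
    - rewrite sum_O; auto.
    - rewrite sum_Sn; etransitivity; [apply Hadd|]; etransitivity; [|symmetry; apply Hadd].
      apply f_equal2; [apply IH | now apply Ku].
      apply Nat.le_trans with (S m); [apply Nat.le_succ_diag_r | exact Hm]. }
  specialize (K n (le_n n)); rewrite inner_norm in K.
  pose proof (Cauchy_Schwarz H (basis_proj n x) x) as K1; rewrite <- K in K1.
  rewrite Cmod_R, Rabs_pos_eq in K1 by apply pow2_ge_0.
  pose proof (hs_norm_ge_0 H (basis_proj n x)) as K2.
  destruct (Rle_lt_or_eq_dec _ _ K2) as [K3 | K3].
  - apply Rmult_le_reg_l with (norm (basis_proj n x)); [exact K3|].
    eapply Rle_trans; [|exact K1]; right; ring.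
  - rewrite <- K3; apply hs_norm_ge_0.
Qed.

Lemma basis_proj_matrix_unit (n k l : nat) : (k <= n)%nat ->
  op_comp (basis_proj n) (matrix_unit E k l) = matrix_unit E k l.
Proof.
  intros Hk; apply BOp_eq; intros x; rewrite comp_apply, matrix_unit_apply, bop_scal.
  f_equal.
  assert (K : forall m, basis_proj m (E k) = if le_dec k m then E k else zero).
  { induction m as [|m IH]; unfold basis_proj.
    - rewrite sum_O, matrix_unit_spec by exact hE.
      now destruct k as [|k'].
    - rewrite sum_Sn; etransitivity; [apply plus_apply|].
      etransitivity; [apply f_equal2; [exact IH | apply (matrix_unit_spec E _ _ _ hE)]|].
      destruct (Nat.eqb_spec k (S m)) as [-> | Hne].
      + destruct (le_dec (S m) m) as [Hl|_]; [exfalso; exact (Nat.nle_succ_diag_l _ Hl)|].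
        destruct le_dec as [|Hn]; [|exfalso; apply Hn, le_n].
        apply (plus_zero_l (G := CompleteNormedModule.AbelianGroup _ H)).
      + etransitivity; [apply (plus_zero_r (G := CompleteNormedModule.AbelianGroup _ H))|].
        destruct (le_dec k m) as [Hl|Hl], (le_dec k (S m)) as [Hl'|Hl']; try reflexivity.
        * exfalso; apply Hl', Nat.le_trans with m; [exact Hl | apply Nat.le_succ_diag_r].
        * exfalso; apply Nat.le_succ_r in Hl'; destruct Hl'; congruence. }
  rewrite K; now destruct le_dec.
Qed.

Lemma matrix_unit_basis_proj (n k l : nat) : (l <= n)%nat ->
  op_comp (matrix_unit E k l) (basis_proj n) = matrix_unit E k l.
Proof.
  intros Hl; apply BOp_eq; intros x; rewrite comp_apply, !matrix_unit_apply.
  now rewrite basis_proj_inner.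
Qed.

Lemma op_comp_plus_r A B T : op_comp A (plus B T) = plus (op_comp A B) (op_comp A T).
Proof. op_ring. Qed.

Lemma op_comp_plus_l A B T : op_comp (plus A B) T = plus (op_comp A T) (op_comp B T).
Proof. op_ring. Qed.

Lemma basis_proj_square_sum (a : nat -> nat -> C) (n : nat) :
  op_comp (basis_proj n) (square_sum a n) = square_sum a n.
Proof.
  unfold square_sum.
  rewrite (sum_n_additive (G := BOp_AbelianMonoid) (G' := BOp_AbelianMonoid)
             (op_comp (basis_proj n)) (op_comp_plus_r _)).
  apply sum_n_ext_loc; intros k Hk.
  rewrite (sum_n_additive (G := BOp_AbelianMonoid) (G' := BOp_AbelianMonoid)
             (op_comp (basis_proj n)) (op_comp_plus_r _)).
  apply sum_n_ext; intros l.
  rewrite <- (basis_proj_matrix_unit n k l Hk) at 2; op_ring.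
Qed.

Lemma square_sum_basis_proj (a : nat -> nat -> C) (n : nat) :
  op_comp (square_sum a n) (basis_proj n) = square_sum a n.
Proof.
  unfold square_sum.
  rewrite (sum_n_additive (G := BOp_AbelianMonoid) (G' := BOp_AbelianMonoid)
             (fun T : BOp H => op_comp T (basis_proj n)) (fun A B => op_comp_plus_l A B _)).
  apply sum_n_ext_loc; intros k Hk.
  rewrite (sum_n_additive (G := BOp_AbelianMonoid) (G' := BOp_AbelianMonoid)
             (fun T : BOp H => op_comp T (basis_proj n)) (fun A B => op_comp_plus_l A B _)).
  apply sum_n_ext_loc; intros l Hl.
  rewrite <- (matrix_unit_basis_proj n k l Hl) at 2; op_ring.
Qed.

(** The square partial sums of the matrix of T are its compressions, so convergence of the double
    series becomes P T P -> T. *)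
Lemma basis_proj_sandwich T (n : nat) :
  op_comp (basis_proj n) (op_comp T (basis_proj n)) =
  square_sum (fun k l => inner (T (E l)) (E k)) n.
Proof.
  unfold basis_proj at 1; unfold square_sum.
  rewrite (sum_n_additive (G := BOp_AbelianMonoid) (G' := BOp_AbelianMonoid)
    (fun A : BOp H => op_comp A (op_comp T (basis_proj n))) (fun A B => op_comp_plus_l A B _)).
  apply sum_n_ext; intros k; unfold basis_proj.
  rewrite (sum_n_additive (G := BOp_AbelianMonoid) (G' := BOp_AbelianMonoid)
    (fun A : BOp H => op_comp (matrix_unit E k k) (op_comp T A))).
  - apply sum_n_ext; intros l; apply BOp_eq; intros x.
    rewrite !comp_apply, scal_apply, !matrix_unit_apply, bop_scal, inner_scal_l.
    rewrite Cmult_comm; symmetry; apply (scal_assoc (inner (T (E l)) (E k))).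
  - intros A B; op_ring.
Qed.

Lemma smooth_compact_sandwich c B :
  smooth_compact E c -> smooth_compact E (op_comp c (op_comp B c)).
Proof.
  intros Hc; apply smooth_compact_oplim.
  set (T := op_comp c (op_comp B c)).
  exists (fun k l => inner (T (E l)) (E k)); split.
  - intros M N.
    destruct (smooth_compact_row c M Hc) as [D1 [HD1 K1]].
    destruct (smooth_compact_column c N Hc) as [D2 [HD2 K2]].
    exists (D1 * (opnorm B * D2)); intros k l; unfold T; rewrite !comp_apply.
    pose proof (pos_INR k); pose proof (pos_INR l).
    assert (Hl : 0 <= (1 + INR l) ^ N) by (apply pow_le; lra).
    rewrite (Rmult_comm ((1 + INR k) ^ M)), Rmult_assoc.
    eapply Rle_trans; [apply Rmult_le_compat_l; [exact Hl | apply K1]|].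
    apply Rle_trans with (D1 * (opnorm B * ((1 + INR l) ^ N * norm (c (E l))))).
    + replace (D1 * (opnorm B * ((1 + INR l) ^ N * norm (c (E l)))))
        with ((1 + INR l) ^ N * (D1 * (opnorm B * norm (c (E l))))) by ring.
      apply Rmult_le_compat_l; [exact Hl|]; apply Rmult_le_compat_l; [exact HD1|].
      apply opnorm_bound.
    + apply Rmult_le_compat_l; [exact HD1|]; apply Rmult_le_compat_l; [apply opnorm_ge_0|].
      apply K2.
  - apply smooth_compact_oplim in Hc; destruct Hc as [a [_ Hc]].
    (* Each of the two error terms below costs 2 |B| |c| times the distance from c to its partial
       sum. *)
    pose (K := 4 * (opnorm B * opnorm c)).
    pose proof (opnorm_ge_0 B) as HB; pose proof (opnorm_ge_0 c) as Hc0.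
    assert (HBc : 0 <= opnorm B * opnorm c) by now apply Rmult_le_pos.
    apply oplim_bound with (u := fun n => K * opnorm (minus (square_sum a n) c));
      [typeclasses eauto | |].
    + apply small_mult; [typeclasses eauto | unfold K; lra | exact Hc].
    + apply filter_forall; intros n; rewrite <- basis_proj_sandwich.
      set (P := basis_proj n); set (cn := square_sum a n).
      set (d := opnorm (minus cn c)).
      assert (Hd : 0 <= d) by apply opnorm_ge_0.
      assert (HP : opnorm P <= 1) by apply basis_proj_norm.
      pose proof (opnorm_ge_0 P) as HP0.
      (* P fixes the partial sum cn, so P c - c = P (c - cn) + (cn - c). *)
      assert (HPc : opnorm (minus (op_comp P c) c) <= 2 * d).
      { replace (minus (op_comp P c) c)
          with (plus (op_comp P (minus c cn)) (minus cn c)).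
        - eapply Rle_trans; [apply opnorm_triangle|].
          pose proof (opnorm_comp P (minus c cn)) as K1.
          rewrite (opnorm_minus_sym c cn) in K1; fold d in K1; fold d.
          pose proof (Rmult_le_compat_r _ _ _ Hd HP); lra.
        - assert (E0 : op_comp P cn = cn) by apply basis_proj_square_sum.
          rewrite <- E0 at 2; op_ring. }
      assert (HcP : opnorm (minus (op_comp c P) c) <= 2 * d).
      { replace (minus (op_comp c P) c)
          with (plus (op_comp (minus c cn) P) (minus cn c)).
        - eapply Rle_trans; [apply opnorm_triangle|].
          pose proof (opnorm_comp (minus c cn) P) as K1.
          rewrite (opnorm_minus_sym c cn) in K1; fold d in K1; fold d.
          pose proof (Rmult_le_compat_l _ _ _ Hd HP); lra.
        - assert (E0 : op_comp cn P = cn) by apply square_sum_basis_proj.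
          rewrite <- E0 at 2; op_ring. }
      (* One factor [c] is compressed at a time: P c B c P - c B c = (P c - c) B c P + c B (c P -
         c). *)
      replace (minus (op_comp P (op_comp T P)) T)
        with (plus (op_comp (minus (op_comp P c) c) (op_comp B (op_comp c P)))
                   (op_comp c (op_comp B (minus (op_comp c P) c))))
        by (unfold T; op_ring).
      eapply Rle_trans; [apply opnorm_triangle|].
      replace (K * d) with (2 * d * (opnorm B * (opnorm c * 1)) + opnorm c * (opnorm B * (2 * d)))
        by (unfold K; ring).
      apply Rplus_le_compat.
      * eapply Rle_trans; [apply opnorm_comp|].
        apply Rmult_le_compat; try apply opnorm_ge_0; [exact HPc|].
        eapply Rle_trans; [apply opnorm_comp|]; apply Rmult_le_compat_l; [exact HB|].
        eapply Rle_trans; [apply opnorm_comp|]; apply Rmult_le_compat_l; [exact Hc0 | exact HP].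
      * eapply Rle_trans; [apply opnorm_comp|]; apply Rmult_le_compat_l; [exact Hc0|].
        eapply Rle_trans; [apply opnorm_comp|]; apply Rmult_le_compat_l; [exact HB | exact HcP].
Qed.

End SmoothCompact.

(** * The contour integral of the resolvent expansion *)

Theorem theorem2p10 (H : HilbertSpace) (E : nat -> H)
  (hE : orthonormal_basis E)
  (c : BOp H) (hc : smooth_compact E c)
  (Om : C -> Prop) (hOm : open (T := C_UniformSpace) Om)
  (hspec : forall z : C, spectrum c z -> Om z)
  (f : C -> C) (hf : holomorphic_on Om f) (hf0 : f (RtoC 0) = RtoC 0)
  (G : list (list arc)) (hG : contour_around G (spectrum c) Om) :
  smooth_compact E (hol_calc f c G).
Proof.
  destruct hG as [hclosed [hon [_ hout]]].
  pose proof (smooth_compact_spectrum_0 E hE c hc) as hspec0.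
  pose (l := concat G).
  assert (htrace : forall w, trace l w -> Om w /\ ~ spectrum c w).
  { intros w [g [t [Hg [Ht <-]]]]; apply in_concat in Hg; destruct Hg as [s [Hs Hg]].
    apply hon; now exists s, g, t. }
  (* The contour avoids the spectrum, which contains 0, so division by w is legitimate along it. *)
  assert (hnz : forall w, trace l w -> w <> RtoC 0).
  { intros w Hw ->; now apply (htrace _ Hw). }
  assert (hholo : holo Om f).
  { intros z Hz; destruct (hf z Hz) as [d Hd]; exists d; now apply is_derive_cderiv. }
  assert (hwind : forall z, ~ Om z -> cint (fun w => / (w - z))%C l = RtoC 0).
  { intros z Hz; specialize (hout z Hz).
    change (inv_2pi_i * cint (fun w => / (w - z)) l = 0)%C in hout.
    replace (cint (fun w => / (w - z))%C l)
      with (two_pi_i * (inv_2pi_i * cint (fun w => / (w - z)) l))%C.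
    - rewrite hout; ring.
    - unfold inv_2pi_i; fold two_pi_i; field; apply two_pi_i_neq_0. }
  (* Because f(0) = 0 the integrand is the difference quotient of f at 0, a point of [Om] off the
     contour. *)
  assert (hcauchy : cint (fun w => f w * / w)%C l = RtoC 0).
  { rewrite <- (Cauchy_homology Om f l (RtoC 0) hOm hholo (contour_cycle G hclosed)
                  (fun w Hw => proj1 (htrace w Hw)) hwind (hspec _ hspec0)).
    - apply cint_ext; intros w _; rewrite hf0.
      replace (f w - 0)%C with (f w) by ring; replace (w - 0)%C with w by ring; reflexivity.
    - intros H0; now apply (htrace _ H0). }
  assert (hfc : path_continuous l f).
  { apply continuous_path_continuous; intros w Hw.
    destruct (hholo w (proj1 (htrace w Hw))) as [d Hd]; eapply cderiv_continuous, Hd. }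
  assert (hf1 : path_continuous l (fun w => f w * / w)%C).
  { apply path_continuous_mult; [exact hfc|].
    apply path_continuous_inv; [apply path_continuous_id | exact hnz]. }
  assert (hf2 : path_continuous l (fun w => f w * / (w * w))%C).
  { apply path_continuous_mult; [exact hfc|].
    apply path_continuous_inv; [apply path_continuous_mult; apply path_continuous_id|].
    intros w Hw; apply Cmult_neq_0; now apply hnz. }
  pose (X := fun w => op_scal (f w * / (w * w))%C (resolvent c w)).
  assert (hX : path_integrable (V := BOp_CompleteNormedModule) op_scal X l).
  { apply op_path_integrable; intros w Hw; apply oplim_scal; [typeclasses eauto | now apply hf2|].
    apply resolvent_continuous; [|exact Hw]; intros u Hu; now apply htrace. }
  assert (hscal : forall T : BOp H, forall a b, op_scal (a * b)%C T = op_scal a (op_scal b T)).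
  { intros; op_ring. }
  (* The three terms of the expansion are bounded linear images of simpler integrands, under z -> z
     id, z -> z c and T -> c T c; each integral is moved inside its map. *)
  destruct (path_integral_linear (U := C_R_CompleteNormedModule)
    (V := BOp_CompleteNormedModule) Cmult op_scal (fun z => op_scal z op_id) _ l
    (op_scal_R_linear op_id) (hscal op_id) (path_continuous_integrable _ _ hf1)) as [I1 E1].
  destruct (path_integral_linear (U := C_R_CompleteNormedModule)
    (V := BOp_CompleteNormedModule) Cmult op_scal (fun z => op_scal z c) _ l
    (op_scal_R_linear c) (hscal c) (path_continuous_integrable _ _ hf2)) as [I2 E2].
  destruct (path_integral_linear (U := BOp_CompleteNormedModule)
    (V := BOp_CompleteNormedModule) op_scal op_scal (fun T : BOp H => op_comp c (op_comp T c))
    X l (op_sandwich_R_linear c c) ltac:(intros; op_ring) hX) as [I3 E3].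
  assert (hplus : forall a (x y : BOp H), op_scal a (plus x y) = plus (op_scal a x) (op_scal a y)).
  { intros; op_ring. }
  destruct (path_integral_plus (V := BOp_CompleteNormedModule) op_scal _ _ l hplus I2 I3)
    as [I23 E23].
  destruct (path_integral_plus (V := BOp_CompleteNormedModule) op_scal _ _ l hplus I1 I23)
    as [_ E123].
  assert (hzero : forall T : BOp H, plus (op_scal (RtoC 0) op_id) T = T).
  { intros; op_ring. }
  assert (Emain : hol_calc f c G = op_scal inv_2pi_i
    (plus (op_scal (cint (fun w => f w * / (w * w))%C l) c)
          (op_comp c (op_comp (path_integral (V := BOp_CompleteNormedModule) op_scal X l) c)))).
  { unfold hol_calc.
    change (contour_integral op_scal (fun z => op_scal (f z) (resolvent c z)) G)
      with (path_integral (V := BOp_CompleteNormedModule) op_scal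
              (fun z => op_scal (f z) (resolvent c z)) l).
    rewrite (path_integral_ext (V := BOp_CompleteNormedModule) op_scal _
      (fun w => plus (op_scal (f w * / w)%C op_id)
        (plus (op_scal (f w * / (w * w))%C c) (op_comp c (op_comp (X w) c))))).
    - apply f_equal; etransitivity; [exact E123|].
      etransitivity; [apply f_equal2; [exact E1 | exact E23]|].
      etransitivity; [apply f_equal2; [reflexivity | apply f_equal2; [exact E2 | exact E3]]|].
      change (path_integral (V := C_R_CompleteNormedModule) Cmult (fun w => f w * / w)%C l)
        with (cint (fun w => f w * / w)%C l).
      rewrite hcauchy.
      exact (hzero _).
    - intros w Hw; unfold X.
      rewrite (resolvent_expansion c w (proj2 (htrace w Hw)) (hnz w Hw)) at 1; op_ring. }
  (* With the multiple of the identity gone, only a multiple of [c] and a sandwich by [c] remain. *)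
  rewrite Emain; apply smooth_compact_scal, smooth_compact_plus.
  - now apply smooth_compact_scal.
  - now apply smooth_compact_sandwich.
Qed.
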